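(* Let $M^5\subset\mathbb C^4$ be a maximally minimal CR-generic real analytic submanifold with $R\equiv0$. After determining the three group parameters $\mathsf b=\mathsf a(-iB+\frac i3\overline Q)$, $\mathsf c=\mathsf a\overline{\mathsf a}\,\overline B$, $\mathsf d=\overline{\mathsf a}(-i\mathcal L(\overline B)+iP+\frac{2i}3\overline BQ)$, the further essential torsion functions become $$V_1,\quad V_3,\quad V_4,\quad W_5,\quad W_7,\quad W_9,\quad X_1:=U_2+2W_8+\overline W_8,\quad X_2:=\overline U_1+V_2+\overline W_6,$$ and $V_4$ enables one (by the normalization $V_4=0$) to determine $$\mathsf e:=\mathsf a\big(i\overline{\mathcal L}(\overline B)-iA-2iB\overline B+\tfrac i3\overline B\,\overline Q\big),$$ while in fact, with this value of $\mathsf e$, $V_3\equiv0$, $W_7\equiv0$, $X_2\equiv0$, and $$V_1=\frac1{\mathsf a^2\overline{\mathsf a}^2}\,\mathcal P_1,\qquad W_5=\frac1{\mathsf a\overline{\mathsf a}^3}\,\mathcal P_2,$$ where $\mathcal P_1,\mathcal P_2$ are polynomials in the $\{\mathcal L,\overline{\mathcal L}\}$-derivatives of $P,Q,R,A,B$ (and conjugates), and $$W_9=\frac{i}{9\overline{\mathsf a}^2}\Big(18\overline{\mathcal L}(B)-3\overline{\mathcal L}(\overline Q)-9\overline P-12B\overline Q+9B^2+\overline Q^2\Big),$$ $$X_1=-\frac{i}{9\mathsf a\overline{\mathsf a}}\Big(6\overline{\mathcal L}(Q)+6\mathcal L(\overline Q)-18\mathcal L(B)-18\overline{\mathcal L}(\overline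 B)+27B\overline B-6BQ-6\overline B\,\overline Q+2Q\overline Q+9A\Big).$$
   Context: $M^5\subset\mathbb C^4$ is a local real analytic CR-generic graph $v_j=\varphi_j(x,y,u_1,u_2,u_3)$, $j=1,2,3$, in coordinates $z=x+iy$, $w_j=u_j+iv_j$, with $\varphi_j(0)=0$, $d\varphi_j(0)=0$. $\overline{\mathcal L}$ is the unique local generator of $T^{0,1}M$ of the intrinsic form $\partial_{\overline z}$ plus a combination of $\partial_{u_1},\partial_{u_2},\partial_{u_3}$; $\mathcal L$ is its conjugate; $\mathcal T:=i[\mathcal L,\overline{\mathcal L}]$, $\mathcal S:=[\mathcal L,\mathcal T]$, $\overline{\mathcal S}:=[\overline{\mathcal L},\mathcal T]$; maximally minimal means these five fields form a frame for $\mathbb C\otimes_{\mathbb R} TM$. Functions $P,Q,R,B$ (complex) and $A$ (real): $[\mathcal L,\mathcal S]=P\mathcal T+Q\mathcal S+R\overline{\mathcal S}$, $[\overline{\mathcal L},\mathcal S]=[\mathcal L,\overline{\mathcal S}]=A\mathcal T+B\mathcal S+\overline B\,\overline{\mathcal S}$. Dual coframe of $\{\overline{\mathcal S},\mathcal S,\mathcal T,\overline{\mathcal L},\mathcal L\}$: $\{\overline\sigma_0,\sigma_0,\rho_0,\overline\zeta_0,\zeta_0\}$. The lifted coframe with general group parameters $\mathsf a\in\mathbb C^*$, $\mathsf b,\mathsf c,\mathsf d,\mathsf e\in\mathbb C$ is $\sigma=\mathsf a^2\overline{\mathsf a}\sigma_0$, $\rho=\overline{\mathsf c}\,\overline\sigma_0+\mathsf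 c\sigma_0+\mathsf a\overline{\mathsf a}\rho_0$, $\zeta=\overline{\mathsf d}\,\overline\sigma_0+\mathsf e\sigma_0+\mathsf b\rho_0+\mathsf a\zeta_0$. After inserting the values of $\mathsf b,\mathsf c,\mathsf d$, these are forms on $M\times\mathbb C^*\times\mathbb C$ with remaining parameters $(\mathsf a,\mathsf e)$. With $\beta_1=\frac{d\mathsf a}{\mathsf a}$ and $\beta_2=\frac{d\mathsf e}{\mathsf a^2\overline{\mathsf a}}-\frac{\mathsf e}{\mathsf a^3\overline{\mathsf a}}d\mathsf a$, the torsion coefficients are the uniquely determined functions in $$d\sigma=(2\beta_1+\overline\beta_1)\wedge\sigma+U_1\sigma\wedge\overline\sigma+U_2\sigma\wedge\rho+U_3\sigma\wedge\zeta+U_4\sigma\wedge\overline\zeta+U_5\overline\sigma\wedge\rho+U_6\overline\sigma\wedge\zeta+U_7\overline\sigma\wedge\overline\zeta+\rho\wedge\zeta,$$ $$d\rho=(\beta_1+\overline\beta_1)\wedge\rho+V_1\sigma\wedge\overline\sigma+V_2\sigma\wedge\rho+V_3\sigma\wedge\zeta+V_4\sigma\wedge\overline\zeta+\overline V_2\overline\sigma\wedge\rho+\overline V_4\overline\sigma\wedge\zeta+\overline V_3\overline\sigma\wedge\overline\zeta+V_8\rho\wedge\zeta+\overline V_8\rho\wedge\overline\zeta+i\zeta\wedge\overline\zeta,$$ $$d\zeta=\beta_2\wedge\sigma+\beta_1\wedge\zeta+W_1\sigma\wedge\overline\sigma+W_2\sigma\wedge\rho+W_3\sigma\wedge\zeta+W_4\sigma\wedge\overline\zeta+W_5\overline\sigma\wedge\rho+W_6\overline\sigma\wedge\zeta+W_7\overline\sigma\wedge\overline\zeta+W_8\rho\wedge\zeta+W_9\rho\wedge\overline\zeta+W_{10}\zeta\wedge\overline\zeta.$$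 A linear combination of torsion coefficients (and conjugates) is essential if it is unchanged when $\beta_1,\beta_2$ are modified by adding arbitrary linear combinations of $\sigma,\overline\sigma,\rho,\zeta,\overline\zeta$ (with conjugate modifications of $\overline\beta_1,\overline\beta_2$), the torsion coefficients being recomputed. ''With this value of $\mathsf e$'' means substituting $\mathsf e$ in the coefficient functions. *)

(* Defs.v *)
From mathcomp Require Import all_boot all_order all_algebra.
From mathcomp Require Import all_classical all_reals all_analysis.
From mathcomp Require Import complex.
Set Implicit Arguments.
Unset Strict Implicit.
Unset Printing Implicit Defensive.
Import Order.TTheory GRing.Theory Num.Theory.
Import numFieldNormedType.Exports.
Local Open Scope classical_set_scope.
Local Open Scope ring_scope.

(* Partial sums are over the cubes {0, ..., N-1}^n of multi-indices, which is
   harmless because the series is required to converge absolutely. *)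
Definition real_analytic_at (R : realType) (n : nat)
    (f : 'rV[R]_n.+1 -> R) (p : 'rV[R]_n.+1) : Prop :=
  exists (c : {ffun 'I_n.+1 -> nat} -> R) (r : R),
  [/\ 0 < r,
      exists C : R, forall N : nat,
        \sum_(m : {ffun 'I_n.+1 -> 'I_N})
           `|c [ffun i => m i : nat]| * r ^+ (\sum_i m i)%N <= C
    & forall h : 'rV[R]_n.+1, (forall i, `|h 0 i| < r) ->
        (fun N : nat => \sum_(m : {ffun 'I_n.+1 -> 'I_N})
           c [ffun i => m i : nat] * \prod_i h 0 i ^+ m i) @ \oo
        --> f (p + h)].

Section Calculus.
Variables (R : realType) (n : nat).
Notation pt := 'rV[R]_n.+1.
Notation C := R[i].

Definition pder (f : pt -> C) (i : 'I_n.+1) (p : pt) : C :=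
  Complex ('D_(delta_mx 0 i) (fun q => complex.Re (f q)) p)
          ('D_(delta_mx 0 i) (fun q => complex.Im (f q)) p).

(* A complex vector field X stands for \sum_i X_i d/dx_i, and a complex
   1-form w for \sum_i w_i dx_i. *)
Definition vfield := pt -> 'rV[C]_n.+1.
Definition form1 := pt -> 'rV[C]_n.+1.

Definition conjr (v : 'rV[C]_n.+1) : 'rV[C]_n.+1 := map_mx Num.conj v.

Definition vapp (X : vfield) (f : pt -> C) (p : pt) : C :=
  \sum_i X p 0 i * pder f i p.

Definition vconj (X : vfield) : vfield := fun p => conjr (X p).

Definition bracket (X Y : vfield) : vfield := fun p =>
  \row_i (vapp X (fun q => Y q 0 i) p - vapp Y (fun q => X q 0 i) p).

Definition dfun (f : pt -> C) : form1 := fun p => \row_i pder f i p.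

(* The 2-form \sum_(i < j) K_ij dx_i /\ dx_j is represented by the
   antisymmetric matrix K. *)
Definition wedge (v w : 'rV[C]_n.+1) : 'M[C]_n.+1 := v^T *m w - w^T *m v.

Definition dform (w : form1) (p : pt) : 'M[C]_n.+1 :=
  \matrix_(i, j)
    (pder (fun q => w q 0 j) i p - pder (fun q => w q 0 i) j p).

End Calculus.
Arguments vfield : clear implicits.
Arguments form1 : clear implicits.

Section Graph.
Variable R : realType.
Notation C := R[i].

(* Points of M are given by their coordinates (x, y, u1, u2, u3). *)
Definition ix : 'I_5 := 0.
Definition iy : 'I_5 := 1.
Definition iu (j : 'I_3) : 'I_5 := rshift 2 j.

(* C^4 is R^(4+4), with coordinates (x, u1, u2, u3; y, v1, v2, v3). *)
Definition embed (phi : 'I_3 -> 'rV[R]_5 -> R) (p : 'rV[R]_5) : 'rV[R]_(4 + 4) :=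
  row_mx (row_mx (p 0 ix)%:M (\row_j p 0 (iu j)) : 'rV[R]_(1 + 3))
         (row_mx (p 0 iy)%:M (\row_j phi j p) : 'rV[R]_(1 + 3)).

(* Acts on tangent row vectors by right multiplication. *)
Definition cplxJ : 'M[R]_(4 + 4) := block_mx 0 1%:M (- 1%:M) 0.

(* Its rows span T_p M. *)
Definition tangent (phi : 'I_3 -> 'rV[R]_5 -> R) (p : 'rV[R]_5) :
    'M[R]_(5, 4 + 4) :=
  \matrix_(i, k) 'D_(delta_mx 0 i) (fun q : 'rV[R]_5 => embed phi q 0 k) p.

(* M is the graph of phi over the open neighbourhood Omega of 0; genericity is
   T_p M + J T_p M = T_p C^4. *)
Record CR_generic_graph (Omega : set 'rV[R]_5) (phi : 'I_3 -> 'rV[R]_5 -> R) :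
    Prop := {
  graph_open : open Omega;
  graph_origin : Omega 0;
  graph_analytic : forall j p, Omega p -> real_analytic_at (phi j) p;
  graph_phi0 : forall j, phi j 0 = 0;
  graph_dphi0 : forall j (i : 'I_5), 'D_(delta_mx 0 i) (phi j) 0 = 0;
  graph_generic : forall p, Omega p ->
    row_full (col_mx (tangent phi p) (tangent phi p *m cplxJ)) }.

Definition T01 (phi : 'I_3 -> 'rV[R]_5 -> R) (p : 'rV[R]_5) (v : 'rV[C]_5) :
    Prop :=
  let V := v *m map_mx (real_complex R) (tangent phi p) in
  V *m map_mx (real_complex R) cplxJ = - 'i *: V.

(* d/dzbar = (d/dx + i d/dy) / 2, and the d/du_j components are free. *)
Definition intrinsic_generator (Omega : set 'rV[R]_5)
    (phi : 'I_3 -> 'rV[R]_5 -> R) (Lb : vfield R 4) : Prop :=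
  forall p, Omega p ->
  [/\ Lb p 0 ix = 2^-1, Lb p 0 iy = 'i / 2
    & forall v, T01 phi p v <-> exists c : C, v = c *: Lb p].

Variable Lb : vfield R 4.

Definition fieldL : vfield R 4 := vconj Lb.
Definition fieldT : vfield R 4 := fun p => 'i *: bracket fieldL Lb p.
Definition fieldS : vfield R 4 := bracket fieldL fieldT.
Definition fieldSb : vfield R 4 := bracket Lb fieldT.

Definition frame (p : 'rV[R]_5) : 'M[C]_5 :=
  \matrix_(i < 5) nth 0 [:: fieldSb p; fieldS p; fieldT p; Lb p; fieldL p] i.

Definition maximally_minimal (Omega : set 'rV[R]_5) : Prop :=
  forall p, Omega p -> frame p \in unitmx.

(* Row i of (invmx F)^T pairs to 1 with row i of F and to 0 with the others. *)
Definition coframe0 (i : 'I_5) : form1 R 4 := fun p => row i (invmx (frame p))^T.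
Definition sigma0b := coframe0 0.
Definition sigma0 := coframe0 1.
Definition rho0 := coframe0 2.
Definition zeta0b := coframe0 3.
Definition zeta0 := coframe0 4.

Definition structure_functions (Omega : set 'rV[R]_5)
    (fP fQ fR fB : 'rV[R]_5 -> C) (fA : 'rV[R]_5 -> R) : Prop :=
  forall p, Omega p ->
  [/\ bracket fieldL fieldS p
        = fP p *: fieldT p + fQ p *: fieldS p + fR p *: fieldSb p,
      bracket Lb fieldS p
        = (fA p)%:C%C *: fieldT p + fB p *: fieldS p + (fB p)^* *: fieldSb p
    & bracket fieldL fieldSb p
        = (fA p)%:C%C *: fieldT p + fB p *: fieldS p + (fB p)^* *: fieldSb p].

(* Universal polynomials in the iterated {L, Lbar}-derivatives of P, Q, R, A, B
   and of their conjugates. *)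
Variant symbol := SymP | SymQ | SymR | SymA | SymB.

(* (w, b, s): apply the word w (true for L, false for Lbar, the head of w being
   applied last) to s, or to its conjugate when b is true. *)
Definition jet : Type := (seq bool * bool * symbol)%type.

(* A polynomial is a list of (coefficient, list of variables) monomials. *)
Definition jetpoly : Type := seq (C * seq jet).

Section Eval.
Variables (fP fQ fR fB : 'rV[R]_5 -> C) (fA : 'rV[R]_5 -> R).

Definition symbol_fun (s : symbol) (p : 'rV[R]_5) : C :=
  match s with
  | SymP => fP p | SymQ => fQ p | SymR => fR p | SymA => (fA p)%:C%C
  | SymB => fB p
  end.

Definition jet_eval (j : jet) : 'rV[R]_5 -> C :=
  let: (w, b, s) := j in
  foldr (fun d f => vapp (if d then fieldL else Lb) f)
        (fun p => if b then (symbol_fun s p)^* else symbol_fun s p) w.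

Definition jetpoly_eval (g : jetpoly) (p : 'rV[R]_5) : C :=
  \sum_(m <- g) m.1 * \prod_(j <- m.2) jet_eval j p.

End Eval.
End Graph.
Arguments jetpoly : clear implicits.

(* The total space M x C^* x C, with real coordinates
   (x, y, u1, u2, u3; Re a, Im a, Re e, Im e). *)
Section Lift.
Variable R : realType.
Notation C := R[i].
Notation tot := 'rV[R]_(5 + 4).
Local Notation "v 'wdg' w" := (wedge v w) (at level 40, left associativity).

Definition base (q : tot) : 'rV[R]_5 := lsubmx q.
Definition par_a (q : tot) : C := Complex (rsubmx q 0 0) (rsubmx q 0 1).
Definition par_e (q : tot) : C := Complex (rsubmx q 0 2) (rsubmx q 0 3).

Definition lifted_domain (Omega : set 'rV[R]_5) : set tot :=
  [set q | Omega (base q) /\ par_a q != 0].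

Definition pullback (w : form1 R 4) : form1 R 8 :=
  fun q => row_mx (w (base q)) (0 : 'rV[C]_4).

Variable Lb : vfield R 4.

(* The lifted coframe; b, c, d are functions on the total space. *)
Section Coframe.
Variables b c d : tot -> C.

Definition sigma : form1 R 8 := fun q =>
  (par_a q ^+ 2 * (par_a q)^*) *: pullback (sigma0 Lb) q.
Definition rho : form1 R 8 := fun q =>
  (c q)^* *: pullback (sigma0b Lb) q + c q *: pullback (sigma0 Lb) q
  + (par_a q * (par_a q)^*) *: pullback (rho0 Lb) q.
Definition zeta : form1 R 8 := fun q =>
  (d q)^* *: pullback (sigma0b Lb) q + par_e q *: pullback (sigma0 Lb) q
  + b q *: pullback (rho0 Lb) q + par_a q *: pullback (zeta0 Lb) q.

Definition beta1 : form1 R 8 := fun q => (par_a q)^-1 *: dfun par_a q.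
Definition beta2 : form1 R 8 := fun q =>
  (par_a q ^+ 2 * (par_a q)^*)^-1 *: dfun par_e q
  - (par_e q / (par_a q ^+ 3 * (par_a q)^*)) *: dfun par_a q.

Variant torsion_name :=
  | U1 | U2 | U3 | U4 | U5 | U6 | U7
  | V1 | V2 | V3 | V4 | V8
  | W1 | W2 | W3 | W4 | W5 | W6 | W7 | W8 | W9 | W10.

Definition torsion : Type := torsion_name -> tot -> C.

Definition structure_equations (Omega : set 'rV[R]_5) (B1 B2 : form1 R 8)
    (t : torsion) : Prop :=
  forall q, lifted_domain Omega q ->
  let s := sigma q in let sb := conjr s in
  let r := rho q in
  let z := zeta q in let zb := conjr z in
  let b1 := B1 q in let b1b := conjr b1 in let b2 := B2 q in
  [/\ dform sigma q =
        (2 *: b1 + b1b) wdg s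
        + t U1 q *: (s wdg sb) + t U2 q *: (s wdg r) + t U3 q *: (s wdg z)
        + t U4 q *: (s wdg zb) + t U5 q *: (sb wdg r) + t U6 q *: (sb wdg z)
        + t U7 q *: (sb wdg zb) + r wdg z,
      dform rho q =
        (b1 + b1b) wdg r
        + t V1 q *: (s wdg sb) + t V2 q *: (s wdg r) + t V3 q *: (s wdg z)
        + t V4 q *: (s wdg zb) + (t V2 q)^* *: (sb wdg r)
        + (t V4 q)^* *: (sb wdg z) + (t V3 q)^* *: (sb wdg zb)
        + t V8 q *: (r wdg z) + (t V8 q)^* *: (r wdg zb) + 'i *: (z wdg zb)
    & dform zeta q =
        b2 wdg s + b1 wdg z
        + t W1 q *: (s wdg sb) + t W2 q *: (s wdg r) + t W3 q *: (s wdg z)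
        + t W4 q *: (s wdg zb) + t W5 q *: (sb wdg r) + t W6 q *: (sb wdg z)
        + t W7 q *: (sb wdg zb) + t W8 q *: (r wdg z) + t W9 q *: (r wdg zb)
        + t W10 q *: (z wdg zb)].

(* B + l_0 sigma + l_1 sigmabar + l_2 rho + l_3 zeta + l_4 zetabar *)
Definition modify (l : 'I_5 -> tot -> C) (B : form1 R 8) : form1 R 8 := fun q =>
  B q + l 0 q *: sigma q + l 1 q *: conjr (sigma q) + l 2 q *: rho q
  + l 3 q *: zeta q + l 4 q *: conjr (zeta q).

(* Linear combinations of torsion coefficients; (k, true, n) stands for k times
   the conjugate of the coefficient n. *)
Definition lincomb : Type := seq (C * bool * torsion_name).

Definition lincomb_eval (l : lincomb) (t : torsion) (q : tot) : C :=
  \sum_(x <- l) x.1.1 * (if x.1.2 then (t x.2 q)^* else t x.2 q).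

Definition essential (Omega : set 'rV[R]_5) (l : lincomb) : Prop :=
  forall (l1 l2 : 'I_5 -> tot -> C) (t t' : torsion),
    structure_equations Omega beta1 beta2 t ->
    structure_equations Omega (modify l1 beta1) (modify l2 beta2) t' ->
    forall q, lifted_domain Omega q -> lincomb_eval l t' q = lincomb_eval l t q.

End Coframe.

Definition X1 : lincomb :=
  [:: (1, false, U2); (2, false, W8); (1, true, W8)].
Definition X2 : lincomb :=
  [:: (1, true, U1); (1, false, V2); (1, true, W6)].

Definition further_torsions : seq lincomb :=
  [seq [:: (1, false, n)] | n <- [:: V1; V3; V4; W5; W7; W9]] ++ [:: X1; X2].

Section Normalization.
Variables (fP fQ fB : 'rV[R]_5 -> C) (fA : 'rV[R]_5 -> R).
Notation L := (vapp (fieldL Lb)).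
Notation Lbar := (vapp Lb).

Definition value_b (q : tot) : C :=
  let p := base q in
  par_a q * (- 'i * fB p + 'i / 3 * (fQ p)^*).
Definition value_c (q : tot) : C :=
  par_a q * (par_a q)^* * (fB (base q))^*.
Definition value_d (q : tot) : C :=
  let p := base q in
  (par_a q)^* * (- 'i * L (fun x => (fB x)^*) p + 'i * fP p
                 + 2 * 'i / 3 * (fB p)^* * fQ p).
Definition value_e (q : tot) : C :=
  let p := base q in
  par_a q * ('i * Lbar (fun x => (fB x)^*) p - 'i * (fA p)%:C%C
             - 2 * 'i * fB p * (fB p)^* + 'i / 3 * (fB p)^* * (fQ p)^*).

End Normalization.
End Lift.

(* Main.v *)
(* Analyticity enters only through the differential algebra generated by real
   analytic functions: it contains the components of Lbar, hence those of the whole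
   frame and the functions P, Q, A, B, and mixed partial derivatives commute in it.
   By the Jacobi identity, the brackets [T, S], [T, Sbar] and [S, Sbar] are
   combinations of T, S, Sbar with coefficients in the jets of P, Q, A, B.  Cartan's
   formula then gives d sigma, d rho, d zeta in the lifted coframe, that is, one
   solution of the structure equations.  Changing beta1 and beta2 translates this
   solution by an explicit real-linear function of the ten added coefficients, and
   the essential combinations are those which vanish on all these translations.  The
   values of b, c, d make U5, U6, U7, U3 - 2 V8 + conj W10 and U4 - conj V8 - W10
   vanish, so that subtracting a suitable translation leaves only the eight torsion
   functions.  Their values are polynomial identities in the jets, except W7 = 0, which
   is the S-component of the Jacobi identity of Lbar, T, Sbar. *)
Require Import Defs.
From mathcomp Require Import all_boot all_order all_algebra.
From mathcomp Require Import all_classical all_reals all_analysis.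
From mathcomp Require Import complex.
From mathcomp Require Import ring lra.
Set Implicit Arguments.
Unset Strict Implicit.
Unset Printing Implicit Defensive.
Import Order.TTheory GRing.Theory Num.Theory.
Import numFieldNormedType.Exports.
Local Open Scope classical_set_scope.
Local Open Scope ring_scope.

(** * Real analytic functions *)

(** The values of [b], [c], [d] are dictated by the combinations that vanish: [U6 = 0] is solved by
    [c], [U3 - 2 V8 + conj W10 = 0] by [b], and then [U5 = 0] by [d]. The combination [V4] is affine
    in [e] with invertible slope, hence the value of [e]. Termwise differentiation of power series
    is obtained from a quadratic remainder estimate uniform in the partial sums; it yields the
    convergence of the differentiated series together with the derivative. Differentiated series
    keep the same coefficients and only a derivative order is recorded, so mixed partials have
    literally the same partial sums. All exterior derivatives are computed as antisymmetric 5 x 5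
    matrices on the base and carried to the lifted coframe by a congruence; the fibre coordinates
    contribute only [da] and [de], which give the [beta] terms. The final identities are checked by
    [field], for which ['i] is an indeterminate. Every quantity is therefore first written as a
    power of ['i] times an expression free of ['i], and the relation ['i * 'i = -1] is applied by
    hand. *)

Section Monomials.
Variable R : realType.
Implicit Types (x t rho r : R) (a k : nat).

(** The [a]-th derivative of [x ^+ k]. For [k < a] the falling factorial is zero, so the truncated
    exponent is harmless. *)
Definition dmon a k x : R := (k ^_ a)%:R * x ^+ (k - a).

Lemma normr_exprn_le x rho k : `|x| <= rho -> `|x ^+ k| <= rho ^+ k.
Proof.
move=> xr; rewrite normrX; apply: lerXn2r => //; rewrite nnegrE ?normr_ge0//.
exact: le_trans xr.
Qed.

(** Induction on [k]: the remainder for [k.+1] is [x + t] times the remainder for [k], plus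
    [k x^(k-1) t^2]. The constant [k (k - 1)], twice the sharp one, is the coefficient of the second
    derivative, which is what [dmon] produces. *)
Lemma expr_taylor x t rho k : `|x| <= rho -> `|x + t| <= rho ->
  `|(x + t) ^+ k - x ^+ k - k%:R * x ^+ k.-1 * t|
    <= (k * k.-1)%:R * rho ^+ (k - 2) * t ^+ 2.
Proof.
move=> xr yr; have r0 : 0 <= rho by exact: le_trans xr.
elim: k => [|k IH]; first by rewrite !expr0 subrr !mul0r subr0 normr0.
have -> : (x + t) ^+ k.+1 - x ^+ k.+1 - k.+1%:R * x ^+ k.+1.-1 * t =
  (x + t) * ((x + t) ^+ k - x ^+ k - k%:R * x ^+ k.-1 * t)
  + k%:R * x ^+ k.-1 * t ^+ 2.
  case: k {IH} => [|k]; first by rewrite /= !expr0 !expr1; ring.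
  by rewrite /= !exprS -natr1; ring.
apply: le_trans (ler_normD _ _) _.
have -> : (k.+1 * k.+1.-1)%:R * rho ^+ (k.+1 - 2) * t ^+ 2 =
    rho * ((k * k.-1)%:R * rho ^+ (k - 2) * t ^+ 2)
    + 2 * (k%:R * rho ^+ k.-1 * t ^+ 2).
  case: k {IH} => [|[|k]]; rewrite /= ?subn0 ?subSS.
  - by rewrite !mul0r mulr0 add0r mulr0.
  - by rewrite !expr0; ring.
  - by rewrite !subn0 exprS !natrM; ring.
apply: lerD.
  by rewrite normrM; apply: ler_pM.
have : `|k%:R * x ^+ k.-1 * t ^+ 2| <= k%:R * rho ^+ k.-1 * t ^+ 2.
  rewrite normrM (ger0_norm (sqr_ge0 t)) normrM normr_nat.
  apply: ler_wpM2r; rewrite ?sqr_ge0//; apply: ler_wpM2l => //.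
  exact: normr_exprn_le.
move=> h; apply: le_trans h _.
rewrite ler_peMl ?ler1n// mulr_ge0 ?sqr_ge0// mulr_ge0 ?exprn_ge0//.
Qed.

Lemma dmon_le a k x rho : `|x| <= rho -> `|dmon a k x| <= dmon a k rho.
Proof.
move=> xr; rewrite /dmon normrM normr_nat; apply: ler_wpM2l => //.
exact: normr_exprn_le.
Qed.

Lemma dmon_ge0 a k rho : 0 <= rho -> 0 <= dmon a k rho.
Proof. by move=> r0; rewrite mulr_ge0 ?exprn_ge0. Qed.

Lemma dmon_taylor a k x t rho : `|x| <= rho -> `|x + t| <= rho ->
  `|dmon a k (x + t) - dmon a k x - dmon a.+1 k x * t|
    <= dmon a.+2 k rho * t ^+ 2.
Proof.
move=> xr yr; rewrite /dmon.
have -> : (k ^_ a)%:R * (x + t) ^+ (k - a) - (k ^_ a)%:R * x ^+ (k - a) -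
    (k ^_ a.+1)%:R * x ^+ (k - a.+1) * t = (k ^_ a)%:R *
    ((x + t) ^+ (k - a) - x ^+ (k - a) - (k - a)%:R * x ^+ (k - a).-1 * t).
  by rewrite ffactnSr natrM -subnS; ring.
rewrite normrM normr_nat.
have -> : (k ^_ a.+2)%:R * rho ^+ (k - a.+2) * t ^+ 2 =
  (k ^_ a)%:R * (((k - a) * (k - a).-1)%:R * rho ^+ (k - a - 2) * t ^+ 2).
  by rewrite !ffactnSr -subnDA addn2 -!subnS !natrM; ring.
by apply: ler_wpM2l => //; exact: expr_taylor.
Qed.

(** A Cauchy estimate: with [d = r - rho], the term [C(k, a) rho^(k - a) d^a] is one summand of the
    binomial expansion of [r ^+ k], all of whose summands are nonnegative. The factor in front of
    [r ^+ k] does not depend on [k]. *)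
Lemma dmon_bound a k rho r : 0 <= rho -> rho < r ->
  dmon a k rho <= (a`!)%:R / (r - rho) ^+ a * r ^+ k.
Proof.
move=> rho0 rr; have d0 : 0 < r - rho by rewrite subr_gt0.
rewrite /dmon; case: (ltnP k a) => [ka|ak].
  rewrite ffact_small// mul0r mulr_ge0 ?divr_ge0 ?exprn_ge0 ?(ltW d0)//.
  by apply: le_trans rho0 (ltW rr).
set d := r - rho in d0 *; have -> : r = rho + d by rewrite /d; ring.
rewrite mulrAC ler_pdivlMr ?exprn_gt0// -bin_ffact natrM.
have -> : ('C(k, a))%:R * (a`!)%:R * rho ^+ (k - a) * d ^+ a =
  (a`!)%:R * (('C(k, a))%:R * (rho ^+ (k - a) * d ^+ a)) by ring.
apply: ler_wpM2l => //; rewrite [leRHS]exprDn (bigD1 (inord a)) //= inordK ?ltnS//.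
rewrite mulr_natl -[leLHS]addr0; apply: lerD => //.
apply: sumr_ge0 => i _; rewrite mulrn_wge0// mulr_ge0 ?exprn_ge0// ltW//.
Qed.

End Monomials.

Section Series.
Variables (R : realType) (n : nat).
Notation pt := 'rV[R]_n.+1.
Implicit Types (c : {ffun 'I_n.+1 -> nat} -> R) (al : 'I_n.+1 -> nat).
Implicit Types (h p : pt) (i j : 'I_n.+1) (t rho r : R).

Definition bump_at al i : 'I_n.+1 -> nat := fun j => (al j + (j == i))%N.

(** Partial sum of the power series with coefficients [c], differentiated termwise [al j] times in
    the [j]-th variable. Further differentiation changes [al] only. *)
Definition dsum c al (N : nat) h : R :=
  \sum_(m : {ffun 'I_n.+1 -> 'I_N})
    c [ffun i => m i : nat] * \prod_j dmon (al j) (m j) (h 0 j).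

Lemma line_coord h i t j :
  (h + t *: delta_mx 0 i : pt) 0 j = h 0 j + t *+ (j == i).
Proof.
by rewrite !mxE eqxx /=; case: eqP => _ /=; rewrite ?mulr1 ?mulr0.
Qed.

(** Only the [i]-th factor of each monomial moves, so [dmon_taylor] applies term by term. The bound
    no longer involves [h], and [dsum_bounded] will make it uniform in [N]. *)
Lemma dsum_taylor c al rho i t h (N : nat) :
    (forall j, `|h 0 j| <= rho) ->
    `|h 0 i + t| <= rho ->
  `|dsum c al N (h + t *: delta_mx 0 i) - dsum c al N h
      - dsum c (bump_at al i) N h * t|
    <= (\sum_(m : {ffun 'I_n.+1 -> 'I_N}) `|c [ffun i => m i : nat]|
          * \prod_j dmon (bump_at (bump_at al i) i j) (m j) rho) * t ^+ 2.
Proof.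
move=> hr hir; rewrite /dsum mulr_suml -sumrB -sumrB mulr_suml.
apply: le_trans (ler_norm_sum _ _ _) _; apply: ler_sum => m _.
have D (f : 'I_n.+1 -> R) : \prod_j f j = f i * \prod_(j | j != i) f j.
  by rewrite (bigD1 i).
rewrite !D.
rewrite line_coord eqxx mulr1n /bump_at eqxx addn1 addn1.
have e1 : \prod_(j | j != i) dmon (al j) (m j) ((h + t *: delta_mx 0 i : pt) 0 j)
    = \prod_(j | j != i) dmon (al j) (m j) (h 0 j).
  by apply: eq_bigr => j /negbTE ji; rewrite line_coord ji addr0.
have e2 : \prod_(j | j != i) dmon (al j + (j == i)) (m j) (h 0 j)
    = \prod_(j | j != i) dmon (al j) (m j) (h 0 j).
  by apply: eq_bigr => j /negbTE ji; rewrite ji addn0.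
have e3 : \prod_(j | j != i) dmon (al j + (j == i) + (j == i)) (m j) rho
    = \prod_(j | j != i) dmon (al j) (m j) rho.
  by apply: eq_bigr => j /negbTE ji; rewrite ji !addn0.
rewrite e1 e2 e3; set Q := \prod_(j | _) _; set Q' := \prod_(j | _) _.
set cm := c _.
have -> : cm * (dmon (al i) (m i) (h 0 i + t) * Q)
      - cm * (dmon (al i) (m i) (h 0 i) * Q)
      - cm * (dmon (al i).+1 (m i) (h 0 i) * Q) * t
    = cm * Q * (dmon (al i) (m i) (h 0 i + t) - dmon (al i) (m i) (h 0 i)
         - dmon (al i).+1 (m i) (h 0 i) * t) by ring.
have -> : `|cm| * (dmon (al i).+2 (m i) rho * Q') * t ^+ 2
   = `|cm| * Q' * (dmon (al i).+2 (m i) rho * t ^+ 2) by ring.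
have rho0 : 0 <= rho by apply: le_trans (hr i); rewrite normr_ge0.
rewrite normrM; apply: ler_pM => //; last exact: dmon_taylor.
rewrite normrM; apply: ler_wpM2l => //; rewrite normr_prod.
by apply: ler_prod => j _; rewrite normr_ge0 dmon_le.
Qed.

Definition abs_summable c r : Prop := exists C : R, forall N : nat,
  \sum_(m : {ffun 'I_n.+1 -> 'I_N})
    `|c [ffun i => m i : nat]| * r ^+ (\sum_i m i)%N <= C.

(** By [dmon_bound], passing from the cube of size [r] to the smaller one of size [rho] costs a
    factor depending on [al], [rho] and [r] but not on the monomial, so one summability hypothesis
    controls the derivatives of every order. *)
Lemma dsum_bounded c al rho r : 0 <= rho -> rho < r -> abs_summable c r ->
  exists2 K, 0 <= K & forall N : nat,
  \sum_(m : {ffun 'I_n.+1 -> 'I_N}) `|c [ffun i => m i : nat]|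
          * \prod_j dmon (al j) (m j) rho <= K.
Proof.
move=> rho0 rr [C HC].
pose k := \prod_j (((al j)`!)%:R / (r - rho) ^+ al j) : R.
have k0 : 0 <= k.
  apply: prodr_ge0 => j _; rewrite divr_ge0 ?exprn_ge0// subr_ge0 ltW//.
have C0 : 0 <= C.
  apply: le_trans (HC 0%N); apply: sumr_ge0 => m _.
  by rewrite mulr_ge0 ?exprn_ge0// (le_trans rho0)// ltW.
exists (C * k) => [|N]; first exact: mulr_ge0.
apply: le_trans (ler_wpM2r k0 (HC N)); rewrite mulr_suml.
apply: ler_sum => m _; rewrite -mulrA; apply: ler_wpM2l => //.
rewrite mulrC -prodrXr -big_split/=; apply: ler_prod => j _.
by rewrite dmon_ge0// dmon_bound.
Qed.

End Series.

Lemma quadratic_is_derive (R : realType) (V : normedModType R) (f : V -> R)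
    (x v : V) (d K e : R) :
  0 < e -> 0 <= K ->
  (forall t, `|t| < e -> `|f (x + t *: v) - f x - d * t| <= K * t ^+ 2) ->
  is_derive x v f d.
Proof.
move=> e0 K0 H.
suff L : (fun h => h^-1 *: ((f \o shift x) (h *: v) - f x)) @ 0^' --> d.
  by split; [apply/cvg_ex; exists d | exact/cvg_lim].
apply/cvgrPdist_le => /= eps eps0; near=> t.
have t0 : t != 0 by near: t; exact: nbhs_dnbhs_neq.
have te : `|t| < e by near: t; exact: dnbhs0_lt.
(* [K + 1] instead of [K] keeps the quotient meaningful when [K = 0]. *)
have tK : `|t| < eps / (K + 1).
  by near: t; apply: dnbhs0_lt; rewrite divr_gt0// ltr_wpDl.
rewrite (addrC (t *: v)).
have -> : d - t^-1 *: (f (x + t *: v) - f x)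
    = - (t^-1 * (f (x + t *: v) - f x - d * t)) by rewrite /GRing.scale/=; field.
rewrite normrN normrM normfV mulrC ler_pdivrMr ?normr_gt0//.
apply: le_trans (H _ te) _; rewrite -real_normK ?num_real// expr2 mulrA.
apply: ler_wpM2r => //.
have : K * `|t| <= (K + 1) * `|t| by apply: ler_wpM2r => //; rewrite lerDl.
move=> /le_trans; apply; rewrite mulrC -ler_pdivlMr ?ltr_wpDl//; exact: ltW.
Unshelve. all: by end_near. Qed.

(** For a fixed [t] the difference quotients of [u] converge in [N] and stay within [K |t|] of
    [g N]. Taking [t] small shows that [g] is Cauchy, and the estimate then passes to the limit.
    Convergence of the differentiated series thus needs no argument of its own. *)
Lemma cvg_quadratic (R : realType) (u : R -> nat -> R) (U : R -> R)
    (g : nat -> R) (K e : R) :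
  0 < e -> 0 <= K ->
  (forall t, `|t| < e -> u t N @[N --> \oo] --> U t) ->
  (forall t N, `|t| < e -> `|u t N - u 0 N - g N * t| <= K * t ^+ 2) ->
  exists2 d : R, g N @[N --> \oo] --> d &
    forall t, `|t| < e -> `|U t - U 0 - d * t| <= K * t ^+ 2.
Proof.
move=> e0 K0 uU H.
have cvg_diff t : `|t| < e -> (fun N => u t N - u 0 N) @ \oo --> U t - U 0.
  by move=> te; apply: cvgB; apply: uU; rewrite ?normr0.
have /cvg_ex[d gd] : cvg (g N @[N --> \oo]).
  apply: cauchy_cvg; apply: cauchy_exP => eps eps0.
  (* The first bound keeps [t] in the domain, the second makes the remainder [K * t] at most
     [eps / 2]; convergence of the quotients supplies the other [eps / 4]. *)
  pose t := Num.min (e / 2) (eps / 2 / (K + 1)).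
  have t0 : 0 < t.
    by rewrite lt_min !divr_gt0//= ltr_wpDl.
  have te : `|t| < e.
    by rewrite gtr0_norm// gt_min; apply/orP; left; lra.
  exists ((U t - U 0) / t).
  have eps2 : 0 < eps / 4 * t by rewrite mulr_gt0// divr_gt0.
  have /cvgrPdist_le/(_ _ eps2) := cvg_diff _ te.
  apply: filterS => N /= HN.
  rewrite /ball/=.
  have -> : (U t - U 0) / t - g N =
    ((U t - U 0 - (u t N - u 0 N)) + (u t N - u 0 N - g N * t)) / t.
    by field; rewrite gt_eqF.
  rewrite normrM normfV (gtr0_norm t0) ltr_pdivrMr//.
  apply: le_lt_trans (ler_normD _ _) _.
  apply: le_lt_trans (lerD HN (H t N te)) _.
  rewrite expr2 mulrA -mulrDl ltr_pM2r//.
  have : K * t <= eps / 2.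
    have h1 : t <= eps / 2 / (K + 1) by rewrite ge_min lexx orbT.
    have h2 : (K + 1) * t <= eps / 2.
      by rewrite mulrC -ler_pdivlMr// ltr_wpDl.
    by apply: le_trans h2; apply: ler_wpM2r; [exact: ltW | rewrite lerDl].
  move=> h; lra.
exists d => // t te.
have L : (fun N => `|u t N - u 0 N - g N * t|) @ \oo --> `|U t - U 0 - d * t|.
  apply: cvg_norm; apply: cvgB; first exact: cvg_diff.
  by apply: cvgM => //; exact: cvg_cst.
by apply: (cvgr_to_le L); apply: nearW => N; exact: H.
Qed.

Section AnalyticJet.
Variables (R : realType) (n : nat).
Notation pt := 'rV[R]_n.+1.
Implicit Types (c : {ffun 'I_n.+1 -> nat} -> R) (al : 'I_n.+1 -> nat).
Implicit Types (h p : pt) (i j : 'I_n.+1) (t rho r : R) (f : pt -> R).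

(** Near [p], [f] is the derivative of order [al] of the series [c]. The gap between [rho] and [r]
    is consumed by no differentiation, so both radii survive all partial derivatives. *)
Definition dsum_expansion f p c al rho r : Prop :=
  [/\ 0 < rho, rho < r, abs_summable c r
    & forall h, (forall j, `|h 0 j| < rho) ->
        dsum c al N h @[N --> \oo] --> f (p + h)].

(** [cvg_quadratic] is applied along the line through [h] in direction [i], for [t] smaller than
    [rho - |h_i|] so that the line stays in the cube. *)
Lemma dsum_expansion_is_derive f p c al rho r h i :
    dsum_expansion f p c al rho r -> (forall j, `|h 0 j| < rho) ->
  exists2 d : R, dsum c (bump_at al i) N h @[N --> \oo] --> d &
    is_derive (p + h) (delta_mx 0 i) f d.
Proof.
case=> rho0 rr sc F hr.
have [K K0 HK] := dsum_bounded (bump_at (bump_at al i) i) (ltW rho0) rr sc.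
have e0 : 0 < rho - `|h 0 i| by rewrite subr_gt0.
have line t : `|t| < rho - `|h 0 i| ->
    forall j, `|(h + t *: delta_mx 0 i : pt) 0 j| < rho.
  move=> te j; rewrite line_coord; case: (eqVneq j i) => [->|ji].
    apply: le_lt_trans (ler_normD _ _) _; rewrite mulr1n; lra.
  by rewrite addr0.
have := @cvg_quadratic R (fun t N => dsum c al N (h + t *: delta_mx 0 i))
  (fun t => f (p + (h + t *: delta_mx 0 i)))
  (fun N => dsum c (bump_at al i) N h) K _ e0 K0.
rewrite scale0r addr0; case.
- by move=> t te; apply: F; exact: line.
- move=> t N te; apply: le_trans (dsum_taylor _ _ _ _ _) _.
  + by move=> j; apply: ltW; exact: hr.
  + by apply: le_trans (ler_normD _ _) _; lra.
  + by apply: ler_wpM2r; rewrite ?sqr_ge0.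
move=> d gd H; exists d => //; apply: (quadratic_is_derive e0 K0).
by move=> t te; rewrite -(addrA p h); exact: H.
Qed.

(** Weaker in form than [real_analytic_at], because the series may already be differentiated; this
    makes stability under partial derivatives immediate, without re-indexing coefficients. *)
Definition analytic_jet f p : Prop :=
  exists c al rho r, dsum_expansion f p c al rho r.

Lemma dsum0 c N h : dsum c (fun=> 0%N) N h =
  \sum_(m : {ffun 'I_n.+1 -> 'I_N})
    c [ffun i => m i : nat] * \prod_i h 0 i ^+ m i.
Proof.
apply: eq_bigr => m _; congr (_ * _); apply: eq_bigr => j _.
by rewrite /dmon ffactn0 mul1r subn0.
Qed.

Lemma real_analytic_jet f p : real_analytic_at f p -> analytic_jet f p.
Proof.
case=> c [r [r0 sc F]]; exists c, (fun=> 0%N), (r / 2), r; split => //.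
- by rewrite divr_gt0.
- lra.
move=> h hr; under eq_fun do rewrite dsum0.
by apply: F => i; apply: lt_le_trans (hr i) _; lra.
Qed.

Section AtPoint.
Variables (f : pt -> R) (p : pt).
Hypothesis fp : analytic_jet f p.

Lemma analytic_jet_derivable i : derivable f p (delta_mx 0 i).
Proof.
have [c [al [rho [r E]]]] := fp; have [rho0 _ _ _] := E.
have h0 j : `|(0 : pt) 0 j| < rho by rewrite mxE normr0.
have [d _ []] := dsum_expansion_is_derive i E h0; rewrite addr0.
by move=> + _.
Qed.

Lemma analytic_jet_partial i : analytic_jet (fun q => 'D_(delta_mx 0 i) f q) p.
Proof.
have [c [al [rho [r E]]]] := fp; have [rho0 rr sc _] := E.
exists c, (bump_at al i), rho, r; split => // h hr.
by have [d dd [_ /= ->]] := dsum_expansion_is_derive i E hr.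
Qed.

(** [bump_at] commutes in its two directions, so both mixed partials are limits of one and the same
    sequence. *)
Lemma analytic_jet_partialC i j :
  'D_(delta_mx 0 j) (fun q => 'D_(delta_mx 0 i) f q) p =
  'D_(delta_mx 0 i) (fun q => 'D_(delta_mx 0 j) f q) p.
Proof.
have [c [al [rho [r E]]]] := fp; have [rho0 rr sc _] := E.
have h0 l : `|(0 : pt) 0 l| < rho by rewrite mxE normr0.
have E' l : dsum_expansion (fun q => 'D_(delta_mx 0 l) f q) p c
    (bump_at al l) rho r.
  split => // h hr.
  by have [d dd [_ /= ->]] := dsum_expansion_is_derive l E hr.
have [d1 L1 [_]] := dsum_expansion_is_derive j (E' i) h0.
have [d2 L2 [_]] := dsum_expansion_is_derive i (E' j) h0.
have ijC : bump_at (bump_at al i) j = bump_at (bump_at al j) i.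
  by apply/funext => l; rewrite /bump_at addnAC.
rewrite -ijC in L2; rewrite addr0 => -> ->.
by rewrite -(cvg_lim _ L1)// -(cvg_lim _ L2).
Qed.

End AtPoint.
End AnalyticJet.

(** * Partial derivatives of complex-valued functions *)

Lemma ReM (R : realType) (x y : R[i]) :
  complex.Re (x * y) = complex.Re x * complex.Re y - complex.Im x * complex.Im y.
Proof. by case: x y => [a b] [c d]. Qed.

Lemma ImM (R : realType) (x y : R[i]) :
  complex.Im (x * y) = complex.Re x * complex.Im y + complex.Im x * complex.Re y.
Proof. by case: x y => [a b] [c d]. Qed.

Lemma ReD (R : realType) (x y : R[i]) :
  complex.Re (x + y) = complex.Re x + complex.Re y.
Proof. by case: x y => [a b] [c d]. Qed.

Lemma ImD (R : realType) (x y : R[i]) :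
  complex.Im (x + y) = complex.Im x + complex.Im y.
Proof. by case: x y => [a b] [c d]. Qed.

Lemma ReJ (R : realType) (x : R[i]) : complex.Re x^* = complex.Re x.
Proof. by case: x. Qed.

Lemma ImJ (R : realType) (x : R[i]) : complex.Im x^* = - complex.Im x.
Proof. by case: x. Qed.

Lemma ReV (R : realType) (x : R[i]) : complex.Re x^-1 =
  complex.Re x * (complex.Re x ^+ 2 + complex.Im x ^+ 2)^-1.
Proof. by case: x. Qed.

Lemma ImV (R : realType) (x : R[i]) : complex.Im x^-1 =
  - complex.Im x * (complex.Re x ^+ 2 + complex.Im x ^+ 2)^-1.
Proof. by case: x => [a b]; rewrite /= mulNr. Qed.

Lemma normc2_neq0 (R : realType) (x : R[i]) : x != 0 ->
  complex.Re x ^+ 2 + complex.Im x ^+ 2 != 0.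
Proof.
by rewrite eq_complex /= -sqrf_eq0 -[in X in _ && X]sqrf_eq0 paddr_eq0 ?sqr_ge0.
Qed.

Section PointwiseRules.
Variables (R : realType) (V : normedModType R) (f g : V -> R) (x v : V) (a b : R).
Hypotheses (df : is_derive x v f a) (dg : is_derive x v g b).

Lemma is_derive_addf : is_derive x v (fun q => f q + g q) (a + b).
Proof. exact: is_deriveD. Qed.

Lemma is_derive_subf : is_derive x v (fun q => f q - g q) (a - b).
Proof. exact: is_deriveB. Qed.

Lemma is_derive_mulf : is_derive x v (fun q => f q * g q) (f x * b + g x * a).
Proof. exact: is_deriveM. Qed.

Lemma is_derive_oppf : is_derive x v (fun q => - f q) (- a).
Proof. exact: is_deriveN. Qed.

Lemma is_derive_val c : a = c -> is_derive x v f c.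
Proof. by move=> <-. Qed.

End PointwiseRules.

Section PartialDerivatives.
Variables (R : realType) (n : nat).
Notation pt := 'rV[R]_n.+1.
Notation C := R[i].
Implicit Types (f g : pt -> C) (p : pt) (i j : 'I_n.+1).

(** Unlike the total function [pder], this records that the derivatives of both parts exist, which
    the product and inverse rules require. *)
Definition is_pder f p i (d : C) : Prop :=
  is_derive p (delta_mx 0 i) (fun q => complex.Re (f q)) (complex.Re d) /\
  is_derive p (delta_mx 0 i) (fun q => complex.Im (f q)) (complex.Im d).

Lemma is_pder_val f p i d : is_pder f p i d -> pder f i p = d.
Proof. by case=> [[_ dr] [_ di]]; rewrite /pder dr di; case: d {dr di}. Qed.

Lemma is_pder_eq f p i d d' : is_pder f p i d -> d = d' -> is_pder f p i d'.
Proof. by move=> ? <-. Qed.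

Lemma is_pder_cst (c : C) p i : is_pder (fun=> c) p i 0.
Proof. by split; exact: is_derive_cst. Qed.

Lemma is_pderD f g p i d e : is_pder f p i d -> is_pder g p i e ->
  is_pder (fun q => f q + g q) p i (d + e).
Proof.
move=> [fr fi] [gr gi]; split.
- under eq_fun do rewrite ReD; rewrite ReD; exact: is_derive_addf.
- under eq_fun do rewrite ImD; rewrite ImD; exact: is_derive_addf.
Qed.

Lemma is_pderM f g p i d e : is_pder f p i d -> is_pder g p i e ->
  is_pder (fun q => f q * g q) p i (d * g p + f p * e).
Proof.
move=> [fr fi] [gr gi]; split.
- under eq_fun do rewrite ReM; rewrite ReD !ReM.
  apply: (is_derive_val (is_derive_subf (is_derive_mulf fr gr) (is_derive_mulf fi gi))).
  by rewrite /GRing.scale/=; ring.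
- under eq_fun do rewrite ImM; rewrite ImD !ImM.
  apply: (is_derive_val (is_derive_addf (is_derive_mulf fr gi) (is_derive_mulf fi gr))).
  by rewrite /GRing.scale/=; ring.
Qed.

Lemma is_pder_conj f p i d : is_pder f p i d -> is_pder (fun q => (f q)^*) p i d^*.
Proof.
move=> [fr fi]; split.
- by under eq_fun do rewrite ReJ; rewrite ReJ.
- under eq_fun do rewrite ImJ; rewrite ImJ; exact: is_derive_oppf.
Qed.

(** The inverse is the conjugate divided by the real function [N], the squared modulus, so both
    parts reduce to real quotients. *)
Lemma is_pderV f p i d : f p != 0 -> is_pder f p i d ->
  is_pder (fun q => (f q)^-1) p i (- d * (f p)^-1 ^+ 2).
Proof.
move=> f0 [fr fi]; have N0 := normc2_neq0 f0.
pose N q := complex.Re (f q) * complex.Re (f q)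
  + complex.Im (f q) * complex.Im (f q).
have NE q : complex.Re (f q) ^+ 2 + complex.Im (f q) ^+ 2 = N q by [].
have dN : is_derive p (delta_mx 0 i) N
   (2 * (complex.Re (f p) * complex.Re d + complex.Im (f p) * complex.Im d)).
  apply: (is_derive_val (is_derive_addf (is_derive_mulf fr fr) (is_derive_mulf fi fi))).
  by rewrite /GRing.scale/=; ring.
have dNV : is_derive p (delta_mx 0 i) (fun q => (N q)^-1)
   (- (N p)^-2 * (2 * (complex.Re (f p) * complex.Re d
                       + complex.Im (f p) * complex.Im d))).
  rewrite NE in N0; have [dN1 dN2] := dN.
  by split; [exact: derivableV | rewrite deriveV// dN2].
rewrite NE in N0 *; split.
- under eq_fun do rewrite ReV NE; rewrite ReM expr2 ReM ImM ReV ImV NE.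
  apply: (is_derive_val (is_derive_mulf fr dNV)).
  case: (d) => d1 d2; rewrite /GRing.scale/= /N.
  by move: N0; rewrite /N; case: (f p) => u v /= N0; field.
- under eq_fun do rewrite ImV NE; rewrite ImM expr2 ReM ImM ReV ImV NE.
  apply: (is_derive_val (is_derive_mulf (is_derive_oppf fi) dNV)).
  case: (d) => d1 d2; rewrite /GRing.scale/= /N.
  by move: N0; rewrite /N; case: (f p) => u v /= N0; field.
Qed.

Lemma is_pder_near f g p i d : (\near p, f p = g p) ->
  is_pder f p i d -> is_pder g p i d.
Proof.
move=> fg [fr fi]; split.
- by apply: near_eq_is_derive fr; apply: filterS fg => q ->.
- by apply: near_eq_is_derive fi; apply: filterS fg => q ->.
Qed.

Lemma is_pder_real (f : pt -> R) p i : derivable f p (delta_mx 0 i) ->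
  is_pder (fun q => (f q)%:C%C) p i ('D_(delta_mx 0 i) f p)%:C%C.
Proof.
by move=> df; split; [exact: derivableP | exact: is_derive_cst].
Qed.

Lemma near_eq_pder f g p i : (\near p, f p = g p) -> pder f i p = pder g i p.
Proof.
move=> fg; rewrite /pder; congr Complex; apply: near_eq_derive;
by apply: filterS fg => q ->.
Qed.

End PartialDerivatives.

(* Otherwise unification compares distinct derivatives by unfolding them. *)
Opaque pder.

(** * The differential algebra generated by real analytic functions *)

Section Smooth.
Variables (R : realType) (n : nat) (Omega : set 'rV[R]_n.+1).
Notation pt := 'rV[R]_n.+1.
Notation C := R[i].
Implicit Types (f g : pt -> C) (p : pt) (i j : 'I_n.+1).

(* The differential algebra generated by the real analytic functions, modulo
   equality on Omega; it contains the components of all the fields. *)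
Inductive smooth : (pt -> C) -> Prop :=
| smooth_real (f : pt -> R) :
    (forall p, Omega p -> analytic_jet f p) -> smooth (fun p => (f p)%:C%C)
| smooth_cst (c : C) : smooth (fun=> c)
| smoothD f g : smooth f -> smooth g -> smooth (fun p => f p + g p)
| smoothM f g : smooth f -> smooth g -> smooth (fun p => f p * g p)
| smooth_conj f : smooth f -> smooth (fun p => (f p)^*)
| smoothV f : (forall p, Omega p -> f p != 0) -> smooth f ->
    smooth (fun p => (f p)^-1)
| smooth_ext f g : (forall p, Omega p -> f p = g p) -> smooth f -> smooth g.

Hypothesis oO : open Omega.

Lemma eq_near f g p : Omega p -> (forall q, Omega q -> f q = g q) ->
  \near p, f p = g p.
Proof. by move=> Op fg; apply: filterS fg _; apply: open_nbhs_nbhs. Qed.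

Lemma smooth_is_pder f p i : smooth f -> Omega p -> is_pder f p i (pder f i p).
Proof.
move=> sf; elim: sf p i => {f}.
- move=> f af p i Op; have df := analytic_jet_derivable (i := i) (af p Op).
  by have d := is_pder_real df; rewrite (is_pder_val d).
- by move=> c p i Op; have d := is_pder_cst c p i; rewrite (is_pder_val d).
- move=> f g _ F _ G p i Op; have d := is_pderD (F p i Op) (G p i Op).
  by rewrite (is_pder_val d).
- move=> f g _ F _ G p i Op; have d := is_pderM (F p i Op) (G p i Op).
  by rewrite (is_pder_val d).
- move=> f _ F p i Op; have d := is_pder_conj (F p i Op).
  by rewrite (is_pder_val d).
- move=> f f0 _ F p i Op; have d := is_pderV (f0 p Op) (F p i Op).
  by rewrite (is_pder_val d).
- move=> f g fg _ F p i Op; have d := is_pder_near (eq_near Op fg) (F p i Op).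
  by rewrite (is_pder_val d).
Qed.

Lemma smoothN f : smooth f -> smooth (fun p => - f p).
Proof.
move=> sf; apply: (smooth_ext _ (smoothM (smooth_cst (-1)) sf)) => p _.
by rewrite mulN1r.
Qed.

Lemma smoothB f g : smooth f -> smooth g -> smooth (fun p => f p - g p).
Proof. by move=> sf sg; apply: smoothD => //; apply: smoothN. Qed.

Lemma eq_pder f g p i : (forall q, Omega q -> f q = g q) -> Omega p ->
  pder f i p = pder g i p.
Proof.
by move=> fg Op; apply: near_eq_pder; exact: eq_near.
Qed.

Section Rules.
Variables (f g : pt -> C) (p : pt) (i : 'I_n.+1).
Hypotheses (sf : smooth f) (sg : smooth g) (Op : Omega p).

Lemma pderD : pder (fun q => f q + g q) i p = pder f i p + pder g i p.
Proof. by apply/is_pder_val/is_pderD; exact: smooth_is_pder. Qed.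

Lemma pderM : pder (fun q => f q * g q) i p = pder f i p * g p + f p * pder g i p.
Proof. by apply/is_pder_val/is_pderM; exact: smooth_is_pder. Qed.

Lemma pder_conj : pder (fun q => (f q)^*) i p = (pder f i p)^*.
Proof. by apply/is_pder_val/is_pder_conj; exact: smooth_is_pder. Qed.

Lemma pderN : pder (fun q => - f q) i p = - pder f i p.
Proof.
apply/is_pder_val; have := is_pderM (is_pder_cst (-1) p i) (smooth_is_pder i sf Op).
by rewrite mul0r add0r mulN1r; under eq_fun do rewrite mulN1r.
Qed.

Lemma pderV : f p != 0 ->
  pder (fun q => (f q)^-1) i p = - pder f i p * (f p)^-1 ^+ 2.
Proof. by move=> f0; apply/is_pder_val/is_pderV => //; exact: smooth_is_pder. Qed.

End Rules.

Lemma pder_cst (c : C) p i : pder (fun=> c) i p = 0.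
Proof. exact/is_pder_val/is_pder_cst. Qed.

Lemma smooth_pder f i : smooth f -> smooth (pder f i).
Proof.
elim => {f}.
- move=> f af; apply: (@smooth_ext (fun p => ('D_(delta_mx 0 i) f p)%:C%C)).
    move=> p Op; symmetry; apply/is_pder_val/is_pder_real.
    exact: (analytic_jet_derivable (i := i) (af p Op)).
  by apply: smooth_real => p Op; apply: analytic_jet_partial; exact: af.
- by move=> c; apply: (smooth_ext _ (smooth_cst 0)) => p Op; rewrite pder_cst.
- move=> f g sf F sg G; apply: (smooth_ext _ (smoothD F G)) => p Op.
  by rewrite pderD.
- move=> f g sf F sg G.
  apply: (smooth_ext _ (smoothD (smoothM F sg) (smoothM sf G))) => p Op.
  by rewrite pderM.
- move=> f sf F; apply: (smooth_ext _ (smooth_conj F)) => p Op.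
  by rewrite pder_conj.
- move=> f f0 sf F; have sV := smoothV f0 sf.
  apply: (smooth_ext _ (smoothM (smoothN F) (smoothM sV sV))) => p Op.
  by rewrite pderV ?f0// expr2.
- move=> f g fg _ F; apply: (smooth_ext _ F) => p Op; exact: eq_pder.
Qed.

(** Induction on the construction of [f]. In each case [H] computes the twofold derivative by the
    rule of that operation, and the result is symmetric in the two directions once this holds for
    the constituents. *)
Lemma pderC f i j p : smooth f -> Omega p ->
  pder (pder f i) j p = pder (pder f j) i p.
Proof.
have D g k q (sg : smooth g) (Oq : Omega q) := smooth_is_pder k sg Oq.
move=> sf; elim: sf p => {f}.
- move=> f af p Op.
  have E k q : Omega q ->
      pder (fun p => (f p)%:C%C) k q = ('D_(delta_mx 0 k) f q)%:C%C.
    move=> Oq; apply/is_pder_val/is_pder_real.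
    exact: (analytic_jet_derivable (i := k) (af q Oq)).
  have H k l : pder (pder (fun p => (f p)%:C%C) k) l p
      = ('D_(delta_mx 0 l) (fun q => 'D_(delta_mx 0 k) f q) p)%:C%C.
    rewrite (eq_pder l (E k) Op).
    apply/is_pder_val/is_pder_real/analytic_jet_derivable.
    by apply: analytic_jet_partial; exact: af.
  by rewrite (H i j) (H j i) analytic_jet_partialC//; exact: af.
- move=> c p Op.
  have H k l : pder (pder (fun=> c) k) l p = 0.
    rewrite (@eq_pder _ (fun=> 0) _ _ _ Op) => [|q _]; exact: pder_cst.
  by rewrite (H i j) (H j i).
- move=> f g sf F sg G p Op.
  have sp k := smooth_pder k sf; have sq k := smooth_pder k sg.
  have H k l : pder (pder (fun p => f p + g p) k) l p
      = pder (pder f k) l p + pder (pder g k) l p.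
    rewrite (eq_pder l (fun q => pderD (p := q) k sf sg) Op).
    exact: (is_pder_val (is_pderD (D _ l p (sp k) Op) (D _ l p (sq k) Op))).
  apply: (etrans (H i j)); apply: (etrans _ (esym (H j i))).
  move: (F p Op) (G p Op); move: (pder (pder f i) j p) (pder (pder f j) i p).
  by move: (pder (pder g i) j p) (pder (pder g j) i p) => ? ? ? ? -> ->.
- move=> f g sf F sg G p Op.
  have sp k := smooth_pder k sf; have sq k := smooth_pder k sg.
  have H k l : pder (pder (fun p => f p * g p) k) l p
      = (pder (pder f k) l p * g p + pder f k p * pder g l p)
        + (pder f l p * pder g k p + f p * pder (pder g k) l p).
    rewrite (eq_pder l (fun q => pderM (p := q) k sf sg) Op).
    exact: (is_pder_val (is_pderD
      (is_pderM (D _ l p (sp k) Op) (D _ l p sg Op))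
      (is_pderM (D _ l p sf Op) (D _ l p (sq k) Op)))).
  apply: (etrans (H i j)); apply: (etrans _ (esym (H j i))).
  move: (F p Op) (G p Op); move: (pder (pder f i) j p) (pder (pder f j) i p).
  move: (pder (pder g i) j p) (pder (pder g j) i p) (pder f i p) (pder f j p).
  by move: (pder g i p) (pder g j p) (f p) (g p) => ? ? ? ? ? ? ? ? ? ? -> ->; ring.
- move=> f sf F p Op; have sp k := smooth_pder k sf.
  have H k l : pder (pder (fun p => (f p)^*) k) l p = (pder (pder f k) l p)^*.
    rewrite (eq_pder l (fun q => pder_conj (p := q) k sf) Op).
    exact: (is_pder_val (is_pder_conj (D _ l p (sp k) Op))).
  apply: (etrans (H i j)); apply: (etrans _ (esym (H j i))).
  exact: congr1 (F p Op).
- move=> f f0 sf F p Op.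
  have sV := smoothV f0 sf; have sp k := smooth_pder k sf.
  (* The derivative of the inverse is written with products only, so that differentiating it again
     uses just the rules for products, constants and the inverse. *)
  have E k q : Omega q ->
    pder (fun p => (f p)^-1) k q = pder f k q * (-1 * ((f q)^-1 * (f q)^-1)).
    by move=> Oq; rewrite pderV ?f0// expr2 mulN1r mulrN mulNr.
  have DV l := is_pderV (f0 p Op) (D _ l p sf Op).
  have H k l := etrans (eq_pder l (E k) Op)
    (is_pder_val (is_pderM (D _ l p (sp k) Op)
      (is_pderM (is_pder_cst (-1) p l) (is_pderM (DV l) (DV l))))).
  apply: (etrans (H i j)); apply: (etrans _ (esym (H j i))).
  have sym (a b u v w : C) : a = b ->
    a * (-1 * (w * w))
      + u * (0 * (w * w) + -1 * (- v * w ^+ 2 * w + w * (- v * w ^+ 2))) =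
    b * (-1 * (w * w))
      + v * (0 * (w * w) + -1 * (- u * w ^+ 2 * w + w * (- u * w ^+ 2))).
    by move=> ->; ring.
  exact: sym (F p Op).
- move=> f g fg sf F p Op.
  have E k q : Omega q -> pder g k q = pder f k q.
    by move=> Oq; apply: eq_pder Oq => x Ox; rewrite fg.
  by rewrite (eq_pder j (E i) Op) (eq_pder i (E j) Op) F.
Qed.

Lemma smooth_sum (I : Type) (r : seq I) (P : pred I) (F : I -> pt -> C) :
  (forall x, P x -> smooth (F x)) -> smooth (fun p => \sum_(x <- r | P x) F x p).
Proof.
move=> sF; elim: r => [|x r IH].
  by apply: (smooth_ext _ (smooth_cst 0)) => p _; rewrite big_nil.
case Px: (P x); last first.
  by apply: (smooth_ext _ IH) => p _; rewrite big_cons Px.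
by apply: (smooth_ext _ (smoothD (sF x Px) IH)) => p _; rewrite big_cons Px.
Qed.

Lemma smooth_prod (I : Type) (r : seq I) (P : pred I) (F : I -> pt -> C) :
  (forall x, P x -> smooth (F x)) -> smooth (fun p => \prod_(x <- r | P x) F x p).
Proof.
move=> sF; elim: r => [|x r IH].
  by apply: (smooth_ext _ (smooth_cst 1)) => p _; rewrite big_nil.
case Px: (P x); last first.
  by apply: (smooth_ext _ IH) => p _; rewrite big_cons Px.
by apply: (smooth_ext _ (smoothM (sF x Px) IH)) => p _; rewrite big_cons Px.
Qed.

Definition smooth_mx (m k : nat) (M : pt -> 'M[C]_(m, k)) : Prop :=
  forall (a : 'I_m) (b : 'I_k), smooth (fun p => M p a b).

Lemma smooth_det k (M : pt -> 'M[C]_k) : smooth_mx M -> smooth (fun p => \det (M p)).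
Proof.
move=> sM; rewrite /determinant; apply: smooth_sum => s _.
by apply: smoothM; [exact: smooth_cst | exact: smooth_prod].
Qed.

(** Cramer's rule: the cofactors are polynomial in the entries, and the determinant has no zero on
    [Omega]. *)
Lemma smooth_invmx k (M : pt -> 'M[C]_k) :
  (forall p, Omega p -> M p \in unitmx) -> smooth_mx M ->
  smooth_mx (fun p => invmx (M p)).
Proof.
move=> uM sM i j.
have sdet : smooth (fun p => (\det (M p))^-1).
  by apply: smoothV => [p /uM|]; [rewrite unitmxE unitfE | exact: smooth_det].
have scof : smooth (fun p => cofactor (M p) j i).
  apply: smoothM; first exact: smooth_cst.
  apply: smooth_det => a b.
  by apply: (smooth_ext _ (sM (lift j a) (lift i b))) => p _; rewrite !mxE.
apply: (smooth_ext _ (smoothM sdet scof)) => p Op.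
by rewrite /invmx uM// !mxE.
Qed.

Lemma smooth_mulmx a b c (M : pt -> 'M[C]_(a, b)) (N : pt -> 'M[C]_(b, c)) :
  smooth_mx M -> smooth_mx N -> smooth_mx (fun p => M p *m N p).
Proof.
move=> sM sN i j.
apply: (@smooth_ext (fun p => \sum_k M p i k * N p k j)) => [p _|].
  by rewrite mxE.
by apply: smooth_sum => k _; exact: smoothM.
Qed.

End Smooth.

(** * The generator of T01 *)

Lemma derive_coord (R : realType) n (p : 'rV[R]_n.+1) (i k : 'I_n.+1) :
  is_derive p (delta_mx 0 i) (fun q : 'rV[R]_n.+1 => q 0 k) (k == i)%:R.
Proof.
apply: (@quadratic_is_derive _ _ _ _ _ _ 0 1) => // t _.
by rewrite line_coord mul0r mulr_natl [X in X - _ - _]addrC addrK subrr normr0.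
Qed.

Lemma sum_ord5 (T : nmodType) (F : 'I_5 -> T) :
  \sum_i F i = F ix + F iy + \sum_j F (iu j).
Proof.
rewrite (@big_split_ord _ _ _ 2 3); congr (_ + _).
by rewrite !big_ord_recl big_ord0 /= addr0; congr (F _ + F _); apply: val_inj.
Qed.

Section Generator.
Variables (R : realType) (phi : 'I_3 -> 'rV[R]_5 -> R).
Notation C := R[i].

(** The image [V] of [v] has blocks [V1] for [x, u] and [V2] for [y, v], and [cplxJ] sends them to
    [- V2, V1]. The condition is thus [V2 = 'i V1]; the other block equation follows from it by
    ['i * 'i = -1]. *)
Lemma T01P (p : 'rV[R]_5) (v : 'rV[C]_5) : T01 phi p v <->
  v 0 iy = 'i * v 0 ix /\
  forall j, \sum_i v 0 i * ('D_(delta_mx 0 i) (phi j) p)%:C%C = 'i * v 0 (iu j).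
Proof.
rewrite /T01 /=; set V := v *m _.
have Vcoord (k : 'I_(4 + 4)) (l : 'I_5) :
    (forall q : 'rV[R]_5, embed phi q 0 k = q 0 l) -> V 0 k = v 0 l.
  move=> E; rewrite mxE (bigD1 l)//= big1 ?addr0; last first.
    move=> i /negbTE il; rewrite !mxE; under eq_fun do rewrite E.
    by have [_ ->] := derive_coord p i l; rewrite eq_sym il mulr0.
  rewrite !mxE; under eq_fun do rewrite E.
  by have [_ ->] := derive_coord p l l; rewrite eqxx mulr1.
have Vx : V 0 (lshift (1 + 3) (lshift 3 (0 : 'I_1))) = v 0 ix.
  apply: Vcoord => q; apply: etrans (@row_mxEl _ 1 (1 + 3) (1 + 3) _ _ _ _) _.
  by rewrite row_mxEl mxE eqxx.
have Vy : V 0 (rshift (1 + 3) (lshift 3 (0 : 'I_1))) = v 0 iy.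
  apply: Vcoord => q; apply: etrans (@row_mxEr _ 1 (1 + 3) (1 + 3) _ _ _ _) _.
  by rewrite row_mxEl mxE eqxx.
have Vu j : V 0 (lshift (1 + 3) (rshift 1 j)) = v 0 (iu j).
  apply: Vcoord => q; apply: etrans (@row_mxEl _ 1 (1 + 3) (1 + 3) _ _ _ _) _.
  by rewrite row_mxEr mxE.
have Vp j : V 0 (rshift (1 + 3) (rshift 1 j)) =
    \sum_i v 0 i * ('D_(delta_mx 0 i) (phi j) p)%:C%C.
  rewrite mxE; apply: eq_bigr => i _; rewrite !mxE; apply: (congr1 (fun x => v 0 i * x%:C%C)).
  congr (derive _ p _); apply/funext => q.
  apply: etrans (@row_mxEr _ 1 (1 + 3) (1 + 3) _ _ _ _) _.
  by rewrite row_mxEr mxE.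
have VJ : V *m map_mx (real_complex R) (cplxJ R) = row_mx (- rsubmx V) (lsubmx V).
  rewrite /cplxJ map_block_mx !map_mx0 map_mxN map_mx1.
  rewrite -[V in LHS]hsubmxK mul_row_block !mulmx0 add0r addr0.
  by rewrite mulmxN !mulmx1.
rewrite VJ.
have ii : 'i * 'i = -1 :> C by rewrite -expr2 sqrCi.
split=> [E|[Ey Ep]].
  have H (k : 'I_4) : V 0 (rshift 4 k) = 'i * V 0 (lshift 4 k).
    have := congr1 (fun M : 'rV_(4 + 4) => M 0 (lshift 4 k)) E.
    rewrite row_mxEl !mxE => /eqP; rewrite mulNr eqr_opp => /eqP.
    exact.
  by split=> [|j]; [rewrite -Vy -Vx | rewrite -Vp -Vu].
have H (k : 'I_(1 + 3)) : V 0 (rshift (1 + 3) k) = 'i * V 0 (lshift (1 + 3) k).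
  case: (splitP k) => l kl.
    have -> : k = lshift 3 0 by apply: val_inj; rewrite /= kl (ord1 l).
    by rewrite Vy Vx.
  have -> : k = rshift 1 l by apply: val_inj.
  by rewrite Vp Vu.
apply/rowP => k; case: (splitP (k : 'I_(4 + 4))) => l kl.
  have -> : k = lshift 4 l by apply: val_inj.
  by rewrite row_mxEl !mxE; have := H l; rewrite !mxE mulNr => ->.
have -> : k = rshift 4 l by apply: val_inj.
rewrite row_mxEr !mxE; have := H l; rewrite !mxE => ->.
by rewrite mulrA mulNr ii opprK mul1r.
Qed.

Variables (Omega : set 'rV[R]_5) (Lb : vfield R 4).
Hypothesis graph : CR_generic_graph Omega phi.
Hypothesis gen : intrinsic_generator Omega phi Lb.

Let Phi p : 'M[C]_3 := \matrix_(k, j) ('D_(delta_mx 0 (iu k)) (phi j) p)%:C%C.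
Let N p : 'M[C]_3 := 'i%:M - Phi p.

(** A vector [w] in the left kernel of [N p] gives a vector [(0, 0, w)] of T01, hence a multiple of
    [Lb p]. Since the first entry of [Lb p] is [1/2], the multiple is zero: invertibility reflects
    that T01 is a line. *)
Let N_unit p : Omega p -> N p \in unitmx.
Proof.
move=> Op; rewrite -row_free_unit; apply: inj_row_free => w wN.
have [Lx Ly LT] := gen Op.
pose v : 'rV[C]_5 := row_mx (0 : 'rV_2) w.
have vx : v 0 ix = 0.
  have -> : ix = lshift 3 (0 : 'I_2) by apply: val_inj.
  by apply: etrans (@row_mxEl _ 1 2 3 _ _ _ _) _; rewrite mxE.
have vy : v 0 iy = 0.
  have -> : iy = lshift 3 (1 : 'I_2) by apply: val_inj.
  by apply: etrans (@row_mxEl _ 1 2 3 _ _ _ _) _; rewrite mxE.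
have vu j : v 0 (iu j) = w 0 j by exact: (@row_mxEr _ 1 2 3).
have /LT[c vE] : T01 phi p v.
  apply/T01P; split=> [|j]; first by rewrite vx vy mulr0.
  rewrite sum_ord5 vx vy !mul0r !add0r vu.
  have := congr1 (fun M : 'rV_3 => M 0 j) wN.
  rewrite mulmxBr mxE [X in _ + X]mxE mul_mx_scalar [X in _ = X]mxE [X in X - _]mxE.
  move/eqP; rewrite subr_eq0 => /eqP ->; rewrite mxE.
  by apply: eq_bigr => k _; rewrite vu mxE.
have c0 : c = 0.
  have := congr1 (fun M : 'rV_5 => M 0 ix) vE.
  rewrite vx mxE Lx => /esym/eqP; rewrite mulf_eq0 invr_eq0 pnatr_eq0 orbF.
  by move/eqP.
by apply/rowP => j; rewrite -vu vE c0 scale0r !mxE.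
Qed.

Let smooth_partial j i :
  smooth Omega (fun p => ('D_(delta_mx 0 i) (phi j) p)%:C%C).
Proof.
apply: smooth_real => p Op; apply: analytic_jet_partial.
by apply: real_analytic_jet; exact: graph_analytic graph _ _ Op.
Qed.

(** The [u]-components of [Lb] solve a linear system with matrix [N] and right-hand side [rhs], both
    built from first derivatives of [phi]; inverting the matrix stays inside the smooth
    functions. *)
Lemma smooth_generator : smooth_mx Omega Lb.
Proof.
pose rhs p : 'rV[C]_3 := \row_j (2^-1 * ('D_(delta_mx 0 ix) (phi j) p)%:C%C
  + 'i / 2 * ('D_(delta_mx 0 iy) (phi j) p)%:C%C).
have sN : smooth_mx Omega N.
  move=> k j; apply: (@smooth_ext _ _ _ (fun p => 'i *+ (k == j)
      - ('D_(delta_mx 0 (iu k)) (phi j) p)%:C%C)) => [p _|].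
    by rewrite !mxE.
  by apply: smoothB; [exact: smooth_cst | exact: smooth_partial].
have srhs : smooth_mx Omega rhs.
  move=> k j; apply: (@smooth_ext _ _ _ (fun p =>
    2^-1 * ('D_(delta_mx 0 ix) (phi j) p)%:C%C
    + 'i / 2 * ('D_(delta_mx 0 iy) (phi j) p)%:C%C)) => [p _|].
    by rewrite !mxE.
  by apply: smoothD; apply: smoothM; (exact: smooth_cst || exact: smooth_partial).
have sA := smooth_mulmx srhs (smooth_invmx N_unit sN).
have AE p j : Omega p -> (rhs p *m invmx (N p)) 0 j = Lb p 0 (iu j).
  move=> Op; have [Lx Ly LT] := gen Op.
  have /LT/T01P[_ E] : exists c, Lb p = c *: Lb p by exists 1; rewrite scale1r.
  pose a : 'rV_3 := \row_j Lb p 0 (iu j).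
  suff -> : rhs p = a *m N p by rewrite mulmxK ?N_unit// mxE.
  apply/rowP => k; rewrite mulmxBr [in RHS]mxE [X in _ + X]mxE mul_mx_scalar.
  rewrite [X in X - _]mxE [a 0 k]mxE -E sum_ord5 Lx Ly [in LHS]mxE [X in _ - X]mxE.
  rewrite [X in _ = _ - X](eq_bigr (fun j => Lb p 0 (iu j)
    * ('D_(delta_mx 0 (iu j)) (phi k) p)%:C%C)) ?addrK// => l _.
  by rewrite !mxE.
move=> i0 k; rewrite (ord1 i0); case: (splitP (k : 'I_(2 + 3))) => l kl.
  have [kx|ky] : k = ix \/ k = iy.
    by case: l kl => [[|[|//]] ?] kl; [left|right]; apply: val_inj.
  - rewrite kx; apply: (smooth_ext _ (smooth_cst _ 2^-1)) => p Op.
    by have [-> _ _] := gen Op.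
  - rewrite ky; apply: (smooth_ext _ (smooth_cst _ ('i / 2))) => p Op.
    by have [_ -> _] := gen Op.
have -> : k = iu l by apply: val_inj.
by apply: (smooth_ext _ (sA 0 l)) => p Op; rewrite AE.
Qed.

End Generator.

(** * Vector fields and brackets *)

Section Fields.
Variables (R : realType) (n : nat) (Omega : set 'rV[R]_n.+1).
Hypothesis oO : open Omega.
Notation pt := 'rV[R]_n.+1.
Notation C := R[i].
Notation smooth := (smooth Omega).
Notation smooth_mx := (smooth_mx Omega).
Implicit Types (f g : pt -> C) (p : pt) (X Y Z : vfield R n).

Lemma smooth_vapp X f : smooth_mx X -> smooth f -> smooth (vapp X f).
Proof.
move=> sX sf; apply: smooth_sum => i _; apply: smoothM; first exact: sX.
exact: (smooth_pder oO _ sf).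
Qed.

Lemma smooth_vconj X : smooth_mx X -> smooth_mx (vconj X).
Proof.
move=> sX i j; apply: (smooth_ext _ (smooth_conj (sX i j))) => p _.
by rewrite !mxE.
Qed.

Lemma smooth_bracket X Y : smooth_mx X -> smooth_mx Y -> smooth_mx (bracket X Y).
Proof.
move=> sX sY i j.
apply: (smooth_ext _ (smoothB (smooth_vapp sX (sY 0 j)) (smooth_vapp sY (sX 0 j)))).
by move=> p _; rewrite mxE.
Qed.

Lemma smooth_scale f X : smooth f -> smooth_mx X -> smooth_mx (fun p => f p *: X p).
Proof.
move=> sf sX i j; apply: (smooth_ext _ (smoothM sf (sX i j))) => p _.
by rewrite mxE.
Qed.

Lemma eq_vapp X f g p : (forall q, Omega q -> f q = g q) -> Omega p ->
  vapp X f p = vapp X g p.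
Proof.
by move=> fg Op; apply: eq_bigr => i _; congr (_ * _); exact: (eq_pder oO _ fg Op).
Qed.

Lemma eq_vapp_field X Y f p : X p = Y p -> vapp X f p = vapp Y f p.
Proof. by rewrite /vapp => ->. Qed.

Lemma vappZ_field f X g p : vapp (fun q => f q *: X q) g p = f p * vapp X g p.
Proof. by rewrite /vapp mulr_sumr; apply: eq_bigr => i _; rewrite mxE mulrA. Qed.

Lemma vappD_field X Y g p :
  vapp (fun q => X q + Y q) g p = vapp X g p + vapp Y g p.
Proof.
by rewrite /vapp -big_split; apply: eq_bigr => i _; rewrite mxE mulrDl.
Qed.

Lemma vapp_cst X (c : C) p : vapp X (fun=> c) p = 0.
Proof. by rewrite /vapp big1 // => i _; rewrite pder_cst mulr0. Qed.

Section Rules.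
Variables (X : vfield R n) (p : pt).
Hypothesis Op : Omega p.

Lemma vappD f g : smooth f -> smooth g ->
  vapp X (fun q => f q + g q) p = vapp X f p + vapp X g p.
Proof.
move=> sf sg; rewrite /vapp -big_split; apply: eq_bigr => i _ /=.
by rewrite -mulrDr; congr (_ * _); exact: (pderD oO _ sf sg Op).
Qed.

Lemma vappN f : smooth f -> vapp X (fun q => - f q) p = - vapp X f p.
Proof.
move=> sf; rewrite /vapp -sumrN; apply: eq_bigr => i _ /=.
by rewrite -mulrN; congr (_ * _); exact: (pderN oO _ sf Op).
Qed.

Lemma vappM f g : smooth f -> smooth g ->
  vapp X (fun q => f q * g q) p = vapp X f p * g p + f p * vapp X g p.
Proof.
move=> sf sg; rewrite /vapp mulr_suml mulr_sumr -big_split.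
apply: eq_bigr => i _ /=; rewrite mulrCA -mulrA -mulrDr; congr (_ * _).
exact: (pderM oO _ sf sg Op).
Qed.

Lemma vapp_conj f : smooth f ->
  vapp (vconj X) (fun q => (f q)^*) p = (vapp X f p)^*.
Proof.
move=> sf; rewrite /vapp rmorph_sum; apply: eq_bigr => i _ /=.
by rewrite rmorphM mxE; congr (_ * _); exact: (pder_conj oO _ sf Op).
Qed.

(* Records a derivative together with the smoothness needed by the product
   rule, so that derivatives of jet polynomials follow their syntax. *)
Definition is_vapp f (v : C) : Prop := smooth f /\ vapp X f p = v.

Lemma is_vapp_atom f : smooth f -> is_vapp f (vapp X f p).
Proof. by []. Qed.

Lemma is_vapp_cst c : is_vapp (fun=> c) 0.
Proof. by split; [exact: smooth_cst | exact: vapp_cst]. Qed.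

Lemma is_vappD f g u v : is_vapp f u -> is_vapp g v ->
  is_vapp (fun q => f q + g q) (u + v).
Proof.
by move=> [sf <-] [sg <-]; split; [exact: smoothD | exact: vappD].
Qed.

Lemma is_vappM f g u v : is_vapp f u -> is_vapp g v ->
  is_vapp (fun q => f q * g q) (u * g p + f p * v).
Proof.
by move=> [sf <-] [sg <-]; split; [exact: smoothM | exact: vappM].
Qed.

Lemma is_vappN f u : is_vapp f u -> is_vapp (fun q => - f q) (- u).
Proof. by move=> [sf <-]; split; [exact: smoothN | exact: vappN]. Qed.

End Rules.

(** The second-order terms of the two compositions cancel by [pderC]; this is the place where
    commutation of mixed partials enters. *)
Lemma vapp_bracket X Y f p : smooth_mx X -> smooth_mx Y -> smooth f -> Omega p ->
  vapp (bracket X Y) f p = vapp X (vapp Y f) p - vapp Y (vapp X f) p.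
Proof.
move=> sX sY sf Op.
have expand U V : smooth_mx V -> vapp U (vapp V f) p =
    \sum_i \sum_j (U p 0 i * pder (fun q => V q 0 j) i p * pder f j p)
    + \sum_i \sum_j U p 0 i * V p 0 j * pder (pder f j) i p.
  move=> sV; rewrite -big_split; apply: eq_bigr => i _ /=.
  have sj j : smooth (fun q => V q 0 j * pder f j q).
    by apply: smoothM; [exact: sV | exact: (smooth_pder oO _ sf)].
  have D j : is_pder (fun q => V q 0 j * pder f j q) p i
      (pder (fun q => V q 0 j) i p * pder f j p + V p 0 j * pder (pder f j) i p).
    exact: (is_pderM (smooth_is_pder oO i (sV 0 j) Op)
      (smooth_is_pder oO i (smooth_pder oO j sf) Op)).
  have DS (s : seq 'I_n.+1) :
      is_pder (fun q => \sum_(j <- s) V q 0 j * pder f j q) p i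
       (\sum_(j <- s) (pder (fun q => V q 0 j) i p * pder f j p
         + V p 0 j * pder (pder f j) i p)).
    elim: s => [|j s IH].
      rewrite big_nil; under eq_fun do rewrite big_nil; exact: is_pder_cst.
    by rewrite big_cons; under eq_fun do rewrite big_cons; exact: is_pderD.
  rewrite (is_pder_val (DS _)) mulr_sumr -big_split; apply: eq_bigr => j _ /=.
  by rewrite mulrDr !mulrA.
rewrite (expand _ _ sX) (expand _ _ sY).
have -> : \sum_i \sum_j Y p 0 i * X p 0 j * pder (pder f j) i p
   = \sum_i \sum_j X p 0 i * Y p 0 j * pder (pder f j) i p.
  rewrite exchange_big; apply: eq_bigr => i _; apply: eq_bigr => j _ /=.
  exact: (congr2 *%R (mulrC _ _) (pderC oO _ _ sf Op)).
rewrite opprD addrACA subrr addr0 [LHS]/vapp.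
under eq_bigr do rewrite mxE mulrBl.
rewrite sumrB; apply: (congr2 (fun a b => a - b));
by rewrite exchange_big; apply: eq_bigr => i _ /=; rewrite [in LHS]/vapp mulr_suml.
Qed.

Lemma bracketC X Y p : bracket X Y p = - bracket Y X p.
Proof. by apply/rowP => i; rewrite !mxE opprB. Qed.

Lemma eq_bracket X X' Y Y' p : (forall q, Omega q -> X q = X' q) ->
  (forall q, Omega q -> Y q = Y' q) -> Omega p ->
  bracket X Y p = bracket X' Y' p.
Proof.
move=> eX eY Op; apply/rowP => i; rewrite !mxE.
rewrite (@eq_vapp X _ (fun q => Y' q 0 i))// => [|q Oq]; last by rewrite eY.
rewrite (@eq_vapp Y _ (fun q => X' q 0 i))// => [|q Oq]; last by rewrite eX.
by congr (_ - _); apply: eq_vapp_field; [exact: eX | exact: eY].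
Qed.

Lemma bracketDr X Y Z p : smooth_mx Y -> smooth_mx Z -> Omega p ->
  bracket X (fun q => Y q + Z q) p = bracket X Y p + bracket X Z p.
Proof.
move=> sY sZ Op; apply/rowP => i; rewrite !mxE.
under eq_fun do rewrite mxE.
by rewrite (vappD _ Op (sY 0 i) (sZ 0 i)) vappD_field opprD addrACA.
Qed.

Lemma bracketZr X f Y p : smooth f -> smooth_mx Y -> Omega p ->
  bracket X (fun q => f q *: Y q) p = vapp X f p *: Y p + f p *: bracket X Y p.
Proof.
move=> sf sY Op; apply/rowP => i; rewrite !mxE.
under eq_fun do rewrite mxE.
by rewrite (vappM _ Op sf (sY 0 i)) vappZ_field mulrBr addrA.
Qed.

Lemma bracket_conj X Y p : smooth_mx X -> smooth_mx Y -> Omega p ->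
  bracket (vconj X) (vconj Y) p = conjr (bracket X Y p).
Proof.
move=> sX sY Op; apply/rowP => i; rewrite !mxE rmorphB.
by congr (_ - _); under eq_fun do rewrite mxE; rewrite vapp_conj.
Qed.

(** Componentwise, all terms are twofold derivatives of coordinate functions of the fields once
    [vapp_bracket] is applied, and they cancel in pairs. *)
Lemma jacobi X Y Z p : smooth_mx X -> smooth_mx Y -> smooth_mx Z -> Omega p ->
  bracket (bracket X Y) Z p =
    bracket X (bracket Y Z) p - bracket Y (bracket X Z) p.
Proof.
move=> sX sY sZ Op; apply/rowP => i.
have bE (U V : vfield R n) q : bracket U V q 0 i =
    vapp U (fun q => V q 0 i) q - vapp V (fun q => U q 0 i) q by rewrite mxE.
rewrite (bE (bracket X Y) Z) [RHS]mxE [in X in _ = _ + X]mxE.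
rewrite (bE X (bracket Y Z)) (bE Y (bracket X Z)).
have eB (U V W : vfield R n) : smooth_mx U -> smooth_mx V ->
    vapp W (fun q => bracket U V q 0 i) p =
    vapp W (vapp U (fun q => V q 0 i)) p - vapp W (vapp V (fun q => U q 0 i)) p.
  move=> sU sV; under eq_fun do rewrite mxE.
  have s1 := smooth_vapp sU (sV 0 i); have s2 := smooth_vapp sV (sU 0 i).
  exact: (is_vappD Op (is_vapp_atom W p s1) (is_vappN Op (is_vapp_atom W p s2))).2.
rewrite (vapp_bracket sX sY (sZ 0 i) Op) (eB _ _ _ sX sY) (eB _ _ _ sY sZ).
rewrite (eB _ _ _ sX sZ) (vapp_bracket sY sZ (sX 0 i) Op).
rewrite (vapp_bracket sX sZ (sY 0 i) Op).
move: (vapp X (vapp Y _) p) (vapp Y (vapp X _) p) (vapp Z (vapp X _) p)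
  (vapp Z (vapp Y _) p) (vapp X (vapp Z _) p) (vapp Y (vapp Z _) p).
by move=> *; ring.
Qed.

End Fields.

(** * The frame and its commutators *)

Lemma forall_ord5 (P : 'I_5 -> Prop) : P 0 -> P 1 -> P 2 -> P 3 -> P 4 ->
  forall i, P i.
Proof.
move=> P0 P1 P2 P3 P4 [[|[|[|[|[|//]]]]] Hi].
- by have -> : Ordinal Hi = 0 by apply: val_inj.
- by have -> : Ordinal Hi = 1 by apply: val_inj.
- by have -> : Ordinal Hi = 2 by apply: val_inj.
- by have -> : Ordinal Hi = 3 by apply: val_inj.
- by have -> : Ordinal Hi = 4 by apply: val_inj.
Qed.

Lemma big_ord5 (T : nmodType) (F : 'I_5 -> T) :
  \sum_i F i = F 0 + F 1 + F 2 + F 3 + F 4.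
Proof.
rewrite !big_ord_recl big_ord0 /= addr0 !addrA.
by congr (F _ + F _ + F _ + F _ + F _); apply: val_inj.
Qed.

Definition row5 (T : Type) (x0 x1 x2 x3 x4 : T) : 'rV[T]_5 :=
  \row_i nth x0 [:: x0; x1; x2; x3; x4] i.

Section Conjugation.
Variables (R : realType) (n : nat).
Notation C := R[i].

Lemma conjrK : involutive (@conjr R n).
Proof. by move=> v; apply/rowP => i; rewrite !mxE conjCK. Qed.

Lemma conjrD (v w : 'rV[C]_n.+1) : conjr (v + w) = conjr v + conjr w.
Proof. by apply/rowP => i; rewrite !mxE rmorphD. Qed.

Lemma conjrZ (c : C) (v : 'rV[C]_n.+1) : conjr (c *: v) = c^* *: conjr v.
Proof. by apply/rowP => i; rewrite !mxE rmorphM. Qed.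

Lemma vconjK (X : vfield R n) : vconj (vconj X) = X.
Proof. by apply/funext => p; rewrite /vconj conjrK. Qed.

End Conjugation.

Section CRFrame.
Variables (R : realType) (Omega : set 'rV[R]_5) (Lb : vfield R 4).
Notation C := R[i].
Notation pt := 'rV[R]_5.
Notation L := (fieldL Lb).
Notation T := (fieldT Lb).
Notation S := (fieldS Lb).
Notation Sb := (fieldSb Lb).
Hypothesis oO : open Omega.
Hypothesis sLb : smooth_mx Omega Lb.

Lemma smooth_fieldL : smooth_mx Omega L.
Proof. exact: smooth_vconj. Qed.

Lemma smooth_fieldT : smooth_mx Omega T.
Proof.
apply: (@smooth_scale _ _ _ (fun=> 'i) (bracket L Lb)); first exact: smooth_cst.
by apply: smooth_bracket => //; exact: smooth_fieldL.
Qed.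

Lemma smooth_fieldS : smooth_mx Omega S.
Proof. by apply: smooth_bracket => //; [exact: smooth_fieldL | exact: smooth_fieldT]. Qed.

Lemma smooth_fieldSb : smooth_mx Omega Sb.
Proof. by apply: smooth_bracket => //; exact: smooth_fieldT. Qed.

Hint Resolve smooth_fieldL smooth_fieldT smooth_fieldS smooth_fieldSb : core.

Lemma vapp_L_conj f p : smooth Omega f -> Omega p ->
  vapp L (fun q => (f q)^*) p = (vapp Lb f p)^*.
Proof. by move=> sf Op; exact: (vapp_conj oO). Qed.

Lemma vapp_Lb_conj f p : smooth Omega f -> Omega p ->
  vapp Lb (fun q => (f q)^*) p = (vapp L f p)^*.
Proof.
by move=> sf Op; rewrite -[in LHS](vconjK Lb); exact: (vapp_conj oO).
Qed.

Lemma vapp_T f p : smooth Omega f -> Omega p ->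
  vapp T f p = 'i * (vapp L (vapp Lb f) p - vapp Lb (vapp L f) p).
Proof.
by move=> sf Op; rewrite (vappZ_field (fun=> 'i)) (vapp_bracket oO).
Qed.

Lemma vapp_S f p : smooth Omega f -> Omega p ->
  vapp S f p = vapp L (vapp T f) p - vapp T (vapp L f) p.
Proof. by move=> sf Op; rewrite (vapp_bracket oO). Qed.

Lemma vapp_Sb f p : smooth Omega f -> Omega p ->
  vapp Sb f p = vapp Lb (vapp T f) p - vapp T (vapp Lb f) p.
Proof. by move=> sf Op; rewrite (vapp_bracket oO). Qed.

Lemma conjr_T p : Omega p -> conjr (T p) = T p.
Proof.
move=> Op; apply: etrans (conjrZ _ _) _.
rewrite -(bracket_conj oO smooth_fieldL sLb Op) [vconj L]vconjK.
by rewrite bracketC conjCi scalerN scaleNr opprK.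
Qed.

Lemma conjr_S p : Omega p -> conjr (S p) = Sb p.
Proof.
move=> Op; apply: etrans (esym (bracket_conj oO smooth_fieldL smooth_fieldT Op)) _.
rewrite [vconj L]vconjK.
by apply: (eq_bracket oO _ _ Op) => // q Oq; exact: conjr_T.
Qed.

Lemma conjr_Sb p : Omega p -> conjr (Sb p) = S p.
Proof. by move=> Op; rewrite -conjr_S// conjrK. Qed.

Lemma vapp_T_conj f p : smooth Omega f -> Omega p ->
  vapp T (fun q => (f q)^*) p = (vapp T f p)^*.
Proof.
move=> sf Op; rewrite -(vapp_conj oO)//; apply: eq_vapp_field.
by rewrite /vconj conjr_T.
Qed.

Definition frame_field (a : 'I_5) : vfield R 4 :=
  nth (fun=> 0) [:: Sb; S; T; Lb; L] a.

Lemma row_frame p a : row a (frame Lb p) = frame_field a p.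
Proof.
apply/rowP => j; rewrite !mxE; congr (fun_of_matrix _ 0 j).
by elim/forall_ord5 : a.
Qed.

Lemma frame_combE (v : 'rV[C]_5) p : v *m frame Lb p =
  v 0 0 *: Sb p + v 0 1 *: S p + v 0 2 *: T p + v 0 3 *: Lb p + v 0 4 *: L p.
Proof.
by rewrite mulmx_sum_row big_ord5 !row_frame.
Qed.

Lemma smooth_frame_field a : smooth_mx Omega (frame_field a).
Proof. by elim/forall_ord5 : a. Qed.

Lemma smooth_frame : smooth_mx Omega (frame Lb).
Proof.
move=> a j; apply: (smooth_ext _ (smooth_frame_field a 0 j)) => p Op.
by rewrite -row_frame mxE.
Qed.

Hypothesis frameU : maximally_minimal Lb Omega.

Lemma frame_inj p (v w : 'rV[C]_5) : Omega p ->
  v *m frame Lb p = w *m frame Lb p -> v = w.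
Proof. by move=> /frameU Fu /(congr1 (mulmx^~ (invmx (frame Lb p)))); rewrite !mulmxK. Qed.

(** This makes [fP], [fQ], [fA] and [fB] differentiable: they are known only as coordinates of
    brackets in the frame. *)
Lemma smooth_coord (v : pt -> 'rV[C]_5) (X : vfield R 4) a : smooth_mx Omega X ->
  (forall p, Omega p -> X p = v p *m frame Lb p) ->
  smooth Omega (fun p => v p 0 a).
Proof.
move=> sX E.
have sc := smooth_mulmx sX (smooth_invmx frameU smooth_frame).
apply: (smooth_ext _ (sc 0 a)) => p Op.
by rewrite E// mulmxK// frameU.
Qed.

Section Coframe.
Variables (f : pt -> 'rV[C]_5).
Hypothesis sf : smooth_mx Omega f.

Definition coframe p : 'M[C]_5 := (invmx (frame Lb p))^T.

Definition coform : form1 R 4 := fun p => f p *m coframe p.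

Lemma smooth_coform : smooth_mx Omega coform.
Proof.
apply: smooth_mulmx => // i j.
apply: (smooth_ext _ (smooth_invmx frameU smooth_frame j i)) => p _.
by rewrite [RHS]mxE.
Qed.

Lemma coform_frame p a : Omega p ->
  \sum_i coform p 0 i * frame_field a p 0 i = f p 0 a.
Proof.
move=> Op; transitivity ((coform p *m (frame Lb p)^T) 0 a).
  by rewrite [RHS]mxE; apply: eq_bigr => i _; rewrite -row_frame !mxE.
by rewrite /coform /coframe -mulmxA -trmx_mul mulmxV ?frameU// trmx1 mulmx1.
Qed.

(* Cartan's formula dw(X_a, X_b) = X_a w(X_b) - X_b w(X_a) - w([X_a, X_b]). *)
Lemma dform_coform p (K : 'M[C]_5) : Omega p ->
  (forall a b, K a b = vapp (frame_field a) (fun q => f q 0 b) p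
     - vapp (frame_field b) (fun q => f q 0 a) p
     - \sum_i coform p 0 i * bracket (frame_field a) (frame_field b) p 0 i) ->
  dform coform p = (coframe p)^T *m K *m coframe p.
Proof.
move=> Op KE; set Th := coframe p; set F := frame Lb p.
suff -> : K = F *m dform coform p *m F^T.
  rewrite /Th /coframe trmxK !mulmxA mulVmx ?frameU// mul1mx -mulmxA -trmx_mul.
  by rewrite mulVmx ?frameU// trmx1 mulmx1.
apply/matrixP => a b; rewrite KE.
have sw := smooth_coform.
have X_w (U V : vfield R 4) : smooth_mx Omega V ->
    vapp U (fun q => \sum_i coform q 0 i * V q 0 i) p =
    \sum_i \sum_j U p 0 i * pder (fun q => coform q 0 j) i p * V p 0 j
    + \sum_j coform p 0 j * vapp U (fun q => V q 0 j) p.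
  move=> sV.
  have DS (s : seq 'I_5) :
      is_vapp Omega U p (fun q => \sum_(j <- s) coform q 0 j * V q 0 j)
       (\sum_(j <- s) (vapp U (fun q => coform q 0 j) p * V p 0 j
         + coform p 0 j * vapp U (fun q => V q 0 j) p)).
    elim: s => [|j s IH].
      rewrite big_nil; under eq_fun do rewrite big_nil; exact: (is_vapp_cst Omega U p 0).
    rewrite big_cons; under eq_fun do rewrite big_cons.
    apply: (is_vappD oO Op) IH.
    exact: (is_vappM oO Op (is_vapp_atom U p (sw 0 j)) (is_vapp_atom U p (sV 0 j))).
  rewrite (DS _).2 big_split exchange_big; congr (_ + _); apply: eq_bigr => j _ /=.
  by rewrite {1}/vapp mulr_suml.
have wf c (U : vfield R 4) : vapp U (fun q => f q 0 c) p =
    vapp U (fun q => \sum_i coform q 0 i * frame_field c q 0 i) p.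
  by apply: (eq_vapp oO) Op => q Oq; rewrite coform_frame.
rewrite (wf b) (wf a) !X_w; try exact: smooth_frame_field.
have -> : \sum_i coform p 0 i * bracket (frame_field a) (frame_field b) p 0 i =
   \sum_j coform p 0 j * vapp (frame_field a) (fun q => frame_field b q 0 j) p
   - \sum_j coform p 0 j * vapp (frame_field b) (fun q => frame_field a q 0 j) p.
  by rewrite -sumrB; apply: eq_bigr => j _; rewrite [X in _ * X]mxE mulrBr.
have -> : (F *m dform coform p *m F^T) a b =
  \sum_i \sum_j frame_field a p 0 i * pder (fun q => coform q 0 j) i p
      * frame_field b p 0 j
  - \sum_i \sum_j frame_field b p 0 i * pder (fun q => coform q 0 j) i p
      * frame_field a p 0 j.
  rewrite mxE; under eq_bigr do rewrite mxE mulr_suml.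
  rewrite exchange_big [X in _ - X]exchange_big -sumrB; apply: eq_bigr => i _ /=.
  rewrite -sumrB; apply: eq_bigr => j _.
  rewrite -!row_frame !mxE -/F.
  by move: (pder _ i p) (pder _ j p) => u v; ring.
move: (\sum_i _) (\sum_i _) (\sum_i _) (\sum_i _) => u v x y; ring.
Qed.

End Coframe.
End CRFrame.

Lemma addr_rev3 (V : zmodType) (x y z : V) : x + y + z = z + y + x.
Proof. by rewrite addrC (addrC x) addrA. Qed.

Section ConjugationRules.
Variable R : realType.
Implicit Types x y : R[i].

Lemma conjM x y : (x * y)^* = x^* * y^*. Proof. exact: rmorphM. Qed.
Lemma conjD x y : (x + y)^* = x^* + y^*. Proof. exact: rmorphD. Qed.
Lemma conjN x : (- x)^* = - x^*. Proof. exact: rmorphN. Qed.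
Lemma conj_i : ('i : R[i])^* = - 'i. Proof. exact: conjCi. Qed.
Lemma conjV x : (x^-1)^* = (x^*)^-1. Proof. exact: fmorphV. Qed.
Lemma conjn n : (n%:R : R[i])^* = n%:R. Proof. exact: rmorph_nat. Qed.
Lemma conjX x n : (x ^+ n)^* = x^* ^+ n. Proof. exact: rmorphXn. Qed.

End ConjugationRules.

Lemma conjr_comb3 (R : realType) n (x y z : R[i]) (u v w : 'rV[R[i]]_n.+1) :
  conjr (x *: u + y *: v + z *: w) =
  x^* *: conjr u + y^* *: conjr v + z^* *: conjr w.
Proof. by rewrite !conjrD !conjrZ. Qed.

Section Commutators.
Variables (R : realType) (Omega : set 'rV[R]_5) (Lb : vfield R 4).
Variables (fP fQ fR fB : 'rV[R]_5 -> R[i]) (fA : 'rV[R]_5 -> R).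
Notation C := R[i].
Notation pt := 'rV[R]_5.
Notation L := (fieldL Lb).
Notation T := (fieldT Lb).
Notation S := (fieldS Lb).
Notation Sb := (fieldSb Lb).
Hypothesis oO : open Omega.
Hypothesis sLb : smooth_mx Omega Lb.
Hypothesis frameU : maximally_minimal Lb Omega.
Hypothesis str : structure_functions Lb Omega fP fQ fR fB fA.
Hypothesis R0 : forall p, Omega p -> fR p = 0.

Notation sL := (smooth_fieldL sLb).
Notation sT := (smooth_fieldT oO sLb).
Notation sS := (smooth_fieldS oO sLb).
Notation sSb := (smooth_fieldSb oO sLb).

Definition Ac (p : pt) : C := (fA p)%:C%C.
Definition Pb (p : pt) : C := (fP p)^*.
Definition Qb (p : pt) : C := (fQ p)^*.
Definition Bb (p : pt) : C := (fB p)^*.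

Lemma row5E (x0 x1 x2 x3 x4 : C) p :
  row5 x0 x1 x2 x3 x4 *m frame Lb p =
  x0 *: Sb p + x1 *: S p + x2 *: T p + x3 *: Lb p + x4 *: L p.
Proof. by rewrite frame_combE !mxE. Qed.

Lemma smooth_P : smooth Omega fP.
Proof.
have E p : Omega p -> bracket L S p = row5 (fR p) (fQ p) (fP p) 0 0 *m frame Lb p.
  move=> Op; have [e _ _] := str Op; rewrite row5E !scale0r !addr0.
  exact: etrans e (addr_rev3 _ _ _).
have := smooth_coord oO sLb frameU 2 (smooth_bracket oO sL sS) E.
by apply: smooth_ext => p _; rewrite mxE.
Qed.

Lemma smooth_Q : smooth Omega fQ.
Proof.
have E p : Omega p -> bracket L S p = row5 (fR p) (fQ p) (fP p) 0 0 *m frame Lb p.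
  move=> Op; have [e _ _] := str Op; rewrite row5E !scale0r !addr0.
  exact: etrans e (addr_rev3 _ _ _).
have := smooth_coord oO sLb frameU 1 (smooth_bracket oO sL sS) E.
by apply: smooth_ext => p _; rewrite mxE.
Qed.

Lemma smooth_AB : smooth Omega Ac /\ smooth Omega fB.
Proof.
have E p : Omega p ->
    bracket Lb S p = row5 (fB p)^* (fB p) (Ac p) 0 0 *m frame Lb p.
  move=> Op; have [_ e _] := str Op; rewrite row5E !scale0r !addr0.
  exact: etrans e (addr_rev3 _ _ _).
have sc a := smooth_coord oO sLb frameU a (smooth_bracket oO sLb sS) E.
split; first by move: (sc 2); apply: smooth_ext => p _; rewrite mxE.
by move: (sc 1); apply: smooth_ext => p _; rewrite mxE.
Qed.

Lemma smooth_A : smooth Omega Ac. Proof. by case: smooth_AB. Qed.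
Lemma smooth_B : smooth Omega fB. Proof. by case: smooth_AB. Qed.
Lemma smooth_Pb : smooth Omega Pb. Proof. exact: smooth_conj smooth_P. Qed.
Lemma smooth_Qb : smooth Omega Qb. Proof. exact: smooth_conj smooth_Q. Qed.
Lemma smooth_Bb : smooth Omega Bb. Proof. exact: smooth_conj smooth_B. Qed.

Lemma conj_Ac p : (Ac p)^* = Ac p.
Proof. exact: conjc_real. Qed.

Lemma bracket_comb3 (U X Y Z : vfield R 4) (f g h : pt -> C) p :
  smooth Omega f -> smooth Omega g -> smooth Omega h ->
  smooth_mx Omega X -> smooth_mx Omega Y -> smooth_mx Omega Z -> Omega p ->
  bracket U (fun q => f q *: X q + g q *: Y q + h q *: Z q) p =
    (vapp U f p *: X p + f p *: bracket U X p)
    + (vapp U g p *: Y p + g p *: bracket U Y p)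
    + (vapp U h p *: Z p + h p *: bracket U Z p).
Proof.
move=> sf sg sh sX sY sZ Op.
have s1 := smooth_scale sf sX; have s2 := smooth_scale sg sY.
have s3 := smooth_scale sh sZ.
have s12 : smooth_mx Omega (fun q => f q *: X q + g q *: Y q).
  move=> i j; apply: (smooth_ext _ (smoothD (s1 i j) (s2 i j))) => q _.
  by rewrite [RHS]mxE.
rewrite (bracketDr oO U s12 s3 Op) (bracketDr oO U s1 s2 Op).
by rewrite (bracketZr oO U sf sX Op) (bracketZr oO U sg sY Op) (bracketZr oO U sh sZ Op).
Qed.

Lemma bracket_L_Lb p : bracket L Lb p = - 'i *: T p.
Proof. by rewrite scalerA mulNr -expr2 sqrCi opprK scale1r. Qed.

Lemma bracket_L_S p : Omega p -> bracket L S p = fP p *: T p + fQ p *: S p.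
Proof.
move=> Op; have [e _ _] := str Op; apply: etrans e _.
by rewrite (R0 Op) (scale0r (Sb p)) addr0.
Qed.

Lemma bracket_Lb_S p : Omega p ->
  bracket Lb S p = Ac p *: T p + fB p *: S p + Bb p *: Sb p.
Proof. by move=> Op; have [_ -> _] := str Op. Qed.

Lemma bracket_L_Sb p : Omega p ->
  bracket L Sb p = Ac p *: T p + fB p *: S p + Bb p *: Sb p.
Proof. by move=> Op; have [_ _ ->] := str Op. Qed.

Lemma bracket_Lb_Sb p : Omega p -> bracket Lb Sb p = Pb p *: T p + Qb p *: Sb p.
Proof.
move=> Op; have e : bracket Lb Sb p = bracket (vconj L) (vconj S) p.
  rewrite [vconj L]vconjK; apply: (eq_bracket oO) => // q Oq.
  by rewrite /vconj (conjr_S oO sLb).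
apply: etrans e _; rewrite (bracket_conj oO sL sS Op) bracket_L_S// conjrD.
rewrite (conjrZ (fP p)) (conjrZ (fQ p)).
by rewrite (conjr_T oO sLb Op) (conjr_S oO sLb Op).
Qed.

(** [tE], [tF], [tG] are the coefficients of [[T, S]] on [T], [S], [Sb]. The primed functions are
    their conjugates, so [tE'], [tF'], [tG'] belong to [T], [Sb], [S] in [[T, Sb]]. *)
Definition tG p : C := 'i * (vapp L Bb p + Bb p * Bb p - fP p - fQ p * Bb p).
Definition tF p : C := 'i * (Ac p + vapp L fB p + fB p * Bb p - vapp Lb fQ p).
Definition tE p : C := 'i * (vapp L Ac p + fB p * fP p + Ac p * Bb p
  - vapp Lb fP p - Ac p * fQ p).
Definition tG' p : C := - 'i * (vapp Lb fB p + fB p * fB p - Pb p - Qb p * fB p).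
Definition tF' p : C := - 'i * (Ac p + vapp Lb Bb p + Bb p * fB p - vapp L Qb p).
Definition tE' p : C := - 'i * (vapp Lb Ac p + Bb p * Pb p + Ac p * fB p
  - vapp L Pb p - Ac p * Qb p).

Lemma smooth_vL f : smooth Omega f -> smooth Omega (vapp L f).
Proof. exact: (smooth_vapp oO sL). Qed.
Lemma smooth_vLb f : smooth Omega f -> smooth Omega (vapp Lb f).
Proof. exact: (smooth_vapp oO sLb). Qed.
Lemma smooth_vT f : smooth Omega f -> smooth Omega (vapp T f).
Proof. exact: (smooth_vapp oO sT). Qed.

Local Ltac smt := repeat first
  [ exact: smooth_A | exact: smooth_B | exact: smooth_P | exact: smooth_Q
  | exact: smooth_Bb | exact: smooth_Pb | exact: smooth_Qb
  | apply: smooth_vL | apply: smooth_vLb | apply: smooth_vT | exact: smooth_cst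
  | apply: smoothB | apply: smoothD | apply: smoothM | apply: smoothN ].

Lemma smooth_tG : smooth Omega tG. Proof. by rewrite /tG; smt. Qed.
Lemma smooth_tF : smooth Omega tF. Proof. by rewrite /tF; smt. Qed.
Lemma smooth_tE : smooth Omega tE. Proof. by rewrite /tE; smt. Qed.
Lemma smooth_tG' : smooth Omega tG'. Proof. by rewrite /tG'; smt. Qed.
Lemma smooth_tF' : smooth Omega tF'. Proof. by rewrite /tF'; smt. Qed.
Lemma smooth_tE' : smooth Omega tE'. Proof. by rewrite /tE'; smt. Qed.

Lemma conj_Bb : (fun q => (Bb q)^*) = fB.
Proof. by apply/funext => q; rewrite /Bb conjCK. Qed.
Lemma conj_Ac_fun : (fun q => (Ac q)^*) = Ac.
Proof. by apply/funext => q; rewrite conj_Ac. Qed.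

Lemma conj_tG p : Omega p -> (tG p)^* = tG' p.
Proof.
move=> Op; rewrite /tG /tG' !(conjM, conjD, conjN, conj_i).
by rewrite -(vapp_Lb_conj Lb oO) ?conj_Bb ?conjCK//; exact: smooth_Bb.
Qed.

Lemma conj_tF p : Omega p -> (tF p)^* = tF' p.
Proof.
move=> Op; rewrite /tF /tF' !(conjM, conjD, conjN, conj_i).
rewrite -(vapp_Lb_conj Lb oO smooth_B Op) -(vapp_L_conj Lb oO smooth_Q Op) conj_Ac.
by rewrite /Bb conjCK.
Qed.

Lemma conj_tE p : Omega p -> (tE p)^* = tE' p.
Proof.
move=> Op; rewrite /tE /tE' !(conjM, conjD, conjN, conj_i).
rewrite -(vapp_Lb_conj Lb oO smooth_A Op) -(vapp_L_conj Lb oO smooth_P Op) conj_Ac_fun.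
by rewrite conj_Ac /Bb conjCK.
Qed.

(** As [T] is ['i] times [[L, Lb]], the Jacobi identity gives [[T, S]] as ['i] times the difference
    of [[L, [Lb, S]]] and [[Lb, [L, S]]], whose inner brackets are the structure equations. *)
Lemma bracket_T_S p : Omega p ->
  bracket T S p = tE p *: T p + tF p *: S p + tG p *: Sb p.
Proof.
move=> Op.
have -> : bracket T S p = 'i *: bracket (bracket L Lb) S p.
  rewrite bracketC (bracketZr (f := fun=> 'i) oO S (smooth_cst _ _) (smooth_bracket oO sL sLb) Op).
  by rewrite vapp_cst scale0r add0r -scalerN -bracketC.
rewrite (jacobi oO sL sLb sS Op).
rewrite (eq_bracket oO (fun q _ => erefl (L q)) bracket_Lb_S Op).
rewrite (bracket_comb3 _ smooth_A smooth_B smooth_Bb sT sS sSb Op).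
(* The zero third term only gives the bracket the three-term shape of [bracket_comb3]. *)
have E q : Omega q -> bracket L S q = fP q *: T q + fQ q *: S q + 0 *: T q.
  by move=> Oq; rewrite bracket_L_S// scale0r addr0.
rewrite (eq_bracket oO (fun q _ => erefl (Lb q)) E Op).
rewrite (bracket_comb3 (h := fun=> 0) _ smooth_P smooth_Q (smooth_cst _ 0) sT sS sT Op).
rewrite vapp_cst !scale0r addr0.
rewrite -[bracket L T p]/(S p) -[bracket Lb T p]/(Sb p).
rewrite bracket_L_S// bracket_L_Sb// bracket_Lb_S// /tE /tF /tG.
move: (T p) (S p) (Sb p) (Ac p) (fB p) (Bb p) (fP p) (fQ p) => t s sb A B B' P Q.
move: (vapp L _ p) (vapp L _ p) (vapp L _ p) (vapp Lb _ p) (vapp Lb _ p) => x y z u v.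
by apply/rowP => j; rewrite !mxE; ring.
Qed.

Lemma bracket_T_Sb p : Omega p ->
  bracket T Sb p = tE' p *: T p + tF' p *: Sb p + tG' p *: S p.
Proof.
move=> Op.
have e : bracket T Sb p = bracket (vconj T) (vconj S) p.
  by apply: (eq_bracket oO) => // q Oq; rewrite /vconj ?(conjr_S oO sLb)// (conjr_T oO sLb).
apply: etrans e _; rewrite (bracket_conj oO sT sS Op) bracket_T_S// conjr_comb3.
by rewrite (conjr_T oO sLb Op) (conjr_S oO sLb Op) (conjr_Sb oO sLb Op)
  (conj_tE Op) (conj_tF Op) (conj_tG Op).
Qed.

Definition hT p : C := vapp L tE' p + tF' p * Ac p + tG' p * fP p - vapp T Ac p
  - fB p * tE p - Bb p * tE' p.
Definition hS p : C := tE' p + tF' p * fB p + vapp L tG' p + tG' p * fQ p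
  - vapp T fB p - fB p * tF p - Bb p * tG' p.
Definition hSb p : C := vapp L tF' p + tF' p * Bb p - vapp T Bb p
  - fB p * tG p - Bb p * tF' p.

(** Since [S] is [[L, T]], the Jacobi identity of [L], [T], [Sb] gives [[S, Sb]] as [[L, [T, Sb]]]
    minus [[T, [L, Sb]]]; [hT], [hS], [hSb] collect the coefficients. *)
Lemma bracket_S_Sb p : Omega p ->
  bracket S Sb p = hT p *: T p + hS p *: S p + hSb p *: Sb p.
Proof.
move=> Op; rewrite (jacobi oO sL sT sSb Op).
rewrite (eq_bracket oO (fun q _ => erefl (L q)) bracket_T_Sb Op).
rewrite (bracket_comb3 _ smooth_tE' smooth_tF' smooth_tG' sT sSb sS Op).
rewrite (eq_bracket oO (fun q _ => erefl (T q)) bracket_L_Sb Op).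
rewrite (bracket_comb3 _ smooth_A smooth_B smooth_Bb sT sS sSb Op).
have -> : bracket T T p = 0 by apply/rowP => j; rewrite !mxE subrr.
rewrite bracket_T_S// bracket_T_Sb// -[bracket L T p]/(S p).
rewrite bracket_L_S// bracket_L_Sb// /hT /hS /hSb.
move: (T p) (S p) (Sb p) (Ac p) (fB p) (Bb p) (fP p) (fQ p) => t s sb A B B' P Q.
move: (tE p) (tF p) (tG p) (tE' p) (tF' p) (tG' p) => e f g e' f' g'.
move: (vapp L _ p) (vapp L _ p) (vapp L _ p) (vapp T _ p) (vapp T _ p) (vapp T _ p).
by move=> *; apply/rowP => j; rewrite !mxE; ring.
Qed.

(* The Sb-component of the Jacobi identity of L, T, S. *)
Lemma jacobi_L_T_S p : Omega p -> vapp L tG p + tG p * Bb p - fQ p * tG p = 0.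
Proof.
move=> Op; have := jacobi oO sL sT sS Op.
have -> : bracket (bracket L T) S p = 0 by apply/rowP => j; rewrite !mxE subrr.
rewrite (eq_bracket oO (fun q _ => erefl (L q)) bracket_T_S Op).
rewrite (bracket_comb3 _ smooth_tE smooth_tF smooth_tG sT sS sSb Op).
have E q : Omega q -> bracket L S q = fP q *: T q + fQ q *: S q + 0 *: T q.
  by move=> Oq; rewrite bracket_L_S// scale0r addr0.
rewrite (eq_bracket oO (fun q _ => erefl (T q)) E Op).
rewrite (bracket_comb3 (h := fun=> 0) _ smooth_P smooth_Q (smooth_cst _ 0) sT sS sT Op).
have -> : bracket T T p = 0 by apply/rowP => j; rewrite !mxE subrr.
rewrite vapp_cst !scale0r addr0 -[bracket L T p]/(S p).
rewrite bracket_T_S// bracket_L_S// bracket_L_Sb//.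
move=> J.
suff : row5 (vapp L tG p + tG p * Bb p - fQ p * tG p)
    (tE p + vapp L tF p + tF p * fQ p + tG p * fB p - vapp T fQ p - fQ p * tF p)
    (vapp L tE p + tF p * fP p + tG p * Ac p - vapp T fP p - fQ p * tE p) 0 0 = 0.
  by move/rowP/(_ 0); rewrite !mxE.
apply: (frame_inj frameU Op); rewrite row5E mul0mx; apply: etrans (esym J).
move: (T p) (S p) (Sb p) (Lb p) (L p) => t s sb lb l {J E}.
move: (vapp L _ p) (vapp L _ p) (vapp L _ p) (vapp T _ p) (vapp T _ p).
by move=> *; apply/rowP => j; rewrite !mxE; ring.
Qed.

End Commutators.

(** * Forms on the total space *)

Section Differentials.
Variables (R : realType) (n : nat).
Notation C := R[i].
Notation pt := 'rV[R]_n.+1.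
Implicit Types (f g : pt -> C) (w : form1 R n) (q : pt) (v : 'rV[C]_n.+1).

Definition is_dfun f q v : Prop := forall i, is_pder f q i (v 0 i).

Lemma is_dfun_val f q v : is_dfun f q v -> dfun f q = v.
Proof. by move=> df; apply/rowP => i; rewrite mxE; exact: is_pder_val (df i). Qed.

Lemma is_dfunM f g q v v' : is_dfun f q v -> is_dfun g q v' ->
  is_dfun (fun x => f x * g x) q (g q *: v + f q *: v').
Proof.
move=> df dg i; apply: is_pder_eq (is_pderM (df i) (dg i)) _.
by rewrite !mxE mulrC.
Qed.

Lemma is_dfun_conj f q v : is_dfun f q v -> is_dfun (fun x => (f x)^*) q (conjr v).
Proof. by move=> df i; rewrite mxE; exact: is_pder_conj. Qed.

Definition is_jac w q (D : 'M[C]_n.+1) : Prop :=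
  forall i j, is_pder (fun x => w x 0 j) q i (D i j).

(** The witness [D] certifies that all partial derivatives of the coefficients exist, which the
    value [dform w q] alone does not and which the Leibniz rule [is_dformZ] needs. *)
Definition is_dform w q (K : 'M[C]_n.+1) : Prop :=
  exists2 D, is_jac w q D & K = D - D^T.

Lemma is_dform_val w q K : is_dform w q K -> dform w q = K.
Proof.
case=> D jD ->; apply/matrixP => i j; rewrite !mxE.
by rewrite (is_pder_val (jD i j)) (is_pder_val (jD j i)).
Qed.

Lemma is_dformD w w' q K K' : is_dform w q K -> is_dform w' q K' ->
  is_dform (fun x => w x + w' x) q (K + K').
Proof.
move=> [D jD ->] [D' jD' ->]; exists (D + D').
  move=> i j; under eq_fun do rewrite mxE; rewrite mxE.
  by apply: is_pderD.
by rewrite linearD opprD addrACA.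
Qed.

Lemma is_dformZ f w q v K : is_dfun f q v -> is_dform w q K ->
  is_dform (fun x => f x *: w x) q (wedge v (w q) + f q *: K).
Proof.
move=> df [D jD ->]; exists (v^T *m w q + f q *: D).
  move=> i j; under eq_fun do rewrite mxE.
  apply: is_pder_eq (is_pderM (df i) (jD i j)) _.
  by rewrite !mxE big_ord_recl big_ord0 addr0 mxE.
by apply/matrixP => i j; rewrite !mxE !big_ord1 !mxE; ring.
Qed.

Lemma smooth_is_dform (Omega : set pt) w q : open Omega -> Omega q ->
  smooth_mx Omega w -> is_dform w q (dform w q).
Proof.
move=> oO Oq sw; exists (\matrix_(i, j) pder (fun x => w x 0 j) i q).
  by move=> i j; rewrite mxE; exact: (smooth_is_pder oO).
by apply/matrixP => i j; rewrite !mxE.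
Qed.

End Differentials.

Section TotalSpace.
Variable R : realType.
Notation C := R[i].
Notation tot := 'rV[R]_(5 + 4).

Lemma is_derive_base (g : 'rV[R]_5 -> R) (q : tot) (v : tot) d :
  is_derive (base q) (lsubmx v) g d -> is_derive q v (fun x => g (base x)) d.
Proof.
have E : (fun h : R => h^-1 *: (((fun x : tot => g (base x)) \o shift q) (h *: v)
      - g (base q))) =
    (fun h : R => h^-1 *: ((g \o shift (base q)) (h *: lsubmx v) - g (base q))).
  apply/funext => h; rewrite /base /=; congr (_ *: (g _ - _)).
  by apply/rowP => k; rewrite !mxE.
by case; rewrite /derivable /derive => dg <-; split; rewrite /derivable /derive E.
Qed.

Lemma is_dfun_base (f : 'rV[R]_5 -> C) (q : tot) v :
  is_dfun f (base q) v -> is_dfun (fun x : tot => f (base x)) q (row_mx v (0 : 'rV_4)).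
Proof.
move=> df i; case: (splitP (i : 'I_(5 + 4))) => l il.
  have -> : i = lshift 4 l by apply: val_inj.
  have [dr di] := df l.
  have -> : (row_mx v 0 : 'rV[C]_(5 + 4)) 0 (lshift 4 l) = v 0 l by rewrite row_mxEl.
  have e : lsubmx (delta_mx 0 (lshift 4 l) : tot) = delta_mx 0 l.
    by apply/rowP => k; rewrite !mxE /= (inj_eq (@lshift_inj _ _)).
  split; first by apply: (@is_derive_base (fun x => complex.Re (f x))); rewrite e.
  by apply: (@is_derive_base (fun x => complex.Im (f x))); rewrite e.
have -> : i = rshift 5 l by apply: val_inj.
have -> : (row_mx v 0 : 'rV[C]_(5 + 4)) 0 (rshift 5 l) = 0 by rewrite row_mxEr mxE.
have e : lsubmx (delta_mx 0 (rshift 5 l) : tot) = 0.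
  by apply/rowP => k; rewrite !mxE /= eq_lrshift.
split.
- by apply: (@is_derive_base (fun x => complex.Re (f x))); rewrite e; exact: is_derive0.
- by apply: (@is_derive_base (fun x => complex.Im (f x))); rewrite e; exact: is_derive0.
Qed.

(** Transposed Jacobian matrix of [base]: it pulls 1-forms back by right multiplication and 2-forms
    back by congruence. *)
Definition proj_mx59 : 'M[C]_(5, 5 + 4) := row_mx 1%:M 0.

Lemma pullbackE (w : form1 R 4) q : pullback w q = w (base q) *m proj_mx59.
Proof. by rewrite /pullback /proj_mx59 mul_mx_row mulmx1 mulmx0. Qed.

Lemma is_dform_pullback (w : form1 R 4) (q : tot) K : is_dform w (base q) K ->
  is_dform (pullback w) q (proj_mx59^T *m K *m proj_mx59).
Proof.
case=> D jD ->; exists (proj_mx59^T *m D *m proj_mx59); last first.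
  rewrite mulmxBr mulmxBl; congr (_ - _).
  by rewrite [RHS]trmx_mul [(proj_mx59^T *m D)^T]trmx_mul trmxK mulmxA.
have E : proj_mx59^T *m D *m proj_mx59 = row_mx (col_mx D 0) 0.
  rewrite /proj_mx59 tr_row_mx trmx1 trmx0 mul_col_mx mul1mx mul0mx.
  by rewrite mul_mx_row mulmx1 mulmx0.
have wE (x : tot) (l : 'I_5) : pullback w x 0 (lshift 4 l) = w (base x) 0 l.
  exact: (@row_mxEl _ 1 5 4).
have w0 (x : tot) (l : 'I_4) : pullback w x 0 (rshift 5 l) = 0.
  by apply: etrans (@row_mxEr _ 1 5 4 _ _ _ _) _; rewrite mxE.
move=> i j; rewrite E; case: (splitP (j : 'I_(5 + 4))) => l jl.
  have -> : j = lshift 4 l by apply: val_inj.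
  under eq_fun do rewrite wE.
  have dw : is_dfun (fun x => w x 0 l) (base q) (col l D)^T.
    by move=> k; rewrite !mxE; exact: jD.
  apply: is_pder_eq (is_dfun_base dw i) _.
  case: (splitP (i : 'I_(5 + 4))) => k ik.
    have -> : i = lshift 4 k by apply: val_inj.
    apply: etrans (@row_mxEl _ 1 5 4 _ _ _ _) _.
    by apply: esym; apply: etrans (@row_mxEl _ _ 5 4 _ _ _ _) _;
      apply: etrans (@col_mxEu _ 5 4 _ _ _ _ _) _; rewrite !mxE.
  have -> : i = rshift 5 k by apply: val_inj.
  apply: etrans (@row_mxEr _ 1 5 4 _ _ _ _) _.
  by apply: esym; apply: etrans (@row_mxEl _ _ 5 4 _ _ _ _) _;
    apply: etrans (@col_mxEd _ 5 4 _ _ _ _ _) _; rewrite !mxE.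
have -> : j = rshift 5 l by apply: val_inj.
under eq_fun do rewrite w0.
apply: is_pder_eq (is_pder_cst 0 q i) _.
by apply: esym; apply: etrans (@row_mxEr _ _ 5 4 _ _ _ _) _; rewrite mxE.
Qed.

Lemma is_dfun_complex (j k : 'I_9) q :
  is_dfun (fun x : tot => Complex (x 0 j) (x 0 k)) q
    (\row_i Complex (j == i)%:R (k == i)%:R).
Proof. by move=> i; rewrite mxE; split; exact: derive_coord. Qed.

Lemma is_dfun_a q : is_dfun (@par_a R) q (dfun (@par_a R) q).
Proof.
have E : @par_a R = fun x => Complex (x 0 (rshift 5 (0 : 'I_4))) (x 0 (rshift 5 (1 : 'I_4))).
  by apply/funext => x; rewrite /par_a !mxE.
by rewrite E; have d := is_dfun_complex (rshift 5 (0 : 'I_4)) (rshift 5 (1 : 'I_4)) q;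
  rewrite (is_dfun_val d).
Qed.

Lemma is_dfun_e q : is_dfun (@par_e R) q (dfun (@par_e R) q).
Proof.
have E : @par_e R = fun x => Complex (x 0 (rshift 5 (2 : 'I_4))) (x 0 (rshift 5 (3 : 'I_4))).
  by apply/funext => x; rewrite /par_e !mxE.
by rewrite E; have d := is_dfun_complex (rshift 5 (2 : 'I_4)) (rshift 5 (3 : 'I_4)) q;
  rewrite (is_dfun_val d).
Qed.

End TotalSpace.

(** * Two-forms expanded in a coframe *)

Section TwoForms.
Variables (R : realType) (n : nat).
Notation C := R[i].
Local Notation "v 'wdg' w" := (wedge v w) (at level 40, left associativity).
Implicit Types (k : 'I_5 -> 'I_5 -> C) (Om : 'M[C]_(5, n.+1)).

(** Expansion of a 2-form in the wedges of the rows of [Om]; only the entries of [k] above the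
    diagonal count. *)
Definition comb2 Om k : 'M[C]_n.+1 :=
  k 0 1 *: (row 0 Om wdg row 1 Om) + k 0 2 *: (row 0 Om wdg row 2 Om)
  + k 0 3 *: (row 0 Om wdg row 3 Om) + k 0 4 *: (row 0 Om wdg row 4 Om)
  + k 1 2 *: (row 1 Om wdg row 2 Om) + k 1 3 *: (row 1 Om wdg row 3 Om)
  + k 1 4 *: (row 1 Om wdg row 4 Om) + k 2 3 *: (row 2 Om wdg row 3 Om)
  + k 2 4 *: (row 2 Om wdg row 4 Om) + k 3 4 *: (row 3 Om wdg row 4 Om).

Lemma wedgeE (v w : 'rV[C]_n.+1) i j :
  wedge v w i j = v 0 i * w 0 j - w 0 i * v 0 j.
Proof. by rewrite !mxE !big_ord1 !mxE. Qed.

Lemma mulmx_antisym m (N : 'M[C]_(5, m)) (K : 'M[C]_5) x y :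
  (forall i j, K i j = - K j i) ->
  (N^T *m K *m N) x y =
    K 0 1 * (N 0 x * N 1 y - N 1 x * N 0 y) + K 0 2 * (N 0 x * N 2 y - N 2 x * N 0 y)
  + K 0 3 * (N 0 x * N 3 y - N 3 x * N 0 y) + K 0 4 * (N 0 x * N 4 y - N 4 x * N 0 y)
  + K 1 2 * (N 1 x * N 2 y - N 2 x * N 1 y) + K 1 3 * (N 1 x * N 3 y - N 3 x * N 1 y)
  + K 1 4 * (N 1 x * N 4 y - N 4 x * N 1 y) + K 2 3 * (N 2 x * N 3 y - N 3 x * N 2 y)
  + K 2 4 * (N 2 x * N 4 y - N 4 x * N 2 y) + K 3 4 * (N 3 x * N 4 y - N 4 x * N 3 y).
Proof.
move=> anti; have K0 i : K i i = 0.
  have /eqP := anti i i; rewrite -addr_eq0 -mulr2n -mulr_natr mulf_eq0.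
  by rewrite pnatr_eq0 orbF => /eqP.
rewrite mxE big_ord5 !mxE !big_ord5 !mxE !K0.
rewrite (anti 1 0) (anti 2 0) (anti 3 0) (anti 4 0) (anti 2 1) (anti 3 1).
rewrite (anti 4 1) (anti 3 2) (anti 4 2) (anti 4 3).
move: (K 0 1) (K 0 2) (K 0 3) (K 0 4) (K 1 2) (K 1 3) (K 1 4) (K 2 3) (K 2 4) (K 3 4).
move: (N 0 x) (N 1 x) (N 2 x) (N 3 x) (N 4 x) (N 0 y) (N 1 y) (N 2 y) (N 3 y) (N 4 y).
by move=> *; ring.
Qed.

Lemma comb2E Om (K : 'M[C]_5) : (forall i j, K i j = - K j i) ->
  Om^T *m K *m Om = comb2 Om K.
Proof.
move=> anti; apply/matrixP => x y; apply: etrans (mulmx_antisym _ _ _ anti) _.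
have entry c i j : (c *: (row i Om wdg row j Om)) x y
    = c * (Om i x * Om j y - Om j x * Om i y).
  by rewrite mxE wedgeE ![row _ Om _ _]mxE.
rewrite -!entry /comb2.
move: (_ *: _) (_ *: _) (_ *: _) (_ *: _) (_ *: _) (_ *: _) (_ *: _) (_ *: _)
  (_ *: _) (_ *: _).
by move=> *; rewrite !mxE.
Qed.

(** A right inverse of [Om] undoes the congruence by [Om] and recovers the antisymmetric coefficient
    matrix [A]. This is the source of the uniqueness of the torsion coefficients. *)
Lemma comb2_inj Om k k' : row_free Om -> comb2 Om k = comb2 Om k' ->
  forall i j : 'I_5, (i < j)%N -> k i j = k' i j.
Proof.
move=> Omf.
pose A (h : 'I_5 -> 'I_5 -> C) : 'M[C]_5 :=
  \matrix_(i, j) if (i < j)%N then h i j else if (j < i)%N then - h j i else 0.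
have anti h i j : A h i j = - A h j i.
  by rewrite !mxE; case: ltngtP; rewrite ?opprK ?oppr0.
have AE h : comb2 Om h = Om^T *m A h *m Om.
  by rewrite comb2E// /comb2 !mxE.
have [Y OmY] : exists Y, Om *m Y = 1%:M by apply/row_freeP.
rewrite !AE => E i j ij.
have : A k = A k'.
  have := congr1 (fun M => Y^T *m (M *m Y)) E.
  by rewrite -!mulmxA OmY !mulmx1 !mulmxA -trmx_mul OmY trmx1 !mul1mx.
by move/matrixP/(_ i j); rewrite !mxE ij.
Qed.

Lemma wedgeDl (u v w : 'rV[C]_n.+1) : (u + v) wdg w = u wdg w + v wdg w.
Proof. by rewrite /wedge linearD mulmxDl mulmxDr opprD addrACA. Qed.

Lemma wedgeZl (c : C) (v w : 'rV[C]_n.+1) : (c *: v) wdg w = c *: (v wdg w).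
Proof.
by apply/matrixP => i j; rewrite [RHS]mxE 2!wedgeE ![(c *: v) _ _]mxE; ring.
Qed.

Lemma wedgeC (v w : 'rV[C]_n.+1) : v wdg w = - (w wdg v).
Proof. by rewrite /wedge opprB. Qed.

Lemma wedgevv (v : 'rV[C]_n.+1) : v wdg v = 0.
Proof. by rewrite /wedge subrr. Qed.

(** Here and in [drho_expand], the [l]s modify [beta1] and the [m]s stand for their conjugates,
    which modify its conjugate; this is why they sit on the conjugated forms. In [dzeta_expand] the
    [m]s instead modify [beta2]. *)
Lemma dsigma_expand (s sb r z zb b bc : 'rV[C]_n.+1)
    (l0 l1 l2 l3 l4 m0 m1 m2 m3 m4 U1 U2 U3 U4 U5 U6 U7 : C) :
  (2 *: (b + l0 *: s + l1 *: sb + l2 *: r + l3 *: z + l4 *: zb)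
     + (bc + m0 *: sb + m1 *: s + m2 *: r + m3 *: zb + m4 *: z)) wdg s
  + U1 *: (s wdg sb) + U2 *: (s wdg r) + U3 *: (s wdg z)
  + U4 *: (s wdg zb) + U5 *: (sb wdg r) + U6 *: (sb wdg z)
  + U7 *: (sb wdg zb) + r wdg z =
  (2 *: b + bc) wdg s
  + ((U1 - (2 * l1 + m0)) *: (s wdg sb) + (U2 - (2 * l2 + m2)) *: (s wdg r)
  + (U3 - (2 * l3 + m4)) *: (s wdg z) + (U4 - (2 * l4 + m3)) *: (s wdg zb)
  + U5 *: (sb wdg r) + U6 *: (sb wdg z)
  + U7 *: (sb wdg zb) + 1 *: (r wdg z) + 0 *: (r wdg zb) + 0 *: (z wdg zb)).
Proof.
rewrite !(wedgeDl, wedgeZl) wedgevv (wedgeC sb s) (wedgeC r s) (wedgeC z s) (wedgeC zb s).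
move: (b wdg s) (bc wdg s) (s wdg sb) (s wdg r) (s wdg z) (s wdg zb) (sb wdg r)
  (sb wdg z) (sb wdg zb) (r wdg z) (r wdg zb) (z wdg zb).
by move=> *; apply/matrixP => i j; rewrite !mxE; ring.
Qed.

Lemma drho_expand (s sb r z zb b bc : 'rV[C]_n.+1)
    (l0 l1 l2 l3 l4 m0 m1 m2 m3 m4 V1 V2 V3 V4 V5 V6 V7 V8 V9 : C) :
  (b + l0 *: s + l1 *: sb + l2 *: r + l3 *: z + l4 *: zb
     + (bc + m0 *: sb + m1 *: s + m2 *: r + m3 *: zb + m4 *: z)) wdg r
  + V1 *: (s wdg sb) + V2 *: (s wdg r) + V3 *: (s wdg z)
  + V4 *: (s wdg zb) + V5 *: (sb wdg r) + V6 *: (sb wdg z)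
  + V7 *: (sb wdg zb) + V8 *: (r wdg z) + V9 *: (r wdg zb) + 'i *: (z wdg zb) =
  (b + bc) wdg r
  + (V1 *: (s wdg sb) + (V2 + (l0 + m1)) *: (s wdg r)
  + V3 *: (s wdg z) + V4 *: (s wdg zb)
  + (V5 + (l1 + m0)) *: (sb wdg r) + V6 *: (sb wdg z)
  + V7 *: (sb wdg zb) + (V8 - (l3 + m4)) *: (r wdg z)
  + (V9 - (l4 + m3)) *: (r wdg zb) + 'i *: (z wdg zb)).
Proof.
rewrite !(wedgeDl, wedgeZl) wedgevv (wedgeC z r) (wedgeC zb r).
move: (b wdg r) (bc wdg r) (s wdg sb) (s wdg r) (s wdg z) (s wdg zb) (sb wdg r)
  (sb wdg z) (sb wdg zb) (r wdg z) (r wdg zb) (z wdg zb).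
by move=> *; apply/matrixP => i j; rewrite !mxE; ring.
Qed.

Lemma dzeta_expand (s sb r z zb b b' : 'rV[C]_n.+1)
    (l0 l1 l2 l3 l4 m0 m1 m2 m3 m4 W1 W2 W3 W4 W5 W6 W7 W8 W9 W10 : C) :
  (b' + m0 *: s + m1 *: sb + m2 *: r + m3 *: z + m4 *: zb) wdg s
  + (b + l0 *: s + l1 *: sb + l2 *: r + l3 *: z + l4 *: zb) wdg z
  + W1 *: (s wdg sb) + W2 *: (s wdg r) + W3 *: (s wdg z)
  + W4 *: (s wdg zb) + W5 *: (sb wdg r) + W6 *: (sb wdg z)
  + W7 *: (sb wdg zb) + W8 *: (r wdg z) + W9 *: (r wdg zb) + W10 *: (z wdg zb) =
  b' wdg s + b wdg z
  + ((W1 - m1) *: (s wdg sb) + (W2 - m2) *: (s wdg r)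
  + (W3 - m3 + l0) *: (s wdg z) + (W4 - m4) *: (s wdg zb)
  + W5 *: (sb wdg r) + (W6 + l1) *: (sb wdg z)
  + W7 *: (sb wdg zb) + (W8 + l2) *: (r wdg z)
  + W9 *: (r wdg zb) + (W10 - l4) *: (z wdg zb)).
Proof.
rewrite !(wedgeDl, wedgeZl) !wedgevv (wedgeC sb s) (wedgeC r s) (wedgeC z s).
rewrite (wedgeC zb s) (wedgeC zb z).
move: (b' wdg s) (b wdg z) (s wdg sb) (s wdg r) (s wdg z) (s wdg zb) (sb wdg r)
  (sb wdg z) (sb wdg zb) (r wdg z) (r wdg zb) (z wdg zb).
by move=> *; apply/matrixP => i j; rewrite !mxE; ring.
Qed.

Definition lifted_rows (s sb r z zb : 'rV[C]_n.+1) : 'M[C]_(5, n.+1) :=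
  \matrix_(i < 5) nth 0 [:: s; sb; r; z; zb] i.

Lemma row_lifted_rows s sb r z zb (i : 'I_5) :
  row i (lifted_rows s sb r z zb) = nth 0 [:: s; sb; r; z; zb] i.
Proof. by rewrite rowK. Qed.

Definition coefs (c01 c02 c03 c04 c12 c13 c14 c23 c24 c34 : C) (i j : 'I_5) : C :=
  nth 0 (nth [::] [:: [:: 0; c01; c02; c03; c04]; [:: 0; 0; c12; c13; c14];
                      [:: 0; 0; 0; c23; c24]; [:: 0; 0; 0; 0; c34]] i) j.

Lemma comb2_lifted s sb r z zb k :
  comb2 (lifted_rows s sb r z zb) k =
  k 0 1 *: (s wdg sb) + k 0 2 *: (s wdg r) + k 0 3 *: (s wdg z)
  + k 0 4 *: (s wdg zb) + k 1 2 *: (sb wdg r) + k 1 3 *: (sb wdg z)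
  + k 1 4 *: (sb wdg zb) + k 2 3 *: (r wdg z) + k 2 4 *: (r wdg zb)
  + k 3 4 *: (z wdg zb).
Proof. by rewrite /comb2 !row_lifted_rows. Qed.

Section Equations.
Variables (s r z b1 b2 : 'rV[C]_n.+1) (l m : 'I_5 -> C) (k : 'I_5 -> 'I_5 -> C).
Hypothesis r_real : conjr r = r.
Let sb := conjr s.
Let zb := conjr z.
Let Om := lifted_rows s sb r z zb.
Hypothesis Omf : row_free Om.
Let b1' := b1 + l 0 *: s + l 1 *: sb + l 2 *: r + l 3 *: z + l 4 *: zb.
Let b2' := b2 + m 0 *: s + m 1 *: sb + m 2 *: r + m 3 *: z + m 4 *: zb.

Let b1b' : conjr b1' = conjr b1 + (l 0)^* *: sb + (l 1)^* *: s + (l 2)^* *: r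
  + (l 3)^* *: zb + (l 4)^* *: z.
Proof. by rewrite /b1' !conjrD !conjrZ r_real /sb /zb !conjrK. Qed.

Lemma comb2_eq h h' :
  comb2 Om h = comb2 Om h' <->
  [/\ h 0 1 = h' 0 1, h 0 2 = h' 0 2, h 0 3 = h' 0 3, h 0 4 = h' 0 4
    & [/\ h 1 2 = h' 1 2, h 1 3 = h' 1 3, h 1 4 = h' 1 4 &
       [/\ h 2 3 = h' 2 3, h 2 4 = h' 2 4 & h 3 4 = h' 3 4]]].
Proof.
split=> [E|[]]; first by do !split; apply: (comb2_inj Omf E).
by rewrite /comb2 => -> -> -> -> [-> -> ->] [-> -> ->].
Qed.

(** The left side is [d sigma] with the original [beta1], the right side a structure equation with
    the modified one. Comparing coefficients splits it into ten scalar equations, in which the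
    modification appears as a translation. *)
Lemma dsigma_eq (U1 U2 U3 U4 U5 U6 U7 : C) :
  (2 *: b1 + conjr b1) wdg s + comb2 Om k =
  (2 *: b1' + conjr b1') wdg s
    + U1 *: (s wdg sb) + U2 *: (s wdg r) + U3 *: (s wdg z)
    + U4 *: (s wdg zb) + U5 *: (sb wdg r) + U6 *: (sb wdg z)
    + U7 *: (sb wdg zb) + r wdg z <->
  [/\ k 0 1 = U1 - (2 * l 1 + (l 0)^*), k 0 2 = U2 - (2 * l 2 + (l 2)^*),
      k 0 3 = U3 - (2 * l 3 + (l 4)^*), k 0 4 = U4 - (2 * l 4 + (l 3)^*)
    & [/\ k 1 2 = U5, k 1 3 = U6, k 1 4 = U7 &
       [/\ k 2 3 = 1, k 2 4 = 0 & k 3 4 = 0]]].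
Proof.
pose h := coefs (U1 - (2 * l 1 + (l 0)^*)) (U2 - (2 * l 2 + (l 2)^*))
  (U3 - (2 * l 3 + (l 4)^*)) (U4 - (2 * l 4 + (l 3)^*)) U5 U6 U7 1 0 0.
rewrite -[X in _ <-> X](comb2_eq k h).
rewrite b1b' /b1' ?/b2' dsigma_expand.
rewrite -[X in _ = _ + X <-> _](comb2_lifted s sb r z zb h).
by split=> [/addrI|->].
Qed.

Lemma drho_eq (V1 V2 V3 V4 V2b V4b V3b V8 V8b : C) :
  (b1 + conjr b1) wdg r + comb2 Om k =
  (b1' + conjr b1') wdg r
    + V1 *: (s wdg sb) + V2 *: (s wdg r) + V3 *: (s wdg z)
    + V4 *: (s wdg zb) + V2b *: (sb wdg r) + V4b *: (sb wdg z)
    + V3b *: (sb wdg zb) + V8 *: (r wdg z) + V8b *: (r wdg zb)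
    + 'i *: (z wdg zb) <->
  [/\ k 0 1 = V1, k 0 2 = V2 + (l 0 + (l 1)^*), k 0 3 = V3, k 0 4 = V4
    & [/\ k 1 2 = V2b + (l 1 + (l 0)^*), k 1 3 = V4b, k 1 4 = V3b &
       [/\ k 2 3 = V8 - (l 3 + (l 4)^*), k 2 4 = V8b - (l 4 + (l 3)^*)
         & k 3 4 = 'i]]].
Proof.
pose h := coefs V1 (V2 + (l 0 + (l 1)^*)) V3 V4 (V2b + (l 1 + (l 0)^*)) V4b V3b
  (V8 - (l 3 + (l 4)^*)) (V8b - (l 4 + (l 3)^*)) 'i.
rewrite -[X in _ <-> X](comb2_eq k h).
rewrite b1b' /b1' ?/b2' drho_expand.
rewrite -[X in _ = _ + X <-> _](comb2_lifted s sb r z zb h).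
by split=> [/addrI|->].
Qed.

Lemma dzeta_eq (W1 W2 W3 W4 W5 W6 W7 W8 W9 W10 : C) :
  b2 wdg s + b1 wdg z + comb2 Om k =
  b2' wdg s + b1' wdg z
    + W1 *: (s wdg sb) + W2 *: (s wdg r) + W3 *: (s wdg z)
    + W4 *: (s wdg zb) + W5 *: (sb wdg r) + W6 *: (sb wdg z)
    + W7 *: (sb wdg zb) + W8 *: (r wdg z) + W9 *: (r wdg zb)
    + W10 *: (z wdg zb) <->
  [/\ k 0 1 = W1 - m 1, k 0 2 = W2 - m 2, k 0 3 = W3 - m 3 + l 0, k 0 4 = W4 - m 4
    & [/\ k 1 2 = W5, k 1 3 = W6 + l 1, k 1 4 = W7 &
       [/\ k 2 3 = W8 + l 2, k 2 4 = W9 & k 3 4 = W10 - l 4]]].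
Proof.
pose h := coefs (W1 - m 1) (W2 - m 2) (W3 - m 3 + l 0) (W4 - m 4) W5 (W6 + l 1)
  W7 (W8 + l 2) W9 (W10 - l 4).
rewrite -[X in _ <-> X](comb2_eq k h).
rewrite /b1' ?/b2' dzeta_expand.
rewrite -[X in _ = _ + X <-> _](comb2_lifted s sb r z zb h).
by split=> [/addrI|->].
Qed.

End Equations.
End TwoForms.

(** * The lifted coframe and its behaviour under conjugation *)

Section RealCoframe.
Variables (R : realType) (Omega : set 'rV[R]_5) (Lb : vfield R 4).
Notation C := R[i].
Hypothesis oO : open Omega.
Hypothesis sLb : smooth_mx Omega Lb.
Hypothesis frameU : maximally_minimal Lb Omega.

Definition conj_index (i : 'I_5) : 'I_5 := nth 0 [:: 1; 0; 2; 4; 3] i.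

Lemma conjr_frame_field p a : Omega p ->
  conjr (frame_field Lb a p) = frame_field Lb (conj_index a) p.
Proof.
move=> Op; elim/forall_ord5 : a.
- exact: (conjr_Sb oO sLb Op).
- exact: (conjr_S oO sLb Op).
- exact: (conjr_T oO sLb Op).
- by [].
- exact: conjrK.
Qed.

Lemma coframe_frame p : Omega p -> coframe Lb p *m (frame Lb p)^T = 1%:M.
Proof. by move=> Op; rewrite /coframe -trmx_mul mulmxV ?frameU// trmx1. Qed.

(** A form is determined by its values on the frame, and conjugation permutes the frame fields by
    [conj_index]. *)
Lemma conjr_coframe p (v : 'rV[C]_5) : Omega p ->
  conjr (v *m coframe Lb p) = (\row_j (v 0 (conj_index j))^*) *m coframe Lb p.
Proof.
move=> Op; have cc := coframe_frame Op.
apply: (can_inj (mulmxK (_ : (frame Lb p)^T \in unitmx))).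
  by rewrite unitmx_tr; exact: frameU.
rewrite -mulmxA cc mulmx1; apply/rowP => j.
have E : (conjr (v *m coframe Lb p) *m (frame Lb p)^T) 0 j =
    (((v *m coframe Lb p) *m (frame Lb p)^T) 0 (conj_index j))^*.
  rewrite [LHS]mxE [in RHS]mxE rmorph_sum; apply: eq_bigr => i _ /=.
  rewrite rmorphM mxE; congr (_ * _).
  have := congr1 (fun w : 'rV_5 => w 0 i) (conjr_frame_field (conj_index j) Op).
  have -> : conj_index (conj_index j) = j by elim/forall_ord5 : j.
  by rewrite -!row_frame !mxE => <-.
by rewrite E -mulmxA cc mulmx1 mxE.
Qed.

Definition lifted_coframe (q : 'rV[R]_(5 + 4)) : 'M[C]_(5, 5 + 4) :=
  coframe Lb (base q) *m proj_mx59 R.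

Lemma conjr_lifted_coframe q x0 x1 x2 x3 x4 : Omega (base q) ->
  @conjr R 8 (row5 x0 x1 x2 x3 x4 *m lifted_coframe q) =
  row5 x1^* x0^* x2^* x4^* x3^* *m lifted_coframe q.
Proof.
move=> Op; rewrite /lifted_coframe !mulmxA.
have -> (w : 'rV[C]_5) : @conjr R 8 (w *m proj_mx59 R) = conjr w *m proj_mx59 R.
  rewrite /conjr map_mxM; congr (_ *m _).
  apply: etrans (@map_row_mx _ _ _ 5 5 4 _ _) _.
  by rewrite map_mx1 map_mx0.
rewrite (conjr_coframe _ Op).
apply: (congr1 (mulmx^~ _)).
apply: (congr1 (mulmx^~ _)).
by apply/rowP; elim/forall_ord5; rewrite !mxE.
Qed.

Lemma lifted_coframe_right_inverse q : Omega (base q) ->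
  lifted_coframe q *m ((proj_mx59 R)^T *m (frame Lb (base q))^T) = 1%:M.
Proof.
move=> Op; rewrite /lifted_coframe mulmxA -(mulmxA (coframe _ _)).
have -> : proj_mx59 R *m (proj_mx59 R)^T = 1%:M.
  by rewrite /proj_mx59 tr_row_mx mul_row_col trmx1 mulmx1 mul0mx addr0.
by rewrite mulmx1 coframe_frame.
Qed.

Lemma row5_lifted (x0 x1 x2 x3 x4 : C) q : row5 x0 x1 x2 x3 x4 *m lifted_coframe q =
  x0 *: pullback (sigma0b Lb) q + x1 *: pullback (sigma0 Lb) q
  + x2 *: pullback (rho0 Lb) q + x3 *: pullback (zeta0b Lb) q
  + x4 *: pullback (zeta0 Lb) q.
Proof.
by rewrite mulmx_sum_row big_ord5 !pullbackE /lifted_coframe !row_mul !mxE.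
Qed.

Lemma pullback_coform f q :
  pullback (coform Lb f) q = f (base q) *m lifted_coframe q.
Proof. by rewrite pullbackE /coform /lifted_coframe mulmxA. Qed.

(* Coefficients of d(f . coframe) in the coframe. *)
Definition dcoefs (f : 'rV[R]_5 -> 'rV[C]_5) p : 'M[C]_5 := \matrix_(a, b)
  (vapp (frame_field Lb a) (fun q => f q 0 b) p
   - vapp (frame_field Lb b) (fun q => f q 0 a) p
   - \sum_i coform Lb f p 0 i * bracket (frame_field Lb a) (frame_field Lb b) p 0 i).

Lemma dcoefs_antisym f p i j : dcoefs f p i j = - dcoefs f p j i.
Proof.
have SE : \sum_k coform Lb f p 0 k * bracket (frame_field Lb i) (frame_field Lb j) p 0 k
    = - \sum_k coform Lb f p 0 k * bracket (frame_field Lb j) (frame_field Lb i) p 0 k.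
  rewrite -sumrN; apply: eq_bigr => k _.
  by rewrite bracketC [X in _ * X]mxE mulrN.
rewrite [LHS]mxE [in RHS]mxE SE.
move: (vapp _ _ p) (vapp _ _ p) (\sum_k _) => u v w.
by rewrite opprK !opprB addrC.
Qed.

Lemma is_dform_coform f q : smooth_mx Omega f -> Omega (base q) ->
  is_dform (pullback (coform Lb f)) q
    ((lifted_coframe q)^T *m dcoefs f (base q) *m lifted_coframe q).
Proof.
move=> sf Op.
have sw := smooth_coform oO sLb frameU sf.
have := is_dform_pullback (smooth_is_dform oO Op sw).
rewrite (dform_coform oO sLb frameU sf (K := dcoefs f (base q)) Op); last first.
  by move=> a b; rewrite mxE.
by rewrite /lifted_coframe trmx_mul !mulmxA.
Qed.

End RealCoframe.

Section LiftedMatrices.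
Variable C : fieldType.

Definition matrix55 (rows : seq (seq C)) : 'M[C]_5 :=
  \matrix_(i, j) nth 0 (nth [::] rows i) j.

(* Rows: sigma, its conjugate, rho, zeta, its conjugate; columns: the coframe dual
   to Sb, S, T, Lb, L. *)
Definition lift_mx (a ab e eb B Bb zd d0 b0 b0b : C) : 'M[C]_5 := matrix55
  [:: [:: 0; a ^+ 2 * ab; 0; 0; 0];
      [:: a * ab ^+ 2; 0; 0; 0; 0];
      [:: a * ab * B; a * ab * Bb; a * ab; 0; 0];
      [:: a * zd; e; a * b0; 0; a];
      [:: eb; ab * d0; ab * b0b; ab; 0]].

(** The inverse of [lift_mx]: its rows express [sigma0b], [sigma0], [rho0], [zeta0b], [zeta0] in the
    lifted forms. *)
Definition unlift_mx (a ab e eb B Bb zd d0 b0 b0b : C) : 'M[C]_5 := matrix55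
  [:: [:: 0; (a * ab ^+ 2)^-1; 0; 0; 0];
      [:: (a ^+ 2 * ab)^-1; 0; 0; 0; 0];
      [:: - Bb / (a ^+ 2 * ab); - B / (a * ab ^+ 2); (a * ab)^-1; 0; 0];
      [:: (- d0 + b0b * Bb) / (a ^+ 2 * ab); (- (eb / ab) + b0b * B) / (a * ab ^+ 2);
          - b0b / (a * ab); 0; ab^-1];
      [:: (- (e / a) + b0 * Bb) / (a ^+ 2 * ab); (- zd + b0 * B) / (a * ab ^+ 2);
          - b0 / (a * ab); a^-1; 0]].

Lemma unlift_lift (a ab e eb B Bb zd d0 b0 b0b : C) : a != 0 -> ab != 0 ->
  unlift_mx a ab e eb B Bb zd d0 b0 b0b *m lift_mx a ab e eb B Bb zd d0 b0 b0b
    = 1%:M.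
Proof.
move=> a0 ab0; apply/matrixP => i j; rewrite mxE big_ord5.
by elim/forall_ord5 : i; elim/forall_ord5 : j; rewrite !mxE /=; field;
  rewrite ?a0 ?ab0.
Qed.

Lemma antisymZ (c : C) n (M : 'M[C]_n) : (forall i j, M i j = - M j i) ->
  forall i j, (c *: M) i j = - (c *: M) j i.
Proof. by move=> anti i j; rewrite !mxE anti mulrN. Qed.

Lemma scale_sandwich k m n l (c : C) (A : 'M[C]_(k, m)) (M : 'M[C]_(m, n)) (B : 'M[C]_(n, l)) :
  c *: (A *m M *m B) = A *m (c *: M) *m B.
Proof. by rewrite -scalemxAr -scalemxAl. Qed.

Lemma add_sandwich k m n l (A : 'M[C]_(k, m)) (M N : 'M[C]_(m, n)) (B : 'M[C]_(n, l)) :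
  A *m M *m B + A *m N *m B = A *m (M + N) *m B.
Proof. by rewrite mulmxDr mulmxDl. Qed.

Lemma antisymD n (M N : 'M[C]_n) : (forall i j, M i j = - M j i) ->
  (forall i j, N i j = - N j i) -> forall i j, (M + N) i j = - (M + N) j i.
Proof. by move=> aM aN i j; rewrite !mxE aM aN opprD. Qed.

End LiftedMatrices.

Section WedgeRight.
Variables (R : realType) (n : nat).

Lemma wedgeZr (c : R[i]) (v w : 'rV[R[i]]_n.+1) : wedge v (c *: w) = c *: wedge v w.
Proof. by rewrite wedgeC wedgeZl -scalerN -wedgeC. Qed.

Lemma wedgeDr (u v w : 'rV[R[i]]_n.+1) : wedge u (v + w) = wedge u v + wedge u w.
Proof. by rewrite wedgeC wedgeDl opprD -!wedgeC. Qed.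

End WedgeRight.

Section ScaledWedges.
Variables (R : realType) (n : nat) (x y e : R[i]) (u v w w' : 'rV[R[i]]_n.+1).
Hypotheses (x0 : x != 0) (y0 : y != 0).

(** With [u = da] and [v] its conjugate, the left factor is the differential of [a^2] times conj
    [a]; dividing by that function leaves [2 beta1] plus conj [beta1]. *)
Lemma wedge_dsigma : wedge (y *: (x *: u + x *: u) + (x * x) *: v) w =
  wedge (2 *: (x^-1 *: u) + y^-1 *: v) ((x ^+ 2 * y) *: w).
Proof.
rewrite wedgeZr !(wedgeDl, wedgeZl); move: (wedge u w) (wedge v w) => M M'.
by apply/matrixP => i j; rewrite !mxE; field; rewrite ?x0 ?y0.
Qed.

Lemma wedge_drho : wedge (y *: u + x *: v) w =
  wedge (x^-1 *: u + y^-1 *: v) ((x * y) *: w).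
Proof.
rewrite wedgeZr !(wedgeDl, wedgeZl); move: (wedge u w) (wedge v w) => M M'.
by apply/matrixP => i j; rewrite !mxE; field; rewrite ?x0 ?y0.
Qed.

(** With [u = da] and [v = de]: the term in [da] of [beta2] cancels the wedge of [(e / a) da] with
    [w'] that arises from [beta1] and the [e]-part of [zeta]. *)
Lemma wedge_dzeta : wedge u w + wedge v w' =
  wedge ((x ^+ 2 * y)^-1 *: v - (e / (x ^+ 3 * y)) *: u) ((x ^+ 2 * y) *: w')
  + wedge (x^-1 *: u) (x *: w + e *: w').
Proof.
rewrite -scaleNr wedgeDr !wedgeZr !(wedgeDl, wedgeZl).
move: (wedge u w) (wedge v w') (wedge u w') => M M' M''.
by apply/matrixP => i j; rewrite !mxE; field; rewrite ?x0 ?y0.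
Qed.

End ScaledWedges.

(** * Exterior derivatives of the lifted coframe *)

Section StructureEquations.
Variables (R : realType) (Omega : set 'rV[R]_5) (Lb : vfield R 4).
Variables (fP fQ fR fB : 'rV[R]_5 -> R[i]) (fA : 'rV[R]_5 -> R).
Notation C := R[i].
Notation L := (fieldL Lb).
Notation tot := 'rV[R]_(5 + 4).
Hypothesis oO : open Omega.
Hypothesis sLb : smooth_mx Omega Lb.
Hypothesis frameU : maximally_minimal Lb Omega.
Hypothesis str : structure_functions Lb Omega fP fQ fR fB fA.

Notation valb := (value_b fQ fB).
Notation valc := (value_c fB).
Notation vald := (value_d Lb fP fQ fB).

(** [d0] and [b0] are the parts of [d] and [b] living on the base: [d] is conj [a] times [d0], and
    [b] is [a] times [b0]. As conj [d] is then [a] times [zd], the form [zeta] splits as [a] times a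
    base form plus [e] times another. *)
Definition d0 p : C := - 'i * vapp L (fun x => (fB x)^*) p + 'i * fP p
  + 2 * 'i / 3 * (fB p)^* * fQ p.
Definition zd p : C := (d0 p)^*.
Definition b0 p : C := - 'i * fB p + 'i / 3 * (fQ p)^*.

Definition fsigma (p : 'rV[R]_5) : 'rV[C]_5 := row5 0 1 0 0 0.
Definition frho (p : 'rV[R]_5) : 'rV[C]_5 := row5 (fB p) (fB p)^* 1 0 0.
Definition fzeta (p : 'rV[R]_5) : 'rV[C]_5 := row5 (zd p) 0 (b0 p) 0 1.

Lemma smooth_row5 (x0 x1 x2 x3 x4 : 'rV[R]_5 -> C) :
  smooth Omega x0 -> smooth Omega x1 -> smooth Omega x2 -> smooth Omega x3 ->
  smooth Omega x4 -> smooth_mx Omega (fun p => row5 (x0 p) (x1 p) (x2 p) (x3 p) (x4 p)).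
Proof.
move=> s0 s1 s2 s3 s4 i j.
by elim/forall_ord5 : j; [move: s0|move: s1|move: s2|move: s3|move: s4];
  apply: smooth_ext => p _; rewrite mxE.
Qed.

Let sB := smooth_B oO sLb frameU str.
Let sQ := smooth_Q oO sLb frameU str.
Let sP := smooth_P oO sLb frameU str.

Lemma smooth_d0 : smooth Omega d0.
Proof.
apply: smoothD; first apply: smoothD.
- by apply: smoothM; [exact: smooth_cst | exact: smooth_vapp (smooth_fieldL sLb) (smooth_conj sB)].
- by apply: smoothM; [exact: smooth_cst | exact: sP].
- apply: smoothM sQ; apply: smoothM (smooth_conj sB); exact: smooth_cst.
Qed.

Lemma smooth_b0 : smooth Omega b0.
Proof.
apply: smoothD; first by apply: smoothM sB; exact: smooth_cst.
by apply: smoothM (smooth_conj sQ); exact: smooth_cst.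
Qed.

Lemma smooth_fsigma : smooth_mx Omega fsigma.
Proof. by apply: smooth_row5; exact: smooth_cst. Qed.

Lemma smooth_frho : smooth_mx Omega frho.
Proof.
apply: smooth_row5; try exact: smooth_cst; first exact: sB.
exact: smooth_conj sB.
Qed.

Lemma smooth_fzeta : smooth_mx Omega fzeta.
Proof.
apply: smooth_row5; try exact: smooth_cst; last exact: smooth_b0.
exact: smooth_conj smooth_d0.
Qed.

Lemma sigma_coform : sigma Lb =
  fun q => (par_a q ^+ 2 * (par_a q)^*) *: pullback (coform Lb fsigma) q.
Proof.
apply/funext => q; rewrite pullback_coform row5_lifted !scale0r add0r !addr0.
by rewrite scale1r.
Qed.

Lemma rho_coform : rho Lb valc =
  fun q => (par_a q * (par_a q)^*) *: pullback (coform Lb frho) q.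
Proof.
apply/funext => q; rewrite pullback_coform row5_lifted !scale0r !addr0 scale1r.
rewrite !scalerDr !scalerA /rho /value_c !conjM !conjCK.
by rewrite (mulrC (par_a q)^*).
Qed.

Lemma zeta_coform : zeta Lb valb vald =
  fun q => par_a q *: pullback (coform Lb fzeta) q
           + par_e q *: pullback (coform Lb fsigma) q.
Proof.
apply/funext => q; rewrite !pullback_coform !row5_lifted !scale0r !add0r !addr0.
rewrite !scale1r /zeta.
have -> : (vald q)^* = par_a q * zd (base q) by rewrite /value_d conjM conjCK.
have -> : valb q = par_a q * b0 (base q) by [].
move: (pullback _ q) (pullback _ q) (pullback _ q) (pullback _ q) => u v w t.
by apply/rowP => i; rewrite !mxE; ring.
Qed.

Section AtPoint.
Variable q : tot.
Hypothesis Dq : lifted_domain Omega q.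
Let p := base q.
Let a := par_a q.
Let ab := (par_a q)^*.
Let e := par_e q.
Let eb := (par_e q)^*.
Let Op : Omega p := Dq.1.
Let a0 : a != 0 := Dq.2.

Let ab0 : ab != 0.
Proof. by rewrite conjC_eq0. Qed.

Notation Th := (lifted_coframe Lb q).
Let s := sigma Lb q.
Let r := rho Lb valc q.
Let z := zeta Lb valb vald q.

Definition unlift_at : 'M[C]_5 :=
  unlift_mx a ab e eb (fB p) (fB p)^* (zd p) (d0 p) (b0 p) (b0 p)^*.

Definition lift_at : 'M[C]_5 :=
  lift_mx a ab e eb (fB p) (fB p)^* (zd p) (d0 p) (b0 p) (b0 p)^*.

Lemma sigmaE : s = row5 0 (a ^+ 2 * ab) 0 0 0 *m Th.
Proof.
rewrite /s sigma_coform pullback_coform scalemxAl; congr (_ *m _).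
by apply/rowP; elim/forall_ord5; rewrite !mxE /= ?mulr0 ?mulr1.
Qed.

Lemma rhoE : r = row5 (a * ab * fB p) (a * ab * (fB p)^*) (a * ab) 0 0 *m Th.
Proof.
rewrite /r rho_coform pullback_coform scalemxAl; congr (_ *m _).
by apply/rowP; elim/forall_ord5; rewrite !mxE /= ?mulr0 ?mulr1.
Qed.

Lemma zetaE : z = row5 (a * zd p) e (a * b0 p) 0 a *m Th.
Proof.
rewrite /z zeta_coform !pullback_coform !scalemxAl -mulmxDl; congr (_ *m _).
by apply/rowP; elim/forall_ord5; rewrite !mxE /= ?mulr0 ?mulr1 ?addr0 ?add0r.
Qed.

Lemma conjr_rho : conjr r = r.
Proof.
rewrite rhoE; apply: etrans (conjr_lifted_coframe oO sLb frameU _ _ _ _ _ Op) _.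
  congr (_ *m _).
rewrite /ab !conjM !conjCK conjC0.
by rewrite (mulrC (par_a q)^*).
Qed.

Notation Om := (lifted_rows s (conjr s) r z (conjr z)).

Lemma lifted_rowsE : Om = lift_at *m Th.
Proof.
apply/row_matrixP => i; rewrite row_lifted_rows row_mul.
elim/forall_ord5 : i => /=.
- rewrite sigmaE; congr (_ *m _).
  by apply/rowP; elim/forall_ord5; rewrite !mxE.
- rewrite sigmaE; apply: etrans (conjr_lifted_coframe oO sLb frameU _ _ _ _ _ Op) _.
  congr (_ *m _).
  apply/rowP; elim/forall_ord5; rewrite !mxE //= ?conjC0//.
  by rewrite conjM conjX conjCK mulrC.
- rewrite rhoE; congr (_ *m _).
  by apply/rowP; elim/forall_ord5; rewrite !mxE.
- rewrite zetaE; congr (_ *m _).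
  by apply/rowP; elim/forall_ord5; rewrite !mxE.
- rewrite zetaE; apply: etrans (conjr_lifted_coframe oO sLb frameU _ _ _ _ _ Op) _.
  congr (_ *m _).
  apply/rowP; elim/forall_ord5; rewrite !mxE //= ?conjC0//.
  + by rewrite /zd conjM conjCK.
  + by rewrite conjM.
Qed.

Lemma unlift_atK : unlift_at *m Om = Th.
Proof. by rewrite lifted_rowsE mulmxA unlift_lift// mul1mx. Qed.

Lemma row_free_lifted : row_free Om.
Proof.
have NG : unlift_at *m lift_at = 1%:M by exact: unlift_lift.
have TX := lifted_coframe_right_inverse frameU Op.
apply/row_freeP; exists ((proj_mx59 R)^T *m (frame Lb p)^T *m unlift_at).
have E := etrans (mulmxA _ _ _)
  (etrans (congr1 (mulmx^~ unlift_at) TX) (mul1mx unlift_at)).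
rewrite lifted_rowsE; apply: etrans (esym (mulmxA _ _ _)) _.
exact: etrans (congr1 (mulmx lift_at) E) (mulmx1C NG).
Qed.

(** Coefficients of the same 2-form in the lifted coframe: a change of coframe acts by
    congruence. *)
Definition kcoefs (f : 'rV[R]_5 -> 'rV[C]_5) : 'M[C]_5 :=
  unlift_at^T *m dcoefs Lb f p *m unlift_at.

Lemma kcoefs_antisym f i j : kcoefs f i j = - kcoefs f j i.
Proof.
have E : (kcoefs f)^T = - kcoefs f.
  rewrite /kcoefs !trmx_mul trmxK mulmxA -mulNmx -mulmxN; congr (_ *m _ *m _).
  by apply/matrixP => k l; rewrite mxE dcoefs_antisym !mxE.
by have /matrixP/(_ i j) := E; rewrite !mxE => ->; rewrite opprK.
Qed.

Lemma dform_pull f : Th^T *m dcoefs Lb f p *m Th = Om^T *m kcoefs f *m Om.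
Proof. by rewrite -{1 2}unlift_atK trmx_mul !mulmxA. Qed.

Definition ksigma : 'M[C]_5 := (a ^+ 2 * ab) *: kcoefs fsigma.
Definition krho : 'M[C]_5 := (a * ab) *: kcoefs frho.
Definition kzeta : 'M[C]_5 := a *: kcoefs fzeta + e *: kcoefs fsigma.

Let beta1q := @beta1 R q.
Let beta2q := @beta2 R q.

(** By the Leibniz rule the differential of the group factor gives exactly the [beta] terms, and the
    base form contributes [ksigma], the torsion of one particular solution. *)
Lemma dform_sigma :
  dform (sigma Lb) q = wedge (2 *: beta1q + conjr beta1q) s + comb2 Om ksigma.
Proof.
have da := is_dfun_a q; have dab := is_dfun_conj da.
have daa := is_dfunM (is_dfunM da da) dab.
have dS := is_dformZ daa (is_dform_coform oO sLb frameU smooth_fsigma Dq.1).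
rewrite [in LHS]sigma_coform (is_dform_val dS) dform_pull.
rewrite -(comb2E _ (K := ksigma)); last first.
  by apply: antisymZ; exact: kcoefs_antisym.
rewrite scale_sandwich; apply: (congr2 +%R _ erefl).
rewrite /s sigma_coform /beta1q /beta1 conjrZ conjV.
exact: wedge_dsigma.
Qed.

Lemma dform_rho :
  dform (rho Lb valc) q = wedge (beta1q + conjr beta1q) r + comb2 Om krho.
Proof.
have da := is_dfun_a q; have dab := is_dfun_conj da.
have daa := is_dfunM da dab.
have dS := is_dformZ daa (is_dform_coform oO sLb frameU smooth_frho Dq.1).
rewrite [in LHS]rho_coform (is_dform_val dS) dform_pull.
rewrite -(comb2E _ (K := krho)); last first.
  by apply: antisymZ; exact: kcoefs_antisym.
rewrite scale_sandwich; apply: (congr2 +%R _ erefl).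
rewrite /r rho_coform /beta1q /beta1 conjrZ conjV.
exact: wedge_drho.
Qed.

Lemma dform_zeta : dform (zeta Lb valb vald) q =
  wedge beta2q s + wedge beta1q z + comb2 Om kzeta.
Proof.
have da := is_dfun_a q; have de := is_dfun_e q.
have dS := is_dformD
  (is_dformZ da (is_dform_coform oO sLb frameU smooth_fzeta Dq.1))
  (is_dformZ de (is_dform_coform oO sLb frameU smooth_fsigma Dq.1)).
rewrite [in LHS]zeta_coform (is_dform_val dS).
rewrite (dform_pull fzeta) (dform_pull fsigma).
rewrite -(comb2E _ (K := kzeta)); last first.
  by apply: antisymD; apply: antisymZ; exact: kcoefs_antisym.
apply: etrans (addrACA _ _ _ _) _; apply: (congr2 +%R); last first.
  apply: etrans (congr2 +%R (scale_sandwich _ _ _ _) (scale_sandwich _ _ _ _)) _.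
  exact: add_sandwich.
rewrite /s /z sigma_coform zeta_coform /beta1q /beta1 /beta2q /beta2.
exact: wedge_dzeta.
Qed.

End AtPoint.
End StructureEquations.

(** * Structure equations in coefficients *)

(** The congruence written entry by entry for a sparse matrix. The numerators in its first two
    columns are named [x], [y] in the row of [zeta0] and [xb], [yb] in the row of [zeta0b]; of these
    only [x] and [yb] contain [e] or its conjugate. *)
Lemma unlift_coefs (R : realType) (a ab e eb B Bb zd d0 b0 b0b x y xb yb : R[i])
    (K U M : 'M[R[i]]_5) :
  a != 0 -> ab != 0 -> (forall i j, K i j = - K j i) ->
  U = unlift_mx a ab e eb B Bb zd d0 b0 b0b -> M = U^T *m K *m U ->
  x = - (e / a) + b0 * Bb -> y = - zd + b0 * B ->
  xb = - d0 + b0b * Bb -> yb = - (eb / ab) + b0b * B ->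
  [/\ M 0 1 = (a ^+ 3 * ab ^+ 3)^-1 * (- K 0 1 + Bb * K 0 2 - xb * K 0 3 - x * K 0 4
        - B * K 1 2 + yb * K 1 3 + y * K 1 4 + (xb * B - Bb * yb) * K 2 3
        + (x * B - Bb * y) * K 2 4 + (xb * y - x * yb) * K 3 4),
      M 0 2 = (a ^+ 3 * ab ^+ 2)^-1 * (K 1 2 - b0b * K 1 3 - b0 * K 1 4
        + (Bb * b0b - xb) * K 2 3 + (Bb * b0 - x) * K 2 4
        + (x * b0b - xb * b0) * K 3 4),
      M 0 3 = (a ^+ 3 * ab)^-1 * (K 1 4 - Bb * K 2 4 + xb * K 3 4),
      M 0 4 = (a ^+ 2 * ab ^+ 2)^-1 * (K 1 3 - Bb * K 2 3 - x * K 3 4)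
    & [/\ M 1 2 = (a ^+ 2 * ab ^+ 3)^-1 * (K 0 2 - b0b * K 0 3 - b0 * K 0 4
            + (B * b0b - yb) * K 2 3 + (B * b0 - y) * K 2 4
            + (y * b0b - yb * b0) * K 3 4),
          M 1 3 = (a ^+ 2 * ab ^+ 2)^-1 * (K 0 4 - B * K 2 4 + yb * K 3 4),
          M 1 4 = (a * ab ^+ 3)^-1 * (K 0 3 - B * K 2 3 - y * K 3 4) &
      [/\ M 2 3 = (a ^+ 2 * ab)^-1 * (K 2 4 - b0b * K 3 4),
          M 2 4 = (a * ab ^+ 2)^-1 * (K 2 3 + b0 * K 3 4)
        & M 3 4 = (a * ab)^-1 * - K 3 4]]].
Proof.
move=> a0 ab0 anti UE ME' xE yE xbE ybE.
have U0 : [/\ U 0 0 = 0, U 0 1 = (a * ab ^+ 2)^-1, U 0 2 = 0, U 0 3 = 0 & U 0 4 = 0]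
  by rewrite UE ?xE ?yE ?xbE ?ybE !mxE.
have U1 : [/\ U 1 0 = (a ^+ 2 * ab)^-1, U 1 1 = 0, U 1 2 = 0, U 1 3 = 0 & U 1 4 = 0]
  by rewrite UE ?xE ?yE ?xbE ?ybE !mxE.
have U2 : [/\ U 2 0 = - Bb / (a ^+ 2 * ab), U 2 1 = - B / (a * ab ^+ 2),
   U 2 2 = (a * ab)^-1, U 2 3 = 0 & U 2 4 = 0] by rewrite UE ?xE ?yE ?xbE ?ybE !mxE.
have U3 : [/\ U 3 0 = xb / (a ^+ 2 * ab), U 3 1 = yb / (a * ab ^+ 2),
   U 3 2 = - b0b / (a * ab), U 3 3 = 0 & U 3 4 = ab^-1] by rewrite UE ?xE ?yE ?xbE ?ybE !mxE.
have U4 : [/\ U 4 0 = x / (a ^+ 2 * ab), U 4 1 = y / (a * ab ^+ 2),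
   U 4 2 = - b0 / (a * ab), U 4 3 = a^-1 & U 4 4 = 0] by rewrite UE ?xE ?yE ?xbE ?ybE !mxE.
have ME i j : M i j = _ := etrans (congr1 (fun N => fun_of_matrix N i j) ME')
  (mulmx_antisym U i j anti).
clear UE ME' xE yE xbE ybE.
move: U0 U1 U2 U3 U4 => [U00 U01 U02 U03 U04] [U10 U11 U12 U13 U14]
  [U20 U21 U22 U23 U24] [U30 U31 U32 U33 U34] [U40 U41 U42 U43 U44].
split; [| | | |split; [| | |split]];
  rewrite ME ?(U00, U01, U02, U03, U04, U10, U11, U12, U13, U14)
    ?(U20, U21, U22, U23, U24, U30, U31, U32, U33, U34, U40, U41, U42, U43, U44);
  move: (K 0 1) (K 0 2) (K 0 3) (K 0 4) (K 1 2) (K 1 3) (K 1 4) (K 2 3) (K 2 4) (K 3 4);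
  move=> *; field; rewrite ?a0 ?ab0 //.
Qed.

Section CoframeDerivatives.
Variables (R : realType) (Omega : set 'rV[R]_5) (Lb : vfield R 4).
Variables (fP fQ fR fB : 'rV[R]_5 -> R[i]) (fA : 'rV[R]_5 -> R).
Notation C := R[i].
Notation L := (fieldL Lb).
Notation T := (fieldT Lb).
Notation S := (fieldS Lb).
Notation Sb := (fieldSb Lb).
Hypothesis oO : open Omega.
Hypothesis sLb : smooth_mx Omega Lb.
Hypothesis frameU : maximally_minimal Lb Omega.
Hypothesis str : structure_functions Lb Omega fP fQ fR fB fA.
Hypothesis R0 : forall p, Omega p -> fR p = 0.

Variable p : 'rV[R]_5.
Hypothesis Op : Omega p.

Lemma coform_comb f (v : 'rV[C]_5) :
  \sum_i coform Lb f p 0 i * (v *m frame Lb p) 0 i = \sum_k f p 0 k * v 0 k.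
Proof.
transitivity ((coform Lb f p *m (v *m frame Lb p)^T) 0 0).
  by rewrite [RHS]mxE; apply: eq_bigr => i _; rewrite [X in _ = _ * X]mxE.
rewrite trmx_mul mulmxA /coform -(mulmxA (f p)) (coframe_frame frameU Op) mulmx1.
by rewrite mxE; apply: eq_bigr => i _; rewrite [X in _ * X = _]mxE.
Qed.

Lemma dcoefsE (f : 'rV[R]_5 -> 'rV[C]_5) (fa fb : 'rV[R]_5 -> C) a b (v0 v1 v2 v3 v4 : C) :
  (forall q, f q 0 a = fa q) -> (forall q, f q 0 b = fb q) ->
  bracket (frame_field Lb a) (frame_field Lb b) p =
    v0 *: Sb p + v1 *: S p + v2 *: T p + v3 *: Lb p + v4 *: L p ->
  dcoefs Lb f p a b = vapp (frame_field Lb a) fb p - vapp (frame_field Lb b) fa p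
    - (f p 0 0 * v0 + f p 0 1 * v1 + f p 0 2 * v2 + f p 0 3 * v3 + f p 0 4 * v4).
Proof.
move=> /funext Ea /funext Eb E; rewrite mxE E -row5E coform_comb big_ord5 Ea Eb.
by rewrite !mxE.
Qed.

Notation tE_ := (tE Lb fP fQ fB fA p). Notation tF_ := (tF Lb fQ fB fA p).
Notation tG_ := (tG Lb fP fQ fB p). Notation tE'_ := (tE' Lb fP fQ fB fA p).
Notation tF'_ := (tF' Lb fQ fB fA p). Notation tG'_ := (tG' Lb fP fQ fB p).
Notation hT_ := (hT Lb fP fQ fB fA p). Notation hS_ := (hS Lb fP fQ fB fA p).
Notation hSb_ := (hSb Lb fP fQ fB fA p).
Notation B := (fB p). Notation Bb_ := ((fB p)^*).
Notation P := (fP p). Notation Pb_ := ((fP p)^*).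
Notation Q := (fQ p). Notation Qb_ := ((fQ p)^*).
Notation A := (Ac fA p).

(** The frame is ordered [Sb, S, T, Lb, L], opposite to the order in which the brackets were
    computed, hence the minus signs. Zero coefficients are written out to fit the five-term shape of
    [dcoefsE]. *)
Lemma bracket_table :
  [/\ bracket Sb S p = - hSb_ *: Sb p + - hS_ *: S p + - hT_ *: T p + 0 *: Lb p + 0 *: L p,
      bracket Sb T p = - tF'_ *: Sb p + - tG'_ *: S p + - tE'_ *: T p + 0 *: Lb p + 0 *: L p,
      bracket Sb Lb p = - Qb_ *: Sb p + - 0 *: S p + - Pb_ *: T p + 0 *: Lb p + 0 *: L p,
      bracket Sb L p = - Bb_ *: Sb p + - B *: S p + - A *: T p + 0 *: Lb p + 0 *: L p
    & [/\ bracket S T p = - tG_ *: Sb p + - tF_ *: S p + - tE_ *: T p + 0 *: Lb p + 0 *: L p,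
          bracket S Lb p = - Bb_ *: Sb p + - B *: S p + - A *: T p + 0 *: Lb p + 0 *: L p,
          bracket S L p = - 0 *: Sb p + - Q *: S p + - P *: T p + 0 *: Lb p + 0 *: L p &
      [/\ bracket T Lb p = - 1 *: Sb p + - 0 *: S p + - 0 *: T p + 0 *: Lb p + 0 *: L p,
          bracket T L p = - 0 *: Sb p + - 1 *: S p + - 0 *: T p + 0 *: Lb p + 0 *: L p
        & bracket Lb L p = - 0 *: Sb p + - 0 *: S p + - - 'i *: T p + 0 *: Lb p + 0 *: L p]]].
Proof.
have e1 := bracket_S_Sb oO sLb frameU str R0 Op.
have e2 := bracket_T_Sb oO sLb frameU str R0 Op.
have e3 := bracket_Lb_Sb oO sLb str R0 Op.
have e4 := bracket_L_Sb str Op.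
have e5 := bracket_T_S oO sLb frameU str R0 Op.
have e6 := bracket_Lb_S str Op.
have e7 := bracket_L_S str R0 Op.
have e8 : bracket Lb T p = Sb p := erefl.
have e9 : bracket L T p = S p := erefl.
have e10 := bracket_L_Lb Lb p.
have lin (x0 x1 x2 : C) (v sb s t lb l : 'rV[C]_5) :
   v = x2 *: t + x1 *: s + x0 *: sb ->
   - v = - x0 *: sb + - x1 *: s + - x2 *: t + 0 *: lb + 0 *: l.
  by move=> ->; rewrite !scale0r !addr0 !scaleNr !opprD addr_rev3.
have linTS (x1 x2 : C) (v sb s t lb l : 'rV[C]_5) : v = x2 *: t + x1 *: s ->
   - v = - 0 *: sb + - x1 *: s + - x2 *: t + 0 *: lb + 0 *: l.
  by move=> ->; apply: lin; rewrite scale0r addr0.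
have linTSb (x0 x2 : C) (v sb s t lb l : 'rV[C]_5) : v = x2 *: t + x0 *: sb ->
   - v = - x0 *: sb + - 0 *: s + - x2 *: t + 0 *: lb + 0 *: l.
  by move=> ->; apply: lin; rewrite scale0r addr0.
have linSb (v sb s t lb l : 'rV[C]_5) : v = sb ->
   - v = - 1 *: sb + - 0 *: s + - 0 *: t + 0 *: lb + 0 *: l.
  by move=> ->; apply: lin; rewrite !scale0r !add0r scale1r.
have linS (v sb s t lb l : 'rV[C]_5) : v = s ->
   - v = - 0 *: sb + - 1 *: s + - 0 *: t + 0 *: lb + 0 *: l.
  by move=> ->; apply: lin; rewrite !scale0r add0r addr0 scale1r.
have linT (x2 : C) (v sb s t lb l : 'rV[C]_5) : v = x2 *: t ->
   - v = - 0 *: sb + - 0 *: s + - x2 *: t + 0 *: lb + 0 *: l.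
  by move=> ->; apply: lin; rewrite !scale0r !addr0.
split; [| | | |split; [| | |split]]; rewrite bracketC.
- exact: lin e1.
- exact: lin (etrans e2 (addrAC _ _ _)).
- exact: linTSb e3.
- exact: lin e4.
- exact: lin e5.
- exact: lin e6.
- exact: linTS e7.
- exact: linSb e8.
- exact: linS e9.
- exact: linT e10.
Qed.

End CoframeDerivatives.

Section CoframeCoefficients.
Variables (R : realType) (Omega : set 'rV[R]_5) (Lb : vfield R 4).
Variables (fP fQ fR fB : 'rV[R]_5 -> R[i]) (fA : 'rV[R]_5 -> R).
Notation C := R[i].
Notation L := (fieldL Lb).
Notation T := (fieldT Lb).
Notation S := (fieldS Lb).
Notation Sb := (fieldSb Lb).
Hypothesis oO : open Omega.
Hypothesis sLb : smooth_mx Omega Lb.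
Hypothesis frameU : maximally_minimal Lb Omega.
Hypothesis str : structure_functions Lb Omega fP fQ fR fB fA.
Hypothesis R0 : forall p, Omega p -> fR p = 0.

Variable p : 'rV[R]_5.
Hypothesis Op : Omega p.

Notation tE_ := (tE Lb fP fQ fB fA p). Notation tF_ := (tF Lb fQ fB fA p).
Notation tG_ := (tG Lb fP fQ fB p). Notation tE'_ := (tE' Lb fP fQ fB fA p).
Notation tF'_ := (tF' Lb fQ fB fA p). Notation tG'_ := (tG' Lb fP fQ fB p).
Notation hT_ := (hT Lb fP fQ fB fA p). Notation hS_ := (hS Lb fP fQ fB fA p).
Notation hSb_ := (hSb Lb fP fQ fB fA p).
Notation B := (fB p). Notation Bb_ := ((fB p)^*).
Notation P := (fP p). Notation Pb_ := ((fP p)^*).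
Notation Q := (fQ p). Notation Qb_ := ((fQ p)^*).
Notation A := (Ac fA p).
Notation zd_ := (zd Lb fP fQ fB). Notation b0_ := (b0 fQ fB).

Lemma row5_coord (x0 x1 x2 x3 x4 : C) :
  [/\ row5 x0 x1 x2 x3 x4 0 0 = x0, row5 x0 x1 x2 x3 x4 0 1 = x1,
      row5 x0 x1 x2 x3 x4 0 2 = x2, row5 x0 x1 x2 x3 x4 0 3 = x3
    & row5 x0 x1 x2 x3 x4 0 4 = x4].
Proof. by rewrite !mxE. Qed.

(** Cartan's formula with [bracket_table] inserted; the signs of the table turn the subtracted
    bracket terms into sums, except for [[Lb, L]], which is ['i] times [T]. *)
Lemma dcoefs_row5 (x0 x1 x2 x3 x4 : 'rV[R]_5 -> C)
    (K := dcoefs Lb (fun q => row5 (x0 q) (x1 q) (x2 q) (x3 q) (x4 q)) p) :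
  [/\ K 0 1 = vapp Sb x1 p - vapp S x0 p + (x0 p * hSb_ + x1 p * hS_ + x2 p * hT_),
      K 0 2 = vapp Sb x2 p - vapp T x0 p + (x0 p * tF'_ + x1 p * tG'_ + x2 p * tE'_),
      K 0 3 = vapp Sb x3 p - vapp Lb x0 p + (x0 p * Qb_ + x2 p * Pb_),
      K 0 4 = vapp Sb x4 p - vapp L x0 p + (x0 p * Bb_ + x1 p * B + x2 p * A)
    & [/\ K 1 2 = vapp S x2 p - vapp T x1 p + (x0 p * tG_ + x1 p * tF_ + x2 p * tE_),
          K 1 3 = vapp S x3 p - vapp Lb x1 p + (x0 p * Bb_ + x1 p * B + x2 p * A),
          K 1 4 = vapp S x4 p - vapp L x1 p + (x1 p * Q + x2 p * P) &
      [/\ K 2 3 = vapp T x3 p - vapp Lb x2 p + x0 p,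
          K 2 4 = vapp T x4 p - vapp L x2 p + x1 p
        & K 3 4 = vapp Lb x4 p - vapp L x3 p - x2 p * 'i]]].
Proof.
pose f q := row5 (x0 q) (x1 q) (x2 q) (x3 q) (x4 q).
have [br01 br02 br03 br04 [br12 br13 br14 [br23 br24 br34]]] :=
  bracket_table oO sLb frameU str R0 Op.
have fE q : [/\ f q 0 0 = x0 q, f q 0 1 = x1 q, f q 0 2 = x2 q, f q 0 3 = x3 q
  & f q 0 4 = x4 q] by exact: row5_coord.
have [f0 f1 f2 f3 f4] := fE p.
have g0 q : f q 0 0 = x0 q by case: (fE q).
have g1 q : f q 0 1 = x1 q by case: (fE q).
have g2 q : f q 0 2 = x2 q by case: (fE q).
have g3 q : f q 0 3 = x3 q by case: (fE q).
have g4 q : f q 0 4 = x4 q by case: (fE q).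
have fin (u v y y' : C) : y = y' -> u - v - y = u - v - y' by move=> ->.
split; [| | | |split; [| | |split]].
- apply: etrans (dcoefsE frameU Op g0 g1 br01) _; rewrite f0 f1 f2.
  by move: (vapp _ _ p) (vapp _ _ p) => *; ring.
- apply: etrans (dcoefsE frameU Op g0 g2 br02) _; rewrite f0 f1 f2.
  by move: (vapp _ _ p) (vapp _ _ p) => *; ring.
- apply: etrans (dcoefsE frameU Op g0 g3 br03) _; rewrite f0 f1 f2.
  by move: (vapp _ _ p) (vapp _ _ p) => *; ring.
- apply: etrans (dcoefsE frameU Op g0 g4 br04) _; rewrite f0 f1 f2.
  by move: (vapp _ _ p) (vapp _ _ p) => *; ring.
- apply: etrans (dcoefsE frameU Op g1 g2 br12) _; rewrite f0 f1 f2.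
  by move: (vapp _ _ p) (vapp _ _ p) => *; ring.
- apply: etrans (dcoefsE frameU Op g1 g3 br13) _; rewrite f0 f1 f2.
  by move: (vapp _ _ p) (vapp _ _ p) => *; ring.
- apply: etrans (dcoefsE frameU Op g1 g4 br14) _; rewrite f0 f1 f2.
  by move: (vapp _ _ p) (vapp _ _ p) => *; ring.
- apply: etrans (dcoefsE frameU Op g2 g3 br23) _; rewrite f0 f1 f2.
  by move: (vapp _ _ p) (vapp _ _ p) => *; ring.
- apply: etrans (dcoefsE frameU Op g2 g4 br24) _; rewrite f0 f1 f2.
  by move: (vapp _ _ p) (vapp _ _ p) => *; ring.
- apply: etrans (dcoefsE frameU Op g3 g4 br34) _; rewrite f0 f1 f2.
  by move: (vapp _ _ p) (vapp _ _ p) => *; ring.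
Qed.

Lemma dcoefs_fsigma (K : 'M[C]_5) : K = dcoefs Lb (@fsigma R) p ->
  [/\ K 0 1 = hS_, K 0 2 = tG'_, K 0 3 = 0, K 0 4 = B
    & [/\ K 1 2 = tF_, K 1 3 = B, K 1 4 = Q &
      [/\ K 2 3 = 0, K 2 4 = 1 & K 3 4 = 0]]].
Proof.
move=> ->.
have [k01 k02 k03 k04 [k12 k13 k14 [k23 k24 k34]]] :=
  dcoefs_row5 (fun=> 0) (fun=> 1) (fun=> 0) (fun=> 0) (fun=> 0).
rewrite !vapp_cst !mul0r !mul1r !subrr !add0r !addr0 in k01 k02 k03 k04 k12 k13 k14 k23 k24 k34.
by do !split.
Qed.

Lemma dcoefs_frho (K : 'M[C]_5) : K = dcoefs Lb (frho fB) p ->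
  [/\ K 0 1 = vapp Sb (Bb fB) p - vapp S fB p + (B * hSb_ + Bb_ * hS_ + hT_),
      K 0 2 = - vapp T fB p + (B * tF'_ + Bb_ * tG'_ + tE'_),
      K 0 3 = - vapp Lb fB p + (B * Qb_ + Pb_),
      K 0 4 = - vapp L fB p + (B * Bb_ + Bb_ * B + A)
    & [/\ K 1 2 = - vapp T (Bb fB) p + (B * tG_ + Bb_ * tF_ + tE_),
          K 1 3 = - vapp Lb (Bb fB) p + (B * Bb_ + Bb_ * B + A),
          K 1 4 = - vapp L (Bb fB) p + (Bb_ * Q + P) &
      [/\ K 2 3 = B, K 2 4 = Bb_ & K 3 4 = - 'i]]].
Proof.
move=> ->.
have [k01 k02 k03 k04 [k12 k13 k14 [k23 k24 k34]]] :=
  dcoefs_row5 fB (Bb fB) (fun=> 1) (fun=> 0) (fun=> 0).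
have sub (u v : C) : u = 0 -> u - v = - v by move=> ->; rewrite sub0r.
split; [| | | |split; [| | |split]].
- by apply: etrans k01 _; rewrite mul1r.
- by apply: etrans k02 _; rewrite mul1r (sub _ _ (vapp_cst _ _ _)).
- by apply: etrans k03 _; rewrite mul1r (sub _ _ (vapp_cst _ _ _)).
- by apply: etrans k04 _; rewrite mul1r (sub _ _ (vapp_cst _ _ _)).
- by apply: etrans k12 _; rewrite mul1r (sub _ _ (vapp_cst _ _ _)).
- by apply: etrans k13 _; rewrite mul1r (sub _ _ (vapp_cst _ _ _)).
- by apply: etrans k14 _; rewrite mul1r (sub _ _ (vapp_cst _ _ _)).
- by apply: etrans k23 _; rewrite !vapp_cst subrr add0r.
- by apply: etrans k24 _; rewrite !vapp_cst subrr add0r.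
- by apply: etrans k34 _; rewrite !vapp_cst subrr add0r mul1r.
Qed.

Lemma dcoefs_fzeta (K : 'M[C]_5) : K = dcoefs Lb (fzeta Lb fP fQ fB) p ->
  [/\ K 0 1 = - vapp S zd_ p + (zd_ p * hSb_ + b0_ p * hT_),
      K 0 2 = vapp Sb b0_ p - vapp T zd_ p + (zd_ p * tF'_ + b0_ p * tE'_),
      K 0 3 = - vapp Lb zd_ p + (zd_ p * Qb_ + b0_ p * Pb_),
      K 0 4 = - vapp L zd_ p + (zd_ p * Bb_ + b0_ p * A)
    & [/\ K 1 2 = vapp S b0_ p + (zd_ p * tG_ + b0_ p * tE_),
          K 1 3 = zd_ p * Bb_ + b0_ p * A, K 1 4 = b0_ p * P &
      [/\ K 2 3 = - vapp Lb b0_ p + zd_ p, K 2 4 = - vapp L b0_ p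
        & K 3 4 = - (b0_ p * 'i)]]].
Proof.
move=> ->.
have [k01 k02 k03 k04 [k12 k13 k14 [k23 k24 k34]]] :=
  dcoefs_row5 zd_ (fun=> 0) b0_ (fun=> 0) (fun=> 1).
have sub (u v : C) : u = 0 -> u - v = - v by move=> ->; rewrite sub0r.
have sub' (u v : C) : v = 0 -> u - v = u by move=> ->; rewrite subr0.
have mid (u v w : C) : u + 0 * v + w = u + w by rewrite mul0r addr0.
split; [| | | |split; [| | |split]].
- by apply: etrans k01 _; rewrite mid (sub _ _ (vapp_cst _ _ _)).
- by apply: etrans k02 _; rewrite mid.
- by apply: etrans k03 _; rewrite (sub _ _ (vapp_cst _ _ _)).
- by apply: etrans k04 _; rewrite mid (sub _ _ (vapp_cst _ _ _)).
- by apply: etrans k12 _; rewrite mid (sub' _ _ (vapp_cst _ _ _)).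
- by apply: etrans k13 _; rewrite mid !vapp_cst subrr add0r.
- by apply: etrans k14 _; rewrite !vapp_cst subrr mul0r !add0r.
- by apply: etrans k23 _; rewrite (sub _ _ (vapp_cst _ _ _)).
- by apply: etrans k24 _; rewrite addr0 (sub _ _ (vapp_cst _ _ _)).
- by apply: etrans k34 _; rewrite !vapp_cst subrr add0r.
Qed.

End CoframeCoefficients.

Section ConjugateEntries.
Variables (R : realType) (a b B x y xb yb d02 d03 d04 d12 d13 d14 : R[i]).
Hypotheses (a0 : a != 0) (xbJ : xb^* = y) (xJ : x^* = yb).
Hypotheses (d12J : d12^* = d02) (d13J : d13^* = d04) (d14J : d14^* = d03).

(** The identities of this section are stated over abstract scalars so that [field] handles them
    without meeting derivatives; the hypotheses record how conjugation permutes the entries. *)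
Lemma conj_entry02 : (a * a^* ^+ 2)^-1 * (d02 - b^* * d03 - b * d04
    + (B * b^* - yb) * B + (B * b - y) * B^* - (y * b^* - yb * b) * 'i) =
  ((a ^+ 2 * a^*)^-1 * (d12 - b^* * d13 - b * d14
    + (B^* * b^* - xb) * B + (B^* * b - x) * B^* - (x * b^* - xb * b) * 'i))^*.
Proof.
rewrite !(conjM, conjV, conjD, conjN, conjX, conj_i, conjCK) xbJ xJ d12J d13J d14J.
by field; rewrite conjC_eq0 a0.
Qed.

Lemma conj_entry04 : (a * a^*)^-1 * (d04 - B * B^* - yb * 'i) =
  ((a * a^*)^-1 * (d13 - B^* * B + x * 'i))^*.
Proof.
rewrite !(conjM, conjV, conjD, conjN, conj_i, conjCK) xJ d13J.
by field; rewrite conjC_eq0 a0.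
Qed.

Lemma conj_entry03 : a^* ^- 2 * (d03 - B * B + y * 'i) =
  (a ^- 2 * (d14 - B^* * B^* - xb * 'i))^*.
Proof.
rewrite !(conjM, conjV, conjD, conjN, conjX, conj_i, conjCK) xbJ d14J.
by field; rewrite conjC_eq0 a0.
Qed.

Lemma conj_entry23 : a^*^-1 * (B - b * 'i) = (a^-1 * (B^* + b^* * 'i))^*.
Proof. by rewrite !(conjM, conjV, conjD, conj_i, conjCK) mulrN. Qed.

End ConjugateEntries.

Opaque fsigma frho fzeta dcoefs kcoefs.

Section TorsionEntries.
Variables (R : realType) (Omega : set 'rV[R]_5) (Lb : vfield R 4).
Variables (fP fQ fR fB : 'rV[R]_5 -> R[i]) (fA : 'rV[R]_5 -> R).
Notation C := R[i].
Notation T := (fieldT Lb).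
Hypothesis oO : open Omega.
Hypothesis sLb : smooth_mx Omega Lb.
Hypothesis frameU : maximally_minimal Lb Omega.
Hypothesis str : structure_functions Lb Omega fP fQ fR fB fA.
Hypothesis R0 : forall p, Omega p -> fR p = 0.

Variable q : 'rV[R]_(5 + 4).
Hypothesis Dq : lifted_domain Omega q.
Let p := base q.
Let a := par_a q.
Let ab := (par_a q)^*.
Let e := par_e q.
Let eb := (par_e q)^*.
Let Op : Omega p := Dq.1.
Let a0 : a != 0 := Dq.2.
Let ab0 : ab != 0. Proof. by rewrite conjC_eq0. Qed.

Notation tF_ := (tF Lb fQ fB fA p).
Notation tE'_ := (tE' Lb fP fQ fB fA p).
Notation tF'_ := (tF' Lb fQ fB fA p). Notation tG'_ := (tG' Lb fP fQ fB p).
Notation hS_ := (hS Lb fP fQ fB fA p).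
Notation B := (fB p). Notation Bb_ := ((fB p)^*).
Notation Q := (fQ p). Notation Qb_ := ((fQ p)^*).
Notation zd_ := (zd Lb fP fQ fB p). Notation b_ := (b0 fQ fB p).
Notation d_ := (d0 Lb fP fQ fB p). Notation bb_ := ((b0 fQ fB p)^*).
Notation ks := (ksigma Lb fP fQ fB q).
Notation kr := (krho Lb fP fQ fB q).
Notation kz := (kzeta Lb fP fQ fB q).

Definition unlift_x : C := - (e / a) + b_ * Bb_.
Definition unlift_y : C := - zd_ + b_ * B.
Definition unlift_xb : C := - d_ + bb_ * Bb_.
Definition unlift_yb : C := - (eb / ab) + bb_ * B.

Let uc f := unlift_coefs (U := unlift_at Lb fP fQ fB q) (M := kcoefs Lb fP fQ fB q f)
  (x := unlift_x) (y := unlift_y) (xb := unlift_xb) (yb := unlift_yb)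
  a0 ab0 (dcoefs_antisym Lb f p) erefl erefl erefl erefl erefl erefl.
Let Ks := dcoefs_fsigma oO sLb frameU str R0 Op (erefl (dcoefs Lb (@fsigma R) p)).
Let Kr := dcoefs_frho oO sLb frameU str R0 Op (erefl (dcoefs Lb (frho fB) p)).
Let Kz := dcoefs_fzeta oO sLb frameU str R0 Op
  (erefl (dcoefs Lb (fzeta Lb fP fQ fB) p)).

Let ksE i j (v w : C) : kcoefs Lb fP fQ fB q (@fsigma R) i j = v ->
  (a ^+ 2 * ab) * v = w -> ks i j = w.
Proof. by move=> <- <-; rewrite mxE. Qed.

Let krE i j (v w : C) : kcoefs Lb fP fQ fB q (frho fB) i j = v ->
  (a * ab) * v = w -> kr i j = w.
Proof. by move=> <- <-; rewrite mxE. Qed.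

Let kzE i j (v v' w : C) : kcoefs Lb fP fQ fB q (fzeta Lb fP fQ fB) i j = v ->
  kcoefs Lb fP fQ fB q (@fsigma R) i j = v' ->
  a * v + e * v' = w -> kz i j = w.
Proof. by move=> <- <- <-; rewrite mxE [X in X + _]mxE [X in _ + X]mxE. Qed.

Lemma ksigma_entries :
  [/\ ks 0 1 = (a * ab ^+ 2)^-1 * (- hS_ + Bb_ * tG'_ - unlift_x * B - B * tF_ + unlift_yb * B
        + unlift_y * Q + (unlift_x * B - Bb_ * unlift_y)),
      ks 0 2 = (a * ab)^-1 * (tF_ - bb_ * B - b_ * Q + (Bb_ * b_ - unlift_x)),
      ks 0 3 = a^-1 * (Q - Bb_),
      ks 0 4 = ab^-1 * B
    & [/\ ks 1 2 = ab ^- 2 * (tG'_ - b_ * B + (B * b_ - unlift_y)),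
          ks 1 3 = 0, ks 1 4 = 0 &
      [/\ ks 2 3 = 1, ks 2 4 = 0 & ks 3 4 = 0]]].
Proof.
have [m01 m02 m03 m04 [m12 m13 m14 [m23 m24 m34]]] := uc (@fsigma R).
have [k01 k02 k03 k04 [k12 k13 k14 [k23 k24 k34]]] := Ks.
split; [| | | |split; [| | |split]].
- apply: ksE m01 _; rewrite k01 k02 k03 k04 k12 k13 k14 k23 k24 k34.
  by field; rewrite ?a0 ?ab0.
- apply: ksE m02 _; rewrite k12 k13 k14 k23 k24 k34.
  by field; rewrite ?a0 ?ab0.
- by apply: ksE m03 _; rewrite k14 k24 k34; field; rewrite ?a0 ?ab0.
- by apply: ksE m04 _; rewrite k13 k23 k34; field; rewrite ?a0 ?ab0.
- apply: ksE m12 _; rewrite k02 k03 k04 k23 k24 k34.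
  by field; rewrite ?a0 ?ab0.
- by apply: ksE m13 _; rewrite k04 k24 k34; field; rewrite ?a0 ?ab0.
- by apply: ksE m14 _; rewrite k03 k23 k34; field; rewrite ?a0 ?ab0.
- by apply: ksE m23 _; rewrite k24 k34; field; rewrite ?a0 ?ab0.
- by apply: ksE m24 _; rewrite k23 k34; field; rewrite ?a0 ?ab0.
- by apply: ksE m34 _; rewrite k34; field; rewrite ?a0 ?ab0.
Qed.

Notation dr := (dcoefs Lb (frho fB) p).
Notation dz := (dcoefs Lb (fzeta Lb fP fQ fB) p).

Lemma krho_entries :
  [/\ kr 0 1 = (a ^+ 2 * ab ^+ 2)^-1 * (- dr 0 1 + Bb_ * dr 0 2 - unlift_xb * dr 0 3
        - unlift_x * dr 0 4 - B * dr 1 2 + unlift_yb * dr 1 3 + unlift_y * dr 1 4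
        + (unlift_xb * B - Bb_ * unlift_yb) * B + (unlift_x * B - Bb_ * unlift_y) * Bb_
        - (unlift_xb * unlift_y - unlift_x * unlift_yb) * 'i),
      kr 0 2 = (a ^+ 2 * ab)^-1 * (dr 1 2 - bb_ * dr 1 3 - b_ * dr 1 4
        + (Bb_ * bb_ - unlift_xb) * B + (Bb_ * b_ - unlift_x) * Bb_
        - (unlift_x * bb_ - unlift_xb * b_) * 'i),
      kr 0 3 = a ^- 2 * (dr 1 4 - Bb_ * Bb_ - unlift_xb * 'i),
      kr 0 4 = (a * ab)^-1 * (dr 1 3 - Bb_ * B + unlift_x * 'i)
    & [/\ kr 1 2 = (a * ab ^+ 2)^-1 * (dr 0 2 - bb_ * dr 0 3 - b_ * dr 0 4
            + (B * bb_ - unlift_yb) * B + (B * b_ - unlift_y) * Bb_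
            - (unlift_y * bb_ - unlift_yb * b_) * 'i),
          kr 1 3 = (a * ab)^-1 * (dr 0 4 - B * Bb_ - unlift_yb * 'i),
          kr 1 4 = ab ^- 2 * (dr 0 3 - B * B + unlift_y * 'i) &
      [/\ kr 2 3 = a^-1 * (Bb_ + bb_ * 'i), kr 2 4 = ab^-1 * (B - b_ * 'i)
        & kr 3 4 = 'i]]].
Proof.
have [m01 m02 m03 m04 [m12 m13 m14 [m23 m24 m34]]] := uc (frho fB).
have [_ _ _ _ [_ _ _ [k23 k24 k34]]] := Kr.
split; [| | | |split; [| | |split]].
- apply: krE m01 _; rewrite k23 k24 k34.
  move: (dr 0 1) (dr 0 2) (dr 0 3) (dr 0 4) (dr 1 2) (dr 1 3) (dr 1 4) => *.
  by field; rewrite ?a0 ?ab0.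
- apply: krE m02 _; rewrite k23 k24 k34.
  by move: (dr 1 2) (dr 1 3) (dr 1 4) => *; field; rewrite ?a0 ?ab0.
- apply: krE m03 _; rewrite k24 k34.
  by move: (dr 1 4) => *; field; rewrite ?a0 ?ab0.
- apply: krE m04 _; rewrite k23 k34.
  by move: (dr 1 3) => *; field; rewrite ?a0 ?ab0.
- apply: krE m12 _; rewrite k23 k24 k34.
  by move: (dr 0 2) (dr 0 3) (dr 0 4) => *; field; rewrite ?a0 ?ab0.
- apply: krE m13 _; rewrite k24 k34.
  by move: (dr 0 4) => *; field; rewrite ?a0 ?ab0.
- apply: krE m14 _; rewrite k23 k34.
  by move: (dr 0 3) => *; field; rewrite ?a0 ?ab0.
- by apply: krE m23 _; rewrite k24 k34; field; rewrite ?a0 ?ab0.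
- by apply: krE m24 _; rewrite k23 k34; field; rewrite ?a0 ?ab0.
- by apply: krE m34 _; rewrite k34; field; rewrite ?a0 ?ab0.
Qed.

Lemma kzeta_entries :
  [/\ kz 1 2 = (a * ab ^+ 3)^-1 * (dz 0 2 - bb_ * dz 0 3 - b_ * dz 0 4
        + (B * bb_ - unlift_yb) * dz 2 3 + (B * b_ - unlift_y) * dz 2 4
        - (unlift_y * bb_ - unlift_yb * b_) * (b_ * 'i) + e / a * (tG'_ - unlift_y)),
      kz 1 3 = (a * ab ^+ 2)^-1 * (dz 0 4 - B * dz 2 4 - unlift_yb * (b_ * 'i)),
      kz 1 4 = ab ^- 3 * (dz 0 3 - B * dz 2 3 + unlift_y * (b_ * 'i))
    & [/\ kz 2 3 = (a * ab)^-1 * (dz 2 4 + bb_ * (b_ * 'i) + e / a),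
          kz 2 4 = ab ^- 2 * (dz 2 3 - b_ * (b_ * 'i))
        & kz 3 4 = ab^-1 * (b_ * 'i)]].
Proof.
move: (uc (fzeta Lb fP fQ fB)) (uc (@fsigma R)) Kz Ks.
move: dz (dcoefs Lb (@fsigma R) p) => Mz Ms.
move=> [_ _ _ _ [m12 m13 m14 [m23 m24 m34]]].
move=> [_ _ _ _ [s12 s13 s14 [s23 s24 s34]]].
move=> [_ _ _ _ [_ _ _ [_ _ k34]]].
move=> [_ l02 l03 l04 [l12 l13 l14 [l23 l24 l34]]].
split; [| | |split].
- apply: kzE m12 s12 _.
  rewrite k34.
  rewrite l02 l03 l04.
  rewrite l23 l24 l34.
  move: (Mz 0 2) (Mz 0 3) (Mz 0 4) (Mz 2 3) (Mz 2 4) => *.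
  by field; rewrite ?a0 ?ab0.
- apply: kzE m13 s13 _; rewrite k34 l04 l24 l34.
  by move: (Mz 0 4) (Mz 2 4) => *; field; rewrite ?a0 ?ab0.
- apply: kzE m14 s14 _; rewrite k34 l03 l23 l34.
  by move: (Mz 0 3) (Mz 2 3) => *; field; rewrite ?a0 ?ab0.
- apply: kzE m23 s23 _; rewrite k34 l24 l34.
  by move: (Mz 2 4) => *; field; rewrite ?a0 ?ab0.
- apply: kzE m24 s24 _; rewrite k34 l23 l34.
  by move: (Mz 2 3) => *; field; rewrite ?a0 ?ab0.
- by apply: kzE m34 s34 _; rewrite k34 l34; field; rewrite ?a0 ?ab0.
Qed.

Let sB := smooth_B oO sLb frameU str.

Lemma conj_dr : [/\ (dr 1 2)^* = dr 0 2, (dr 1 3)^* = dr 0 4 & (dr 1 4)^* = dr 0 3].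
Proof.
have [_ -> -> -> [-> -> -> _]] := Kr.
have cB : (vapp T (Bb fB) p)^* = vapp T fB p.
  by rewrite -[LHS]conjCK (vapp_T_conj oO sLb sB Op) !conjCK.
have J (u x1 y1 x2 y2 w : C) : (- u + (x1 * y1 + x2 * y2 + w))^* =
    - u^* + (x1^* * y1^* + x2^* * y2^* + w^*) by rewrite !(conjD, conjN, conjM).
have J' (u x1 y1 w : C) : (- u + (x1 * y1 + w))^* = - u^* + (x1^* * y1^* + w^*).
  by rewrite !(conjD, conjN, conjM).
have cG := conj_tG oO sLb frameU str Op; have cF := conj_tF oO sLb frameU str Op.
have cE := conj_tE oO sLb frameU str Op.
split.
- apply: etrans (J _ _ _ _ _ _) _; rewrite cB cG cF cE conjCK.
  by move: (vapp _ _ _) tG'_ tF'_ tE'_ => *; ring.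
- apply: etrans (J _ _ _ _ _ _) _.
  rewrite -(vapp_L_conj Lb oO (smooth_conj sB) Op) conj_Bb conj_Ac conjCK.
  by move: (vapp _ _ _) => *; ring.
- apply: etrans (J' _ _ _ _) _.
  by rewrite -(vapp_Lb_conj Lb oO (smooth_conj sB) Op) conj_Bb conjCK.
Qed.

Let conj_lin (u v w : C) : (- u + v * w)^* = - u^* + v^* * w^*.
Proof. by rewrite conjD conjN conjM. Qed.

Let cxbJ : unlift_xb^* = unlift_y.
Proof. by apply: etrans (conj_lin _ _ _) _; rewrite (conjCK b_) (conjCK B). Qed.
Let cxJ : unlift_x^* = unlift_yb.
Proof.
by apply: etrans (conj_lin _ _ _) _; rewrite (conjM e) conjV (conjCK B).
Qed.

(** The form [rho] is real, so conjugating [d rho] exchanges [sigma] and [zeta] with their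
    conjugates. The structure equation for [rho] prescribes conjugate coefficients in these slots,
    and without the identities it would have no solution. *)
Lemma krho_conj : [/\ kr 1 2 = (kr 0 2)^*, kr 1 3 = (kr 0 4)^*,
  kr 1 4 = (kr 0 3)^* & kr 2 4 = (kr 2 3)^*].
Proof.
have [_ -> -> -> [-> -> -> [-> -> _]]] := krho_entries.
have [c12 c13 c14] := conj_dr.
split.
- exact: (conj_entry02 _ _ a0 cxbJ cxJ c12 c13 c14).
- exact: (conj_entry04 _ a0 cxJ c13).
- exact: (conj_entry03 _ a0 cxbJ c14).
- exact: conj_entry23.
Qed.

End TorsionEntries.

(** * Torsion modulo changes of beta1 and beta2 *)

Section Shift.
Variable R : realType.
Notation C := R[i].
Implicit Types (l m : 'I_5 -> C) (tau : torsion_name -> C).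

(* Effect on the torsion of adding l . (sigma, ..) to beta1, m . (..) to beta2. *)
Definition torsion_shift n l m : C :=
  match n with
  | U1 => 2 * l 1 + (l 0)^* | U2 => 2 * l 2 + (l 2)^*
  | U3 => 2 * l 3 + (l 4)^* | U4 => 2 * l 4 + (l 3)^*
  | U5 => 0 | U6 => 0 | U7 => 0
  | V1 => 0 | V2 => - (l 0 + (l 1)^*) | V3 => 0 | V4 => 0 | V8 => l 3 + (l 4)^*
  | W1 => m 1 | W2 => m 2 | W3 => m 3 - l 0 | W4 => m 4 | W5 => 0
  | W6 => - l 1 | W7 => 0 | W8 => - l 2 | W9 => 0 | W10 => l 4
  end.

Definition lin_eval (s : lincomb R) tau : C :=
  \sum_(x <- s) x.1.1 * (if x.1.2 then (tau x.2)^* else tau x.2).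

Lemma lincomb_evalE s (t : torsion R) q : lincomb_eval s t q = lin_eval s (t^~ q).
Proof. by []. Qed.

Lemma eq_lin_eval s tau tau' : (forall n, tau n = tau' n) ->
  lin_eval s tau = lin_eval s tau'.
Proof. by move=> E; apply: eq_bigr => x _; rewrite E. Qed.

Lemma lin_evalD s tau tau' :
  lin_eval s (fun n => tau n + tau' n) = lin_eval s tau + lin_eval s tau'.
Proof.
rewrite -big_split; apply: eq_bigr => x _ /=.
by case: x.1.2; rewrite -mulrDr // conjD.
Qed.

(** Numbering of the names, used as a boolean equality test on them. *)
Definition name_index n : nat :=
  match n with
  | U1 => 0 | U2 => 1 | U3 => 2 | U4 => 3 | U5 => 4 | U6 => 5 | U7 => 6
  | V1 => 7 | V2 => 8 | V3 => 9 | V4 => 10 | V8 => 11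
  | W1 => 12 | W2 => 13 | W3 => 14 | W4 => 15 | W5 => 16 | W6 => 17 | W7 => 18
  | W8 => 19 | W9 => 20 | W10 => 21
  end.

Definition single n0 (x : C) n : C := if name_index n == name_index n0 then x else 0.

(** A combination may repeat a name; this is the total coefficient of [n0] in it, or of its
    conjugate when [c] is true. *)
Definition lin_coef (c : bool) (s : lincomb R) n0 : C :=
  \sum_(x <- s) x.1.1 *
    (if (x.1.2 == c) && (name_index x.2 == name_index n0) then 1 else 0).

Lemma lin_eval_single s n0 x :
  lin_eval s (single n0 x) = lin_coef false s n0 * x + lin_coef true s n0 * x^*.
Proof.
rewrite /lin_eval /lin_coef !mulr_suml -big_split; apply: eq_bigr => y _ /=.
rewrite /single; case: y.1.2; case: (_ == _) => /=;
  by rewrite ?conjC0 ?mulr0 ?mulr1 ?mul0r ?add0r ?addr0.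
Qed.

Lemma lin_eval_reduced s x1 x2 y1 y3 y4 z5 z7 z9 :
  lin_eval s (fun n => match n with U1 => x2^* | U2 => x1 | V1 => y1 | V3 => y3
    | V4 => y4 | W5 => z5 | W7 => z7 | W9 => z9 | _ => 0 end) =
  (lin_coef false s V1 * y1 + lin_coef true s V1 * y1^*)
  + (lin_coef false s V3 * y3 + lin_coef true s V3 * y3^*)
  + (lin_coef false s V4 * y4 + lin_coef true s V4 * y4^*)
  + (lin_coef false s W5 * z5 + lin_coef true s W5 * z5^*)
  + (lin_coef false s W7 * z7 + lin_coef true s W7 * z7^*)
  + (lin_coef false s W9 * z9 + lin_coef true s W9 * z9^*)
  + (lin_coef false s U2 * x1 + lin_coef true s U2 * x1^*)
  + (lin_coef false s U1 * x2^* + lin_coef true s U1 * (x2^*)^*).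
Proof.
rewrite -!lin_eval_single -!lin_evalD.
by apply: eq_lin_eval; case; rewrite /single /= ?add0r ?addr0.
Qed.

(* The change of beta1, beta2 which leaves only the eight essential functions. *)
Definition reduce_l tau (j : 'I_5) : C :=
  nth 0 [:: tau V2 - (tau W6)^*; tau W6; tau W8; - tau V8 + (tau W10)^*; - tau W10] j.

Definition reduce_m tau (j : 'I_5) : C :=
  nth 0 [:: 0; - tau W1; - tau W2; tau V2 - (tau W6)^* - tau W3; - tau W4] j.

Lemma shift_reduced tau :
  tau U5 = 0 -> tau U6 = 0 -> tau U7 = 0 ->
  tau U3 - 2 * tau V8 + (tau W10)^* = 0 ->
  tau U4 - (tau V8)^* - tau W10 = 0 ->
  forall n, tau n + torsion_shift n (reduce_l tau) (reduce_m tau) =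
    match n with
    | U1 => ((tau U1)^* + tau V2 + (tau W6)^*)^*
    | U2 => tau U2 + 2 * tau W8 + (tau W8)^*
    | V1 => tau V1 | V3 => tau V3 | V4 => tau V4
    | W5 => tau W5 | W7 => tau W7 | W9 => tau W9 | _ => 0 end.
Proof.
move=> u5 u6 u7 y1 y2; have c0 : (0 : C)^* = 0 by exact: conjC0.
case; rewrite /torsion_shift /reduce_l /reduce_m /= ?addr0 //;
  rewrite ?(conjD, conjN, conjCK).
- by ring.
- by ring.
- by rewrite -[RHS]y1; ring.
- by rewrite -[RHS]y2; ring.
all: by ring.
Qed.

End Shift.

Section TorsionFunctions.
Variables (R : realType) (Omega : set 'rV[R]_5) (Lb : vfield R 4).
Variables (fP fQ fR fB : 'rV[R]_5 -> R[i]) (fA : 'rV[R]_5 -> R).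
Notation C := R[i].
Hypothesis oO : open Omega.
Hypothesis sLb : smooth_mx Omega Lb.
Hypothesis frameU : maximally_minimal Lb Omega.
Hypothesis str : structure_functions Lb Omega fP fQ fR fB fA.
Hypothesis R0 : forall p, Omega p -> fR p = 0.

Notation ks := (ksigma Lb fP fQ fB).
Notation kr := (krho Lb fP fQ fB).
Notation kz := (kzeta Lb fP fQ fB).
Notation valb := (value_b fQ fB).
Notation valc := (value_c fB).
Notation vald := (value_d Lb fP fQ fB).
Notation D := (lifted_domain Omega).
Notation eqs := (structure_equations Lb valb valc vald Omega).
Notation modif := (modify Lb valb valc vald).

Definition tors : torsion R := fun n q =>
  match n with
  | U1 => ks q 0 1 | U2 => ks q 0 2 | U3 => ks q 0 3 | U4 => ks q 0 4
  | U5 => ks q 1 2 | U6 => ks q 1 3 | U7 => ks q 1 4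
  | V1 => kr q 0 1 | V2 => kr q 0 2 | V3 => kr q 0 3 | V4 => kr q 0 4
  | V8 => kr q 2 3
  | W1 => kz q 0 1 | W2 => kz q 0 2 | W3 => kz q 0 3 | W4 => kz q 0 4
  | W5 => kz q 1 2 | W6 => kz q 1 3 | W7 => kz q 1 4 | W8 => kz q 2 3
  | W9 => kz q 2 4 | W10 => kz q 3 4
  end.

(** All statements about torsion rest on this description of the solutions as one explicit solution
    plus a translation: existence, uniqueness, and the test for essential combinations. *)
Lemma torsion_iff (l1 l2 : 'I_5 -> 'rV[R]_(5 + 4) -> C) (t : torsion R) :
  eqs (modif l1 (@beta1 R)) (modif l2 (@beta2 R)) t <->
  forall q, D q -> forall n, t n q = tors n q + torsion_shift n (l1^~ q) (l2^~ q).
Proof.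
split=> E q Dq; have rr := conjr_rho fB oO sLb frameU Dq.
all: have Of := row_free_lifted fP fQ fB oO sLb frameU Dq.
all: have ds := dform_sigma fP fQ fB oO sLb frameU Dq.
all: have dr := dform_rho oO sLb frameU str Dq.
all: have dz := dform_zeta oO sLb frameU str Dq.
all: have [_ _ _ _ [_ _ _ [s23 s24 s34]]] := ksigma_entries oO sLb frameU str R0 Dq.
all: have [_ _ _ _ [_ _ _ [_ _ r34]]] := krho_entries oO sLb frameU str R0 Dq.
all: have [r12 r13 r14 r24] := krho_conj oO sLb frameU str R0 Dq.
  have [eS eR eZ] := E q Dq.
  have [u1 u2 u3 u4 [u5 u6 u7 _]] :=
    (dsigma_eq _ (l1^~ q) _ rr Of _ _ _ _ _ _ _).1 (etrans (esym ds) eS).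
  have [v1 v2 v3 v4 [_ _ _ [v8 _ _]]] :=
    (drho_eq _ (l1^~ q) _ rr Of _ _ _ _ _ _ _ _ _).1 (etrans (esym dr) eR).
  have [w1 w2 w3 w4 [w5 w6 w7 [w8 w9 w10]]] :=
    (dzeta_eq _ _ (l1^~ q) (l2^~ q) _ Of _ _ _ _ _ _ _ _ _ _).1 (etrans (esym dz) eZ).
  by case; rewrite /= ?(u1, u2, u3, u4, u5, u6, u7, v1, v2, v3, v4, v8)
    ?(w1, w2, w3, w4, w5, w6, w7, w8, w9, w10); ring.
split.
- apply: etrans ds _; apply: (dsigma_eq _ (l1^~ q) _ rr Of _ _ _ _ _ _ _).2.
  rewrite s23 s24 s34 !E//=.
  by split; [| | | |split; [| | |split]]; ring.
- apply: etrans dr _; apply: (drho_eq _ (l1^~ q) _ rr Of _ _ _ _ _ _ _ _ _).2.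
  rewrite r34 !E//= r12 r13 r14 r24 !(conjD, conjN) !conjCK ?conjC0.
  by split; [| | | |split; [| | |split]]; ring.
- apply: etrans dz _.
  apply: (dzeta_eq _ _ (l1^~ q) (l2^~ q) _ Of _ _ _ _ _ _ _ _ _ _).2.
  rewrite !E//=.
  by split; [| | | |split; [| | |split]]; ring.
Qed.

End TorsionFunctions.

(** * Values of the torsion functions *)

Section JetExpansions.
Variables (R : realType) (Omega : set 'rV[R]_5) (Lb : vfield R 4).
Variables (fP fQ fR fB : 'rV[R]_5 -> R[i]) (fA : 'rV[R]_5 -> R).
Notation C := R[i].
Notation L := (fieldL Lb).
Notation T := (fieldT Lb).
Notation S := (fieldS Lb).
Notation Sb := (fieldSb Lb).
Hypothesis oO : open Omega.
Hypothesis sLb : smooth_mx Omega Lb.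
Hypothesis frameU : maximally_minimal Lb Omega.
Hypothesis str : structure_functions Lb Omega fP fQ fR fB fA.

Variable p : 'rV[R]_5.
Hypothesis Op : Omega p.

Notation l := (vapp L).
Notation m := (vapp Lb).
Notation B := fB. Notation P := fP. Notation Q := fQ. Notation A := (Ac fA).
Notation Bb := (Bb fB). Notation Pb := (Pb fP). Notation Qb := (Qb fQ).

Let sB := smooth_B oO sLb frameU str.
Let sA := smooth_A oO sLb frameU str.
Let sBb : smooth Omega Bb := smooth_Bb oO sLb frameU str.
Let sQb : smooth Omega Qb := smooth_Qb oO sLb frameU str.
Let sPb : smooth Omega Pb := smooth_Pb oO sLb frameU str.
Let sl f : smooth Omega f -> smooth Omega (l f) := @smooth_vL _ _ _ oO sLb f.
Let sm f : smooth Omega f -> smooth Omega (m f) := @smooth_vLb _ _ _ oO sLb f.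

Let at_ X f sf : is_vapp Omega X p f (vapp X f p) := @is_vapp_atom _ _ Omega X p f sf.
Let cst X c : is_vapp Omega X p (fun=> c) 0 := is_vapp_cst Omega X p c.
Let add X f g u v := @is_vappD R 4 Omega oO X p Op f g u v.
Let mul X f g u v := @is_vappM R 4 Omega oO X p Op f g u v.
Let opp X f u := @is_vappN R 4 Omega oO X p Op f u.

Lemma vapp_T_fun X f : smooth Omega f ->
  vapp X (vapp T f) p = 'i * (vapp X (l (m f)) p - vapp X (m (l f)) p).
Proof.
move=> sf.
have E x : Omega x -> vapp T f x = 'i * (l (m f) x - m (l f) x).
  by move=> Ox; exact: (vapp_T oO sLb sf Ox).
apply: etrans (eq_vapp oO X E Op) _.
apply: etrans (mul (cst X 'i) (add (at_ X (sl (sm sf))) (opp (at_ X (sm (sl sf)))))).2 _.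
by rewrite mul0r add0r.
Qed.

(** Derivatives along [T], [S], [Sb] have to become words in [L] and [Lb], the only derivatives that
    a [jetpoly] can express. *)
Lemma vapp_S_expand f : smooth Omega f ->
  vapp S f p = 'i * (l (l (m f)) p - 2 * l (m (l f)) p + m (l (l f)) p).
Proof.
move=> sf; rewrite (vapp_S oO sLb sf Op) (vapp_T_fun L sf) (vapp_T oO sLb (sl sf) Op).
by move: (l _ p) (l _ p) (m _ p) => *; ring.
Qed.

Lemma vapp_Sb_expand f : smooth Omega f ->
  vapp Sb f p = 'i * (2 * m (l (m f)) p - m (m (l f)) p - l (m (m f)) p).
Proof.
move=> sf; rewrite (vapp_Sb oO sLb sf Op) (vapp_T_fun Lb sf) (vapp_T oO sLb (sm sf) Op).
by move: (m _ p) (m _ p) (l _ p) => *; ring.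
Qed.

Lemma zdE x : Omega x ->
  zd Lb fP fQ fB x = 'i * (m B x - Pb x - 2 / 3 * (B x * Qb x)).
Proof.
move=> Ox; rewrite /zd /d0.
have -> (u v w y : C) : (- 'i * u + 'i * v + 2 * 'i / 3 * w * y)^* =
    'i * (u^* - v^* - 2 / 3 * (w^* * y^*)).
  by rewrite !(conjn, conj_i, conjV, conjM, conjN, conjD); field.
by rewrite -(vapp_Lb_conj Lb oO sBb Ox) conj_Bb conjCK.
Qed.

Lemma vapp_zd X : vapp X (zd Lb fP fQ fB) p = 'i * (vapp X (m B) p - vapp X Pb p
  - 2 / 3 * (vapp X B p * Qb p + B p * vapp X Qb p)).
Proof.
apply: etrans (eq_vapp oO X zdE Op) _.
apply: etrans (mul (cst X 'i) (add (add (at_ X (sm sB)) (opp (at_ X sPb)))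
  (opp (mul (cst X (2 / 3)) (mul (at_ X sB) (at_ X sQb)))))).2 _.
by rewrite !mul0r !add0r.
Qed.

Lemma b0E x : b0 fQ fB x = - 'i * (B x - Qb x / 3).
Proof. by rewrite /b0 /Qb; field. Qed.

Lemma vapp_b0 X : vapp X (b0 fQ fB) p = - 'i * (vapp X B p - vapp X Qb p / 3).
Proof.
apply: etrans (add (mul (cst X (- 'i)) (at_ X sB)) (mul (cst X ('i / 3)) (at_ X sQb))).2 _.
by rewrite !mul0r !add0r; move: (vapp X _ p) (vapp X _ p) => *; field.
Qed.

Lemma vapp_tE' X : vapp X (tE' Lb fP fQ fB fA) p = - 'i *
  (vapp X (m A) p + (vapp X Bb p * Pb p + Bb p * vapp X Pb p)
   + (vapp X A p * B p + A p * vapp X B p) - vapp X (l Pb) p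
   - (vapp X A p * Qb p + A p * vapp X Qb p)).
Proof.
apply: etrans (mul (cst X (- 'i)) (add (add (add (add (at_ X (sm sA))
  (mul (at_ X sBb) (at_ X sPb))) (mul (at_ X sA) (at_ X sB)))
  (opp (at_ X (sl sPb)))) (opp (mul (at_ X sA) (at_ X sQb))))).2 _.
by rewrite mul0r add0r.
Qed.

Lemma vapp_tF' X : vapp X (tF' Lb fQ fB fA) p = - 'i *
  (vapp X A p + vapp X (m Bb) p + (vapp X Bb p * B p + Bb p * vapp X B p)
   - vapp X (l Qb) p).
Proof.
apply: etrans (mul (cst X (- 'i)) (add (add (add (at_ X sA) (at_ X (sm sBb)))
  (mul (at_ X sBb) (at_ X sB))) (opp (at_ X (sl sQb))))).2 _.
by rewrite mul0r add0r.
Qed.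

Lemma vapp_tG' X : vapp X (tG' Lb fP fQ fB) p = - 'i *
  (vapp X (m B) p + (vapp X B p * B p + B p * vapp X B p) - vapp X Pb p
   - (vapp X Qb p * B p + Qb p * vapp X B p)).
Proof.
apply: etrans (mul (cst X (- 'i)) (add (add (add (at_ X (sm sB))
  (mul (at_ X sB) (at_ X sB))) (opp (at_ X sPb)))
  (opp (mul (at_ X sQb) (at_ X sB))))).2 _.
by rewrite mul0r add0r.
Qed.

Hypothesis R0 : forall p, Omega p -> fR p = 0.

(** The conjugate of [jacobi_L_T_S]. *)
Lemma jacobi_Lb_T_Sb :
  vapp Lb (tG' Lb fP fQ fB) p + tG' Lb fP fQ fB p * B p - Qb p * tG' Lb fP fQ fB p = 0.
Proof.
have J := congr1 (fun z : C => z^*) (jacobi_L_T_S oO sLb frameU str R0 Op).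
have JE (u v w y : C) : (u + v * w - y * v)^* = u^* + v^* * w^* - y^* * v^*.
  by rewrite !(conjD, conjN, conjM).
have sG := smooth_tG oO sLb frameU str.
have E : (vapp L (tG Lb fP fQ fB) p)^* = vapp Lb (tG' Lb fP fQ fB) p.
  rewrite -(vapp_Lb_conj Lb oO sG Op).
  by apply: (eq_vapp oO) Op => x Ox; exact: (conj_tG oO sLb frameU str Ox).
have E' := conj_tG oO sLb frameU str Op.
move: J; rewrite JE E E' conjCK => ->; exact: conjC0.
Qed.

End JetExpansions.

(* Expansions of a^2 abar^2 V1 and of a abar^3 W5 for the normalized value of e. *)
Definition poly_V1 (R : realType) : jetpoly R :=
  [:: (- ('i * 1), [:: ([:: true; true], true, SymP)]);
   ('i * 1, [:: ([:: true; true; false], false, SymB)]);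
   ('i * 2, [:: ([:: true; false], false, SymA)]);
   (- ('i * 2), [:: ([:: true; false; true], false, SymB)]);
   ('i * 1, [:: ([:: true; false; false], true, SymB)]);
   (- ('i * 1), [:: ([:: false; true], false, SymA)]);
   ('i * 1, [:: ([:: false; true; true], false, SymB)]);
   (- ('i * 2), [:: ([:: false; true; false], true, SymB)]);
   ('i * 1, [:: ([:: false; false; true], true, SymB)]);
   ('i * 2, [:: ([::], false, SymA); ([:: true], false, SymB)]);
   (- ('i * 2), [:: ([::], false, SymA); ([:: true], true, SymQ)]);
   ('i * 2, [:: ([::], false, SymA); ([:: false], true, SymB)]);
   ('i * 2, [:: ([::], false, SymB); ([:: true], false, SymA)]);
   (- ('i * 1), [:: ([::], false, SymB); ([:: true; true], true, SymQ)]);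
   ('i * 3, [:: ([::], false, SymB); ([:: true; false], true, SymB)]);
   (- ('i * 2), [:: ([::], false, SymB); ([:: false; true], true, SymB)]);
   ('i * 1, [:: ([::], true, SymB); ([:: true], true, SymP)]);
   ('i * 1, [:: ([::], true, SymB); ([:: true; false], false, SymB)]);
   (- ('i * 1), [:: ([::], true, SymB); ([:: false], false, SymA)]);
   (- ('i * 1), [:: ([::], true, SymQ); ([:: true], false, SymA)]);
   (- ('i * 1), [:: ([:: true], false, SymB); ([:: false], true, SymB)]);
   ('i * 1, [:: ([:: true], true, SymB); ([:: false], false, SymB)]);
   (- ('i * 2), [:: ([::], false, SymA); ([::], false, SymB); ([::], true, SymB)]);
   ('i * 1, [:: ([::], false, SymA); ([::], true, SymB); ([::], true, SymQ)]);
   ('i * 2, [:: ([::], false, SymB); ([::], false, SymB); ([:: true], true, SymB)]);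
   ('i * 4, [:: ([::], false, SymB); ([::], true, SymB); ([:: true], false, SymB)]);
   (- ('i * 1), [:: ([::], false, SymB); ([::], true, SymB); ([:: true], true, SymQ)]);
   ('i * 1, [:: ([::], false, SymB); ([::], true, SymB); ([:: false], true, SymB)]);
   (- ('i * 1), [:: ([::], false, SymB); ([::], true, SymQ); ([:: true], true, SymB)]);
   (- ('i * 1), [:: ([::], true, SymB); ([::], true, SymB); ([:: false], false, SymB)]);
   (- ('i * 1), [:: ([::], true, SymB); ([::], true, SymQ); ([:: true], false, SymB)]);
   (- ('i * 2), [:: ([::], false, SymB); ([::], false, SymB); ([::], true, SymB); ([::], true, SymB)]);
   ('i * 1, [:: ([::], false, SymB); ([::], true, SymB); ([::], true, SymB); ([::], true, SymQ)])].

Definition poly_W5 (R : realType) : jetpoly R :=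
  [:: (- (1), [:: ([:: true; false], true, SymP)]);
   (1 / 3, [:: ([:: true; false; false], true, SymQ)]);
   (1, [:: ([:: false; true], true, SymP)]);
   (1, [:: ([:: false; true; false], false, SymB)]);
   (- (2 / 3), [:: ([:: false; true; false], true, SymQ)]);
   (- (1), [:: ([:: false; false; true], false, SymB)]);
   (1 / 3, [:: ([:: false; false; true], true, SymQ)]);
   (- (1), [:: ([::], false, SymA); ([:: false], false, SymB)]);
   (1 / 3, [:: ([::], false, SymA); ([:: false], true, SymQ)]);
   (1, [:: ([::], false, SymB); ([:: true; false], false, SymB)]);
   (- (2 / 3), [:: ([::], false, SymB); ([:: true; false], true, SymQ)]);
   (- (1), [:: ([::], false, SymB); ([:: false], false, SymA)]);
   (2 / 3, [:: ([::], false, SymB); ([:: false; true], true, SymQ)]);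
   (- (1 / 3), [:: ([::], false, SymQ); ([:: false], true, SymP)]);
   (1 / 3, [:: ([::], false, SymQ); ([:: false; false], false, SymB)]);
   (1, [:: ([::], true, SymB); ([:: false], true, SymP)]);
   (- (1), [:: ([::], true, SymB); ([:: false; false], false, SymB)]);
   (2 / 3, [:: ([::], true, SymP); ([:: true], true, SymQ)]);
   (- (1), [:: ([::], true, SymP); ([:: false], true, SymB)]);
   (- (1), [:: ([::], true, SymQ); ([:: true; false], false, SymB)]);
   (1 / 3, [:: ([::], true, SymQ); ([:: false], false, SymA)]);
   (2 / 3, [:: ([::], true, SymQ); ([:: false; true], false, SymB)]);
   (1, [:: ([:: true], false, SymB); ([:: false], false, SymB)]);
   (- (1 / 3), [:: ([:: true], false, SymB); ([:: false], true, SymQ)]);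
   (- (2 / 3), [:: ([:: true], true, SymQ); ([:: false], false, SymB)]);
   (1, [:: ([:: false], false, SymB); ([:: false], true, SymB)]);
   (- (1), [:: ([::], false, SymA); ([::], false, SymB); ([::], false, SymB)]);
   (4 / 3, [:: ([::], false, SymA); ([::], false, SymB); ([::], true, SymQ)]);
   (- (1 / 3), [:: ([::], false, SymA); ([::], true, SymQ); ([::], true, SymQ)]);
   (1, [:: ([::], false, SymB); ([::], false, SymB); ([:: true], false, SymB)]);
   (- (2 / 3), [:: ([::], false, SymB); ([::], false, SymB); ([:: true], true, SymQ)]);
   (- (1 / 3), [:: ([::], false, SymB); ([::], false, SymQ); ([::], true, SymP)]);
   (1, [:: ([::], false, SymB); ([::], false, SymQ); ([:: false], false, SymB)]);
   (- (1 / 3), [:: ([::], false, SymB); ([::], false, SymQ); ([:: false], true, SymQ)]);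
   (1, [:: ([::], false, SymB); ([::], true, SymB); ([::], true, SymP)]);
   (- (5), [:: ([::], false, SymB); ([::], true, SymB); ([:: false], false, SymB)]);
   (4 / 3, [:: ([::], false, SymB); ([::], true, SymB); ([:: false], true, SymQ)]);
   (- (4 / 3), [:: ([::], false, SymB); ([::], true, SymQ); ([:: true], false, SymB)]);
   (2 / 3, [:: ([::], false, SymB); ([::], true, SymQ); ([:: true], true, SymQ)]);
   (- (2 / 3), [:: ([::], false, SymB); ([::], true, SymQ); ([:: false], true, SymB)]);
   (1 / 3, [:: ([::], false, SymQ); ([::], true, SymP); ([::], true, SymQ)]);
   (- (2 / 3), [:: ([::], false, SymQ); ([::], true, SymQ); ([:: false], false, SymB)]);
   (- (1), [:: ([::], true, SymB); ([::], true, SymP); ([::], true, SymQ)]);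
   (7 / 3, [:: ([::], true, SymB); ([::], true, SymQ); ([:: false], false, SymB)]);
   (1 / 3, [:: ([::], true, SymQ); ([::], true, SymQ); ([:: true], false, SymB)]);
   (1 / 3, [:: ([::], false, SymB); ([::], false, SymB); ([::], false, SymB); ([::], false, SymQ)]);
   (- (2), [:: ([::], false, SymB); ([::], false, SymB); ([::], false, SymB); ([::], true, SymB)]);
   (- (2 / 3), [:: ([::], false, SymB); ([::], false, SymB); ([::], false, SymQ); ([::], true, SymQ)]);
   (10 / 3, [:: ([::], false, SymB); ([::], false, SymB); ([::], true, SymB); ([::], true, SymQ)]);
   (1 / 3, [:: ([::], false, SymB); ([::], false, SymQ); ([::], true, SymQ); ([::], true, SymQ)]);
   (- (4 / 3), [:: ([::], false, SymB); ([::], true, SymB); ([::], true, SymQ); ([::], true, SymQ)])].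

Section PolynomialValues.
Variables (R : realType) (Lb : vfield R 4) (p : 'rV[R]_5).
Variables (fP fQ fR fB : 'rV[R]_5 -> R[i]) (fA : 'rV[R]_5 -> R).
Notation C := R[i].
Notation l := (vapp (fieldL Lb)).
Notation m := (vapp Lb).
Notation B := fB. Notation P := fP. Notation Q := fQ. Notation A := (Ac fA).
Notation Bb := (Bb fB). Notation Pb := (Pb fP). Notation Qb := (Qb fQ).

Let termE (c x y s s' : C) : x = y -> s = s' -> c * x + s = c * y + s'.
Proof. by move=> -> ->. Qed.
Let lastE (c x y : C) : x = y -> c * x + 0 = c * y.
Proof. by move=> ->; rewrite addr0. Qed.
Let prodE (x y s s' : C) : x = y -> s = s' -> x * s = y * s'.
Proof. by move=> -> ->. Qed.
Let prod1 (x y : C) : x = y -> x * 1 = y.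
Proof. by move=> ->; rewrite mulr1. Qed.

(** Compares the two sums monomial by monomial, down to jets that agree by reduction, so that no
    normalization of a large polynomial has to look inside the derivatives. *)
Local Ltac polyeval := repeat match goal with
  | |- _ + 0 = _ => apply lastE
  | |- _ + _ = _ => apply termE
  | |- _ * 1 = _ => apply prod1; reflexivity
  | |- _ * _ = _ => apply prodE; [reflexivity|]
  end.

Lemma poly_V1E : jetpoly_eval Lb fP fQ fR fB fA (poly_V1 R) p =
  (- ('i * 1)) * (l (l Pb) p) + (
   ('i * 1) * (l (l (m B)) p) + (
   ('i * 2) * (l (m A) p) + (
   (- ('i * 2)) * (l (m (l B)) p) + (
   ('i * 1) * (l (m (m Bb)) p) + (
   (- ('i * 1)) * (m (l A) p) + (
   ('i * 1) * (m (l (l B)) p) + (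
   (- ('i * 2)) * (m (l (m Bb)) p) + (
   ('i * 1) * (m (m (l Bb)) p) + (
   ('i * 2) * (A p * (l B p)) + (
   (- ('i * 2)) * (A p * (l Qb p)) + (
   ('i * 2) * (A p * (m Bb p)) + (
   ('i * 2) * (B p * (l A p)) + (
   (- ('i * 1)) * (B p * (l (l Qb) p)) + (
   ('i * 3) * (B p * (l (m Bb) p)) + (
   (- ('i * 2)) * (B p * (m (l Bb) p)) + (
   ('i * 1) * (Bb p * (l Pb p)) + (
   ('i * 1) * (Bb p * (l (m B) p)) + (
   (- ('i * 1)) * (Bb p * (m A p)) + (
   (- ('i * 1)) * (Qb p * (l A p)) + (
   (- ('i * 1)) * (l B p * (m Bb p)) + (
   ('i * 1) * (l Bb p * (m B p)) + (
   (- ('i * 2)) * (A p * (B p * (Bb p))) + (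
   ('i * 1) * (A p * (Bb p * (Qb p))) + (
   ('i * 2) * (B p * (B p * (l Bb p))) + (
   ('i * 4) * (B p * (Bb p * (l B p))) + (
   (- ('i * 1)) * (B p * (Bb p * (l Qb p))) + (
   ('i * 1) * (B p * (Bb p * (m Bb p))) + (
   (- ('i * 1)) * (B p * (Qb p * (l Bb p))) + (
   (- ('i * 1)) * (Bb p * (Bb p * (m B p))) + (
   (- ('i * 1)) * (Bb p * (Qb p * (l B p))) + (
   (- ('i * 2)) * (B p * (B p * (Bb p * (Bb p)))) + (
   ('i * 1) * (B p * (Bb p * (Bb p * (Qb p)))))))))))))))))))))))))))))))))))).
Proof.
rewrite /jetpoly_eval /poly_V1 !big_cons !big_nil; polyeval.
Qed.

Lemma poly_W5E : jetpoly_eval Lb fP fQ fR fB fA (poly_W5 R) p =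
  (- (1)) * (l (m Pb) p) + (
   (1 / 3) * (l (m (m Qb)) p) + (
   (1) * (m (l Pb) p) + (
   (1) * (m (l (m B)) p) + (
   (- (2 / 3)) * (m (l (m Qb)) p) + (
   (- (1)) * (m (m (l B)) p) + (
   (1 / 3) * (m (m (l Qb)) p) + (
   (- (1)) * (A p * (m B p)) + (
   (1 / 3) * (A p * (m Qb p)) + (
   (1) * (B p * (l (m B) p)) + (
   (- (2 / 3)) * (B p * (l (m Qb) p)) + (
   (- (1)) * (B p * (m A p)) + (
   (2 / 3) * (B p * (m (l Qb) p)) + (
   (- (1 / 3)) * (Q p * (m Pb p)) + (
   (1 / 3) * (Q p * (m (m B) p)) + (
   (1) * (Bb p * (m Pb p)) + (
   (- (1)) * (Bb p * (m (m B) p)) + (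
   (2 / 3) * (Pb p * (l Qb p)) + (
   (- (1)) * (Pb p * (m Bb p)) + (
   (- (1)) * (Qb p * (l (m B) p)) + (
   (1 / 3) * (Qb p * (m A p)) + (
   (2 / 3) * (Qb p * (m (l B) p)) + (
   (1) * (l B p * (m B p)) + (
   (- (1 / 3)) * (l B p * (m Qb p)) + (
   (- (2 / 3)) * (l Qb p * (m B p)) + (
   (1) * (m B p * (m Bb p)) + (
   (- (1)) * (A p * (B p * (B p))) + (
   (4 / 3) * (A p * (B p * (Qb p))) + (
   (- (1 / 3)) * (A p * (Qb p * (Qb p))) + (
   (1) * (B p * (B p * (l B p))) + (
   (- (2 / 3)) * (B p * (B p * (l Qb p))) + (
   (- (1 / 3)) * (B p * (Q p * (Pb p))) + (
   (1) * (B p * (Q p * (m B p))) + (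
   (- (1 / 3)) * (B p * (Q p * (m Qb p))) + (
   (1) * (B p * (Bb p * (Pb p))) + (
   (- (5)) * (B p * (Bb p * (m B p))) + (
   (4 / 3) * (B p * (Bb p * (m Qb p))) + (
   (- (4 / 3)) * (B p * (Qb p * (l B p))) + (
   (2 / 3) * (B p * (Qb p * (l Qb p))) + (
   (- (2 / 3)) * (B p * (Qb p * (m Bb p))) + (
   (1 / 3) * (Q p * (Pb p * (Qb p))) + (
   (- (2 / 3)) * (Q p * (Qb p * (m B p))) + (
   (- (1)) * (Bb p * (Pb p * (Qb p))) + (
   (7 / 3) * (Bb p * (Qb p * (m B p))) + (
   (1 / 3) * (Qb p * (Qb p * (l B p))) + (
   (1 / 3) * (B p * (B p * (B p * (Q p)))) + (
   (- (2)) * (B p * (B p * (B p * (Bb p)))) + (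
   (- (2 / 3)) * (B p * (B p * (Q p * (Qb p)))) + (
   (10 / 3) * (B p * (B p * (Bb p * (Qb p)))) + (
   (1 / 3) * (B p * (Q p * (Qb p * (Qb p)))) + (
   (- (4 / 3)) * (B p * (Bb p * (Qb p * (Qb p)))))))))))))))))))))))))))))))))))))))))))))))))))))).
Proof.
rewrite /jetpoly_eval /poly_W5 !big_cons !big_nil; polyeval.
Qed.

End PolynomialValues.

Opaque ksigma krho kzeta.

(** * The torsion coefficients as explicit functions *)

Section TorsionValues.
Variables (R : realType) (Omega : set 'rV[R]_5) (Lb : vfield R 4).
Variables (fP fQ fR fB : 'rV[R]_5 -> R[i]) (fA : 'rV[R]_5 -> R).
Notation C := R[i].
Notation L := (fieldL Lb).
Notation T := (fieldT Lb).
Hypothesis oO : open Omega.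
Hypothesis sLb : smooth_mx Omega Lb.
Hypothesis frameU : maximally_minimal Lb Omega.
Hypothesis str : structure_functions Lb Omega fP fQ fR fB fA.
Hypothesis R0 : forall p, Omega p -> fR p = 0.

Variable q : 'rV[R]_(5 + 4).
Hypothesis Dq : lifted_domain Omega q.
Let p := base q.
Let a := par_a q.
Let ab := (par_a q)^*.
Let Op : Omega p := Dq.1.
Let a0 : a != 0 := Dq.2.
Let ab0 : ab != 0. Proof. by rewrite conjC_eq0. Qed.

Notation l := (vapp L).
Notation m := (vapp Lb).
Notation B := fB. Notation P := fP. Notation Q := fQ. Notation A := (Ac fA).
Notation Bb := (Bb fB). Notation Pb := (Pb fP). Notation Qb := (Qb fQ).
Notation ks := (ksigma Lb fP fQ fB q).
Notation kr := (krho Lb fP fQ fB q).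
Notation kz := (kzeta Lb fP fQ fB q).
Notation tors := (tors Lb fP fQ fB).
Notation cx := (unlift_x fQ fB q). Notation cy := (unlift_y Lb fP fQ fB q).
Notation cxb := (unlift_xb Lb fP fQ fB q). Notation cyb := (unlift_yb fQ fB q).

Let sB := smooth_B oO sLb frameU str.
Let sA := smooth_A oO sLb frameU str.
Let sBb : smooth Omega Bb := smooth_Bb oO sLb frameU str.
Let sQb : smooth Omega Qb := smooth_Qb oO sLb frameU str.
Let sPb : smooth Omega Pb := smooth_Pb oO sLb frameU str.

Let sm f : smooth Omega f -> smooth Omega (m f) := @smooth_vLb _ _ _ oO sLb f.

Let jj : 'i * 'i = -1 :> C. Proof. by rewrite -expr2 sqrCi. Qed.

(** [b0] and [zd] with their factors [- 'i] and ['i] removed; [betab] and [zetb] are the conjugates.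
    These are the quantities free of ['i] on which [field] can be used. *)
Let beta : C := B p - Qb p / 3.
Let betab : C := Bb p - Q p / 3.
Let zet : C := m B p - Pb p - 2 / 3 * (B p * Qb p).
Let zetb : C := l Bb p - P p - 2 / 3 * (Bb p * Q p).

Let b0_i : b0 fQ fB p = - 'i * beta. Proof. exact: b0E. Qed.
Let b0b_i : (b0 fQ fB p)^* = 'i * betab.
Proof.
rewrite b0_i.
have -> (u v : C) : (- 'i * (u - v / 3))^* = 'i * (u^* - v^* / 3).
  by rewrite !(conjn, conj_i, conjV, conjM, conjN, conjD) opprK.
by rewrite (conjCK (Q p)).
Qed.
Let zd_i : zd Lb fP fQ fB p = 'i * zet.
Proof. exact (zdE oO sLb frameU str Op). Qed.
Let d0_i : d0 Lb fP fQ fB p = - 'i * zetb.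
Proof.
rewrite /d0 -[fun x => _]/Bb -[(fB p)^*]/(Bb p) /zetb.
by move: (l Bb p) (Bb p) => *; field.
Qed.
Let b0_times_i : b0 fQ fB p * 'i = beta.
Proof. by rewrite b0_i mulrAC mulNr jj opprK mul1r. Qed.
Let b0b_times_i : (b0 fQ fB p)^* * 'i = - betab.
Proof. by rewrite b0b_i mulrAC jj mulN1r. Qed.
Let cy_i : cy = - 'i * (zet + beta * B p).
Proof. by rewrite /unlift_y zd_i b0_i; move: zet beta => *; ring. Qed.
Let cxb_i : cxb = 'i * (zetb + betab * Bb p).
Proof. by rewrite /unlift_xb d0_i b0b_i -[(fB p)^*]/(Bb p); move: zetb betab (Bb p) => *; ring. Qed.

Let Ksig := ksigma_entries oO sLb frameU str R0 Dq.
Let Krho := krho_entries oO sLb frameU str R0 Dq.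
Let Kzet := kzeta_entries oO sLb frameU str R0 Dq.
Let Fr := dcoefs_frho oO sLb frameU str R0 Op (erefl (dcoefs Lb (frho fB) p)).
Let Fz := dcoefs_fzeta oO sLb frameU str R0 Op
  (erefl (dcoefs Lb (fzeta Lb fP fQ fB) p)).

(** This is the equation that determines [d]: [U5] is [tG' - unlift_y] up to a nonzero factor. *)
Let tG'_cy : tG' Lb fP fQ fB p = cy.
Proof.
rewrite cy_i /tG' /zet /beta.
by move: (m B p) (Pb p) (Qb p) => *; field.
Qed.

Lemma tors_U5_U6_U7 : [/\ tors U5 q = 0, tors U6 q = 0 & tors U7 q = 0].
Proof.
have [_ _ _ _ [k12 k13 k14 _]] := Ksig.
split=> //; apply: etrans k12 _; rewrite tG'_cy.
by move: cy (b0 _ _ _) => y b; rewrite [X in _ * X](_ : _ = 0) ?mulr0//; ring.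
Qed.

(** The left side is [Q - 3 conj B - 3 'i conj b0] divided by [a], so its vanishing is what
    determines [b]. *)
Lemma tors_U3_V8_W10 : tors U3 q - 2 * tors V8 q + (tors W10 q)^* = 0.
Proof.
have [_ _ k03 _ _] := Ksig; have [_ _ _ _ [_ _ _ [k23 _ _]]] := Krho.
have [_ _ _ [_ _ k34]] := Kzet.
rewrite -/p b0_times_i in k34.
have E' : (ab^-1 * beta)^* = a^-1 * betab.
  have -> (u v w : C) : (u^*^-1 * (v - w / 3))^* = u^-1 * (v^* - w^* / 3).
    by rewrite !(conjn, conjV, conjM, conjN, conjD) conjCK.
  by rewrite (conjCK (Q p)).
have red (u v w u' v' w' : C) : u = u' -> v = v' -> w = w' ->
  u' - 2 * v' + w'^* = 0 -> u - 2 * v + w^* = 0 by move=> -> -> ->.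
apply: (red _ _ _ _ _ _ k03 k23 k34).
rewrite E'.
rewrite b0b_times_i -[(fB p)^*]/(Bb p) /betab -/a.
by move: a (Bb p) (Q p) a0 => x u v x0; field.
Qed.

(** Up to the factor conj [a], the terms are [B], [B - 'i b0] and ['i b0], which cancel whatever
    [b0] is. *)
Lemma tors_U4_V8_W10 : tors U4 q - (tors V8 q)^* - tors W10 q = 0.
Proof.
have [_ _ _ k04 _] := Ksig; have [_ _ _ [_ _ k34]] := Kzet.
have [_ _ _ _ [_ _ _ [_ k24 _]]] := Krho.
have [_ _ _ c24] := krho_conj oO sLb frameU str R0 Dq.
have red (u v w u' v' v'' w' : C) : u = u' -> v' = v^* -> v' = v'' -> w = w' ->
  u' - v'' - w' = 0 -> u - v^* - w = 0 by move=> -> <- -> ->.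
apply: (red _ _ _ _ _ _ _ k04 c24 k24 k34).
rewrite -/ab b0_times_i.
by move: ab beta (fB p) => *; ring.
Qed.

(** The entry contains [d] through [unlift_xb] but not [e]; the values of [b], [c], [d] make it
    cancel. *)
Lemma tors_V3 : tors V3 q = 0.
Proof.
have [_ _ k03 _ _] := Krho; have [_ _ _ _ [_ _ k14 _]] := Fr.
apply: etrans k03 _; rewrite k14 cxb_i -[(fB p)^*]/(Bb p) mulrAC jj /zetb /betab.
by move: (l Bb p) (Bb p) => *; rewrite [X in _ * X](_ : _ = 0) ?mulr0//; field.
Qed.

(** The normalized [e] is ['i * a * eps], and [epsb] is the conjugate of [eps]. *)
Let eps : C := m Bb p - A p - 2 * (B p * Bb p) + Bb p * Qb p / 3.
Let epsb : C := l B p - A p - 2 * (B p * Bb p) + B p * Q p / 3.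

Let value_e_eps : value_e Lb fQ fB fA q = a * ('i * eps).
Proof.
rewrite /value_e -/p -/a -[fun x => _]/Bb -[(fB p)^*]/(Bb p) -[(fQ p)^*]/(Qb p).
rewrite -[(fA p)%:C%C]/(A p) /eps.
by move: (m Bb p) (Bb p) (Qb p) (A p) => *; field.
Qed.

(** [V4] is [- 'i (e / a - 'i eps)] divided by [a] conj [a]: affine in [e] with a nonzero slope,
    hence with exactly one zero. *)
Lemma tors_V4 : tors V4 q = 0 <-> par_e q = value_e Lb fQ fB fA q.
Proof.
have [_ _ _ k04 _] := Krho; have [_ _ _ _ [_ k13 _ _]] := Fr.
have -> : tors V4 q = (a * ab)^-1 * (- 'i * (par_e q / a - 'i * eps)).
  apply: etrans k04 _; rewrite k13 /unlift_x -/p -/a b0_i -[(fB p)^*]/(Bb p).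
  have -> (x : C) : - 'i * (x - 'i * eps) = - x * 'i - eps.
    have -> : - 'i * (x - 'i * eps) = - x * 'i + ('i * 'i) * eps by move: eps => *; ring.
    by rewrite jj mulN1r.
  have -> (x : C) : (- x + - 'i * beta * Bb p) * 'i = - x * 'i + beta * Bb p.
    have -> : (- x + - 'i * beta * Bb p) * 'i = - x * 'i - ('i * 'i) * (beta * Bb p).
      by move: beta (Bb p) => *; ring.
    by rewrite jj mulN1r opprK.
  congr (_ * _); rewrite /eps /beta.
  by move: (m Bb p) (Bb p) (Qb p) (A p) (par_e q / a) => *; field.
rewrite value_e_eps; split=> [/eqP|->].
  rewrite !mulf_eq0 invr_eq0 mulf_eq0 (negPf a0) (negPf ab0) oppr_eq0.
  rewrite (negPf (@neq0Ci C)) subr_eq0 /= => /eqP <-.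
  by rewrite mulrCA divff ?mulr1.
have -> : a * ('i * eps) / a = 'i * eps by rewrite mulrAC divff ?mul1r.
by rewrite subrr !mulr0.
Qed.

(** Up to a power of conj [a], [W7] equals the left side of [jacobi_Lb_T_Sb]. It contains second
    derivatives such as [m (m B)] that nothing else cancels, so the Jacobi identity is
    indispensable. *)
Lemma tors_W7 : tors W7 q = 0.
Proof.
have [_ _ k14 _] := Kzet; have [_ _ k03 _ [_ _ _ [k23 _ _]]] := Fz.
apply: etrans k14 _; rewrite k03 k23 b0_times_i cy_i zd_i.
rewrite (vapp_zd oO sLb frameU str Op) (vapp_b0 oO sLb frameU str Op) b0_i.
have J := jacobi_Lb_T_Sb oO sLb frameU str Op R0.
rewrite (vapp_tG' oO sLb frameU str Op) in J.
rewrite [X in _ * X](_ : _ = 0) ?mulr0//; apply: etrans J.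
rewrite /tG' /zet /beta -[(fQ p)^*]/(Qb p) -[(fP p)^*]/(Pb p).
by move: (m (m B) p) (m B p) (m Pb p) (m Qb p) (Qb p) (Pb p) => *; field.
Qed.

Lemma tors_W9 : tors W9 q = 'i / (9 * ab ^+ 2) *
  (18 * m B p - 3 * m Qb p - 9 * Pb p - 12 * B p * Qb p + 9 * B p ^+ 2 + Qb p ^+ 2).
Proof.
have [_ _ _ [_ k24 _]] := Kzet; have [_ _ _ _ [_ _ _ [k23 _ _]]] := Fz.
apply: etrans k24 _; rewrite k23 b0_times_i b0_i zd_i.
rewrite (vapp_b0 oO sLb frameU str Op) /zet /beta -/ab.
by move: (m B p) (m Qb p) (Qb p) (Pb p) ab ab0 => ? ? ? ? y y0; field.
Qed.

Let cross_i : (cy * (b0 fQ fB p)^* - cyb * b0 fQ fB p) * 'i = - cy * betab - cyb * beta.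
Proof. by rewrite mulrBl -!mulrA b0_times_i b0b_times_i mulrN mulNr. Qed.

Lemma tors_X2 : lincomb_eval (X2 R) tors q = 0.
Proof.
have [c12 _ _ _] := krho_conj oO sLb frameU str R0 Dq.
move: Ksig Krho Kzet Fr Fz.
move: (dcoefs Lb (frho fB) p) (dcoefs Lb (fzeta Lb fP fQ fB) p) => dr dz.
move=> [k01 _ _ _ _] [_ _ _ _ [k12 _ _ _]] [_ k13 _ _].
move=> [_ d02 d03 d04 _] [_ _ _ z04 [_ _ _ [_ z24 _]]].
have sub (x y u v v' : C) : v = v' -> x = y * (u - v) -> x = y * (u - v') by move=> ->.
have {}k12 := sub _ _ _ _ _ cross_i k12.
have {}k13 := sub _ _ _ _ _ (congr1 ( *%R cyb) b0_times_i) k13.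
(* This sum is the conjugate of [X2], because [kr 1 2] is the conjugate of [V2]. *)
suff E : ks 0 1 + kr 1 2 + kz 1 3 = 0.
  have fin (u v v' w : C) : u + v' + w = 0 -> v' = v^* -> u^* + v + w^* = 0.
    by move=> Z vE; rewrite -[v]conjCK -vE -!conjD Z conjC0.
  apply: etrans (fin _ _ _ _ E c12).
  by rewrite /lincomb_eval !big_cons big_nil /= !mul1r addr0 !addrA.
have red (x u v w x' v' w' : C) : u = x * x' -> v = x * v' -> w = x * w' ->
  x' + v' + w' = 0 -> u + v + w = 0 by move=> -> -> -> E; rewrite -!mulrDr E mulr0.
apply: (red _ _ _ _ _ _ _ k01 k12 k13).
rewrite d02.
rewrite d03 d04.
rewrite z04 z24.
rewrite (vapp_zd oO sLb frameU str Op) (vapp_b0 oO sLb frameU str Op) /hS.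
rewrite (vapp_tG' oO sLb frameU str Op) b0b_i b0_i zd_i cy_i.
rewrite -[(fB p)^*]/(Bb p) -[(fQ p)^*]/(Qb p).
(* These quantities cancel and can be made opaque. Among them are [unlift_x] and [unlift_yb], the
   only carriers of [e], so [X2] does not depend on it. *)
move: (tE' _ _ _ _ _ p) (vapp T B p) cx cyb => ? ? ? ?.
rewrite /tG' /tF /tF' /zet /beta /betab -/p -[(fP p)^*]/(Pb p).
move: (l (m B) p) (m B p) (l Pb p) (l Qb p) (l B p) (m Bb p) (m Q p) (Bb p) (Pb p) (Qb p).
by move: (A p) (B p) (Q p) => *; field.
Qed.

Hypothesis eE : par_e q = value_e Lb fQ fB fA q.

Let e_i : par_e q / a = 'i * eps.
Proof. by rewrite eE value_e_eps mulrAC divff ?mul1r. Qed.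

Let eb_i : (par_e q)^* / ab = - 'i * epsb.
Proof.
have -> : (par_e q)^* / ab = (par_e q / a)^* by rewrite (conjM (par_e q)) conjV.
rewrite e_i /eps /epsb.
have -> (u v x y z : C) : ('i * (u - v - 2 * (x * y) + y * z / 3))^* =
    - 'i * (u^* - v^* - 2 * (x^* * y^*) + y^* * z^* / 3).
  by rewrite !(conjn, conj_i, conjV, conjM, conjN, conjD).
rewrite -(vapp_L_conj Lb oO sBb Op) conj_Bb conj_Ac (conjCK (B p)) (conjCK (Q p)).
by rewrite -[(B p)^*]/(Bb p); move: (l B p) (Bb p) (A p) => *; field.
Qed.

Let cx_i : cx = - 'i * (eps + beta * Bb p).
Proof.
by rewrite /unlift_x -/p -/a e_i b0_i -[(fB p)^*]/(Bb p); move: eps beta (Bb p) => *; ring.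
Qed.
Let cyb_i : cyb = 'i * (epsb + betab * B p).
Proof.
by rewrite /unlift_yb -/p -/ab eb_i b0b_i; move: epsb betab (B p) => *; ring.
Qed.

(** The parameter [e] enters through [unlift_x] in [U2] and through [e / a] in [W8], and its
    conjugate through conj [W8]; all are replaced by [eps] and [epsb]. *)
Lemma tors_X1 : lincomb_eval (X1 R) tors q = - ('i / (9 * a * ab)) *
  (6 * m Q p + 6 * l Qb p - 18 * l B p - 18 * m Bb p
   + 27 * B p * Bb p - 6 * B p * Q p - 6 * Bb p * Qb p
   + 2 * Q p * Qb p + 9 * A p).
Proof.
have sub (x y y' u v v' w w' : C) : y' = y -> v = v' -> w = w' ->
  x = y * (u + v + w) -> x = y' * (u + v' + w') by move=> -> -> ->.
have W8E : kz 2 3 = (a * ab)^-1 * ('i * (l B p - l Qb p / 3 + betab * beta + eps)).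
  have [_ _ _ [k23 _ _]] := Kzet; have [_ _ _ _ [_ _ _ [_ z24 _]]] := Fz.
  have := sub _ _ _ _ _ _ _ _ erefl
    (congr1 ( *%R (b0 fQ fB p)^*) b0_times_i) e_i k23.
  move=> ->; rewrite z24 (vapp_b0 oO sLb frameU str Op) b0b_i; congr (_ * _).
  by move: (l B p) (l Qb p) beta betab eps => *; field.
have cW8 : (kz 2 3)^* =
    (a * ab)^-1 * (- 'i * (m Bb p - m Q p / 3 + beta * betab + epsb)).
  rewrite W8E /betab /beta /eps.
  have -> (u v x y x' y' z w : C) : ((a * ab)^-1 * ('i * (u - v / 3
      + (y' - y / 3) * (x - x' / 3) + (z - w - 2 * (x * y') + y' * x' / 3))))^* =
      (a * ab)^-1 * (- 'i * (u^* - v^* / 3 + (x^* - x'^* / 3) * (y'^* - y^* / 3)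
      + (z^* - w^* - 2 * (x^* * y'^*) + y'^* * x'^* / 3))).
    rewrite !(conjn, conj_i, conjV, conjM, conjN, conjD) (conjCK a) (mulrC a).
    by rewrite [X in _ + X + _]mulrC.
  rewrite -(vapp_Lb_conj Lb oO sB Op) -(vapp_Lb_conj Lb oO sQb Op).
  rewrite -(vapp_L_conj Lb oO sBb Op) conj_Bb conj_Ac (conjCK (B p)) (conjCK (Q p)).
  rewrite -[(B p)^*]/(Bb p) /epsb -[fun q => _]/Bb.
  have -> : (fun q => (Qb q)^*) = Q by apply/funext => x; exact: conjCK.
  by congr (_ * _); move: (l B p) (m Bb p) (m Q p) (Bb p) (A p) => *; field.
have [_ k02 _ _ _] := Ksig.
have -> : lincomb_eval (X1 R) tors q = ks 0 2 + 2 * kz 2 3 + (kz 2 3)^*.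
  by rewrite lincomb_evalE /lin_eval !big_cons big_nil /= !mul1r addr0 !addrA.
rewrite cW8 W8E k02 b0b_i b0_i cx_i /tF -[(fB p)^*]/(Bb p) /eps /epsb /beta /betab.
rewrite -/p -/ab -/a.
move: (l B p) (m Bb p) (m Q p) (l Qb p) (Bb p) (A p) (Qb p) a a0 ab ab0.
by move=> ? ? ? ? ? ? ? x x0 y y0; field; rewrite x0 y0.
Qed.

Local Ltac gen_vapp := repeat match goal with
  |- context [@vapp ?R ?n ?X ?f ?p] => generalize (@vapp R n X f p); intro end.

(** With the quadratic products handled by [cross], every remaining term carries exactly one factor
    ['i], as do the coefficients of [poly_V1], and the identity holds with ['i] an indeterminate. *)
Lemma tors_V1 : tors V1 q = (a ^+ 2 * ab ^+ 2)^-1 *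
  jetpoly_eval Lb fP fQ fR fB fA (poly_V1 R) p.
Proof.
have cross : cxb * cy - cx * cyb = (zetb + betab * Bb p) * (zet + beta * B p)
    - (eps + beta * Bb p) * (epsb + betab * B p).
  rewrite cxb_i cy_i cx_i cyb_i.
  have mi (u v : C) : 'i * u * (- 'i * v) = u * v.
    by rewrite mulrACA mulrN jj opprK mul1r.
  have mi' (u v : C) : - 'i * u * ('i * v) = u * v.
    by rewrite mulrACA mulNr jj opprK mul1r.
  by rewrite mi mi'.
have sub (x y u v v' w : C) : v = v' -> u - v' * 'i = w -> x = y * (u - v * 'i) -> x = y * w.
  by move=> -> <-.
move: Krho Fr; move: (dcoefs Lb (frho fB) p) => dr.
move=> [k01 _ _ _ _] [d01 d02 d03 d04 [d12 d13 d14 _]].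
apply: (sub _ _ _ _ _ _ cross _ k01).
rewrite poly_V1E.
rewrite d01 d02 d03.
rewrite d04 d12 d13 d14.
rewrite (vapp_Sb_expand oO sLb Op sBb) (vapp_S_expand oO sLb Op sB).
rewrite /hT /hS /hSb.
rewrite (vapp_tE' oO sLb frameU str Op) (vapp_tF' oO sLb frameU str Op).
rewrite (vapp_tG' oO sLb frameU str Op).
rewrite (vapp_T oO sLb sA Op) (vapp_T oO sLb sB Op) (vapp_T oO sLb sBb Op).
rewrite cxb_i cy_i cx_i cyb_i.
rewrite -[(fB p)^*]/(Bb p) -[(fQ p)^*]/(Qb p) -[(fP p)^*]/(Pb p).
rewrite /tG' /tE' /tF' /tG /tE /tF /eps /epsb /zet /zetb /beta /betab -/p.
rewrite -/(Bb p) -/(Qb p) -/(Pb p).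
gen_vapp; move: (A p) (B p) (Q p) (P p) (Bb p) (Qb p) (Pb p) => *.
by field.
Qed.

Lemma tors_W5 : tors W5 q = (a * ab ^+ 3)^-1 *
  jetpoly_eval Lb fP fQ fR fB fA (poly_W5 R) p.
Proof.
have cross : cy * (b0 fQ fB p)^* - cyb * b0 fQ fB p =
    (zet + beta * B p) * betab - (epsb + betab * B p) * beta.
  rewrite cy_i cyb_i b0b_i b0_i.
  have mi (u v : C) : - 'i * u * ('i * v) = u * v.
    by rewrite mulrACA mulNr jj opprK mul1r.
  have mi' (u v : C) : 'i * u * (- 'i * v) = u * v.
    by rewrite mulrACA mulrN jj opprK mul1r.
  by rewrite mi mi'.
have cG : tG' Lb fP fQ fB p - cy = 0 by rewrite -tG'_cy subrr.
(* Here [u] is homogeneous of degree two in ['i]: the factors of [b0], [zd], [tE'] and of the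
   derivatives along [T] and [Sb] multiply. Writing ['i * 'i] on the right lets [field] match this
   degree, and [jj] is applied only here. *)
have sub (x y u v v' w w' r r' z : C) : v = v' -> w = w' -> r = 0 ->
    u = 'i * 'i * - (z + v' * w') -> x = y * (u - v * w + r' * r) -> x = y * z.
  by move=> -> -> -> ->; rewrite jj mulN1r opprK mulr0 addr0 addrK.
move: Kzet Fz; move: (dcoefs Lb (fzeta Lb fP fQ fB) p) => dz.
move=> [k12 _ _ _] [_ z02 z03 z04 [_ _ _ [z23 z24 _]]].
apply: (sub _ _ _ _ _ _ _ _ _ _ cross b0_times_i cG _ k12).
rewrite poly_W5E.
rewrite z02 z03 z04.
rewrite z23 z24.
rewrite !(vapp_zd oO sLb frameU str Op) !(vapp_b0 oO sLb frameU str Op).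
rewrite (vapp_Sb_expand oO sLb Op sB) (vapp_Sb_expand oO sLb Op sQb).
rewrite (vapp_T oO sLb (sm sB) Op) (vapp_T oO sLb sPb Op).
rewrite (vapp_T oO sLb sB Op) (vapp_T oO sLb sQb Op).
rewrite cyb_i cy_i b0b_i b0_i zd_i.
rewrite -[(fB p)^*]/(Bb p) -[(fQ p)^*]/(Qb p) -[(fP p)^*]/(Pb p).
rewrite /tE' /tF' /epsb /zet /beta /betab -/p.
rewrite -/(Bb p) -/(Qb p) -/(Pb p).
gen_vapp; move: (A p) (B p) (Q p) (P p) (Bb p) (Qb p) (Pb p) => *.
by field.
Qed.

End TorsionValues.

(** * Essential combinations of torsion coefficients *)

Lemma big_ord8 (T : nmodType) (F : 'I_8 -> T) :
  \sum_i F i = F 0 + F 1 + F 2 + F 3 + F 4 + F 5 + F 6 + F 7.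
Proof.
rewrite !big_ord_recl big_ord0 /= addr0 !addrA.
by congr (F _ + F _ + F _ + F _ + F _ + F _ + F _ + F _); apply: val_inj.
Qed.

Lemma lin_eval1 (R : realType) (n : torsion_name) (tau : torsion_name -> R[i]) :
  lin_eval [:: (1, false, n)] tau = tau n.
Proof. by rewrite /lin_eval big_cons big_nil /= mul1r addr0. Qed.

Lemma lin_eval_X1 (R : realType) (tau : torsion_name -> R[i]) :
  lin_eval (X1 R) tau = tau U2 + 2 * tau W8 + (tau W8)^*.
Proof. by rewrite /lin_eval !big_cons big_nil /= !mul1r addr0 addrA. Qed.

Lemma lin_eval_X2 (R : realType) (tau : torsion_name -> R[i]) :
  lin_eval (X2 R) tau = (tau U1)^* + tau V2 + (tau W6)^*.
Proof. by rewrite /lin_eval !big_cons big_nil /= !mul1r addr0 addrA. Qed.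

(** Vanishing on all translations is what makes a combination essential. For [k] beyond the list,
    [nth] returns the empty combination, which evaluates to zero. *)
Lemma further_torsions_shift (R : realType) k (l m : 'I_5 -> R[i]) :
  lin_eval (nth [::] (further_torsions R) k) (fun n => torsion_shift n l m) = 0.
Proof.
case: k => [|[|[|[|[|[|[|[|k]]]]]]]] /=; rewrite ?lin_eval1//.
- by rewrite lin_eval_X1 /= conjN; ring.
- by rewrite lin_eval_X2 /= !(conjD, conjN, conjM, conjn) conjCK; ring.
- by rewrite nth_nil /lin_eval big_nil.
Qed.

Section EssentialTorsion.
Variables (R : realType) (Omega : set 'rV[R]_5) (Lb : vfield R 4).
Variables (fP fQ fR fB : 'rV[R]_5 -> R[i]) (fA : 'rV[R]_5 -> R).
Notation C := R[i].
Hypothesis oO : open Omega.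
Hypothesis sLb : smooth_mx Omega Lb.
Hypothesis frameU : maximally_minimal Lb Omega.
Hypothesis str : structure_functions Lb Omega fP fQ fR fB fA.
Hypothesis R0 : forall p, Omega p -> fR p = 0.

Notation valb := (value_b fQ fB).
Notation valc := (value_c fB).
Notation vald := (value_d Lb fP fQ fB).
Notation D := (lifted_domain Omega).
Notation eqs := (structure_equations Lb valb valc vald Omega).
Notation modif := (modify Lb valb valc vald).
Notation tors := (tors Lb fP fQ fB).
Let tors_iff := torsion_iff oO sLb frameU str R0.

Lemma modify0 (B : form1 R 8) : modif (fun _ _ => 0) B = B.
Proof.
have E (u v w x y z : 'rV[C]_9) :
    u + 0 *: v + 0 *: w + 0 *: x + 0 *: y + 0 *: z = u by rewrite !scale0r !addr0.
by apply/funext => q; exact: E.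
Qed.

Lemma torsion_shift0 n : torsion_shift n (fun=> 0) (fun=> 0) = 0 :> C.
Proof. by case: n => /=; rewrite ?conjC0 ?mulr0 ?addr0 ?subr0 ?oppr0. Qed.

Lemma torsion0_iff (t : torsion R) : eqs (@beta1 R) (@beta2 R) t <->
  forall q, D q -> forall n, t n q = tors n q.
Proof.
rewrite -[in eqs _](modify0 (@beta1 R)) -[in eqs _ _](modify0 (@beta2 R)).
split=> [/tors_iff E q Dq n|E]; first by rewrite E// torsion_shift0 addr0.
by apply/tors_iff => q Dq n; rewrite E// torsion_shift0 addr0.
Qed.

Lemma essential_further k :
  essential Lb valb valc vald Omega (nth [::] (further_torsions R) k).
Proof.
move=> l1 l2 t t' /torsion0_iff E /tors_iff E' q Dq.
rewrite !lincomb_evalE (eq_lin_eval _ (E q Dq)) (eq_lin_eval _ (E' q Dq)).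
by rewrite lin_evalD further_torsions_shift addr0.
Qed.

(** An essential combination may be evaluated on any solution, in particular on the reduced one,
    where just the eight functions survive; its coefficients on those slots give [k1] and [k2]. *)
Lemma essential_lincomb (s : lincomb R) : essential Lb valb valc vald Omega s ->
  exists k1 k2 : 'I_8 -> C, forall q, D q ->
    lincomb_eval s tors q =
      \sum_i (k1 i * lincomb_eval (nth [::] (further_torsions R) i) tors q
        + k2 i * (lincomb_eval (nth [::] (further_torsions R) i) tors q)^*).
Proof.
move=> ess.
(* In the reduced solution [U2] has become [X1] and [U1] the conjugate of [X2]; hence the flags of
   the last entries are exchanged between [k1] and [k2]. *)
exists (fun i : 'I_8 => nth 0 [:: lin_coef false s V1; lin_coef false s V3;
  lin_coef false s V4; lin_coef false s W5; lin_coef false s W7; lin_coef false s W9;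
  lin_coef false s U2; lin_coef true s U1] i).
exists (fun i : 'I_8 => nth 0 [:: lin_coef true s V1; lin_coef true s V3;
  lin_coef true s V4; lin_coef true s W5; lin_coef true s W7; lin_coef true s W9;
  lin_coef true s U2; lin_coef false s U1] i).
move=> q Dq.
have [u5 u6 u7] := tors_U5_U6_U7 oO sLb frameU str R0 Dq.
have y1 := tors_U3_V8_W10 oO sLb frameU str R0 Dq.
have y2 := tors_U4_V8_W10 oO sLb frameU str R0 Dq.
(* The modification has constant coefficients tuned to the single point [q], the only one at which
   the comparison is made. *)
pose l j (_ : 'rV[R]_(5 + 4)) := reduce_l (tors^~ q) j.
pose m j (_ : 'rV[R]_(5 + 4)) := reduce_m (tors^~ q) j.
pose t' n q' := tors n q' + torsion_shift n (l^~ q') (m^~ q').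
have E0 : eqs (@beta1 R) (@beta2 R) tors by apply/torsion0_iff.
have E1 : eqs (modif l (@beta1 R)) (modif m (@beta2 R)) t' by apply/tors_iff.
rewrite -(ess l m tors t' E0 E1 q Dq) lincomb_evalE.
rewrite (eq_lin_eval _ (shift_reduced u5 u6 u7 y1 y2)) lin_eval_reduced big_ord8 /=.
by rewrite !lincomb_evalE !lin_eval1 lin_eval_X1 lin_eval_X2 conjCK
  [in RHS](addrC (lin_coef true s U1 * _)).
Qed.

End EssentialTorsion.

Theorem lemma1p9 (R : realType) :
  exists P1 P2 : jetpoly R,
  forall (Omega : set 'rV[R]_5) (phi : 'I_3 -> 'rV[R]_5 -> R)
    (Lb : vfield R 4) (fP fQ fR fB : 'rV[R]_5 -> R[i]) (fA : 'rV[R]_5 -> R),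
  CR_generic_graph Omega phi ->
  intrinsic_generator Omega phi Lb ->
  maximally_minimal Lb Omega ->
  structure_functions Lb Omega fP fQ fR fB fA ->
  (forall p, Omega p -> fR p = 0) ->
  let L := vapp (fieldL Lb) in
  let Lbar := vapp Lb in
  let Bbar := fun p => (fB p)^* in
  let Qbar := fun p => (fQ p)^* in
  let b := value_b fQ fB in
  let c := value_c fB in
  let d := value_d Lb fP fQ fB in
  let eqs := structure_equations Lb b c d Omega in
  let D := lifted_domain Omega in
  (* the torsion coefficients are well defined, also after modification of
     beta1 and beta2 *)
  (forall l1 l2 : 'I_5 -> 'rV[R]_(5 + 4) -> R[i],
     let b1 := modify Lb b c d l1 (@beta1 R) in
     let b2 := modify Lb b c d l2 (@beta2 R) in
     (exists t, eqs b1 b2 t) /\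
     (forall t t', eqs b1 b2 t -> eqs b1 b2 t' ->
        forall n q, D q -> t n q = t' n q)) /\
  exists2 t : torsion R, eqs (@beta1 R) (@beta2 R) t &
  [/\ (* the eight functions are essential, and every essential function is now
         a combination of them and of their conjugates *)
      (forall k : 'I_8,
         essential Lb b c d Omega (nth [::] (further_torsions R) k)) /\
      (forall l : lincomb R, essential Lb b c d Omega l ->
         exists k1 k2 : 'I_8 -> R[i], forall q, D q ->
         lincomb_eval l t q =
           \sum_i (k1 i * lincomb_eval (nth [::] (further_torsions R) i) t q
             + k2 i * (lincomb_eval (nth [::] (further_torsions R) i) t q)^*)),
      (* V4 determines e *)
      forall q, D q -> (t V4 q = 0 <-> par_e q = value_e Lb fQ fB fA q)
    & (* values of the torsion functions for this e *)
      forall q, D q -> par_e q = value_e Lb fQ fB fA q ->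
      let p := base q in
      let a := par_a q in
      let abar := (par_a q)^* in
      [/\ t V3 q = 0 /\ t W7 q = 0 /\ lincomb_eval (X2 R) t q = 0,
          t V1 q = (a ^+ 2 * abar ^+ 2)^-1 * jetpoly_eval Lb fP fQ fR fB fA P1 p,
          t W5 q = (a * abar ^+ 3)^-1 * jetpoly_eval Lb fP fQ fR fB fA P2 p,
          t W9 q = 'i / (9 * abar ^+ 2) *
            (18 * Lbar fB p - 3 * Lbar Qbar p - 9 * (fP p)^*
             - 12 * fB p * Qbar p + 9 * fB p ^+ 2 + Qbar p ^+ 2)
        & lincomb_eval (X1 R) t q = - ('i / (9 * a * abar)) *
            (6 * Lbar fQ p + 6 * L Qbar p - 18 * L fB p - 18 * Lbar Bbar p
             + 27 * fB p * Bbar p - 6 * fB p * fQ p - 6 * Bbar p * Qbar p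
             + 2 * fQ p * Qbar p + 9 * (fA p)%:C%C)]].
Proof.
exists (poly_V1 R), (poly_W5 R) => Omega phi Lb fP fQ fR fB fA G gen frameU str R0.
have sLb := smooth_generator G gen; have oO := graph_open G.
move=> L Lbar Bbar Qbar b c d eqs D.
have tors_iff := torsion_iff oO sLb frameU str R0.
split.
  move=> l1 l2 b1 b2; split.
    exists (fun n q => tors Lb fP fQ fB n q + torsion_shift n (l1^~ q) (l2^~ q)).
    exact/tors_iff.
  by move=> t t' /tors_iff E /tors_iff E' n q Dq; rewrite E// E'.
exists (tors Lb fP fQ fB); first exact/(torsion0_iff oO sLb frameU str R0).
split.
- split; first exact: (essential_further oO sLb frameU str R0).
  exact: (essential_lincomb oO sLb frameU str R0).
- move=> q Dq; exact: (tors_V4 oO sLb frameU str R0 Dq).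
- move=> q Dq eE p a ab; split.
  + split; first exact: (tors_V3 oO sLb frameU str R0 Dq).
    split; first exact: (tors_W7 oO sLb frameU str R0 Dq).
    exact: (tors_X2 oO sLb frameU str R0 Dq).
  + exact: (tors_V1 oO sLb frameU str R0 Dq eE).
  + exact: (tors_W5 oO sLb frameU str R0 Dq eE).
  + exact: (tors_W9 oO sLb frameU str R0 Dq).
  + exact: (tors_X1 oO sLb frameU str R0 Dq eE).
Qed.
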